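(* Let $T>0$, $p\ge1$, $\alpha\in(0,1)$, and $u_0\in\mathcal H^{1+\eta}(\mathbb T^2)\cap W^{1,\infty}(\mathbb T^2)$ for some $\eta\in(0,4)$. For $N\in\mathbb N$ define $t_N=N^{-\frac{2\alpha p}{p+2}}$, let $f(z)=\frac{z}{1+|z|^2}$ for $z\in\mathbb R^2$, and let $u^{(N)}$ be the mild solution of the regularized SPDE (defined in the context). Then there are a constant $C=C(\alpha,p,\sigma,L,T,\|u_0\|_{W^{1,\infty}})>0$ and $N_0\in\mathbb N$ such that for all $N\ge N_0$, $$\sup_{t\in[t_N,T]}\ \sup_{x\in\mathbb T^2}\ \mathbb E\left|f\left(\nabla u^{(N)}(t,x)\right)\right|^p\le C\,N^{-\frac{2\alpha p}{p+2}}.$$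
   Context: $\mathbb T^2=[0,L]^2$ is the two-dimensional torus of side length $L>0$ (periodic boundary conditions). For $k=(k_1,k_2)\in\mathbb Z^2$, $e_k(x)=\omega_{k_1}(x_1)\omega_{k_2}(x_2)$, where $\omega_j(z)=\sqrt{2/L}\,\sin(2\pi jz/L)$ for $j>0$, $\omega_0(z)=1/\sqrt L$, $\omega_j(z)=\sqrt{2/L}\,\cos(2\pi jz/L)$ for $j<0$; these form an orthonormal basis of $L^2(\mathbb T^2)$ with $-\Delta e_k=\mu_ke_k$, $\mu_k=(2\pi|k|/L)^2$, $|k|$ the Euclidean norm. For $s\in\mathbb R$, $\mathcal H^s=\mathcal H^s(\mathbb T^2)$ is the space of mean-zero $u=\sum_{k\in\mathbb Z^2\setminus\{0\}}u_ke_k$ with $\|u\|_{\mathcal H^s}^2=\sum_{k\ne0}\mu_k^s|u_k|^2<\infty$. $A=-\Delta^2$, so $e^{tA}\sum_{k\neq0}u_ke_k=\sum_{k\neq0}e^{-t\mu_k^2}u_ke_k$. $\mathfrak F(u)=-\nabla\cdot f(\nabla u)\in\mathcal H^{-1}$ for $u\in\mathcal H^1$. $(\beta_k)_{k\in\mathbb Z^2\setminus\{0\}}$ are i.i.d. standard real Brownian motions, $Z_k(t)=\int_0^te^{-(t-s)\mu_k^2}\,d\beta_k(s)$, and $P_NZ^{(\alpha)}(t)=\sum_{0<|k|\le N}\mu_k^{\alpha/2}Z_k(t)e_k$. The noise intensity $\sigma>0$ is fixed. For $N\in\mathbb N$, $u^{(N)}$ is the mild solution ($\mathcal H^1$-valued,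 time-continuous process) of $$u^{(N)}(t)=e^{tA}u_0+\int_0^te^{(t-s)A}\mathfrak F(u^{(N)}(s))\,ds+\sigma P_NZ^{(\alpha)}(t),\quad t\in[0,T].$$ *)

(* Defs.v *)
From HB Require Import structures.
From mathcomp Require Import all_boot all_order all_algebra.
From mathcomp Require Import all_classical all_reals all_analysis.

Set Implicit Arguments.
Unset Strict Implicit.
Unset Printing Implicit Defensive.

Import Order.TTheory GRing.Theory Num.Theory.
Import numFieldNormedType.Exports.

Local Open Scope classical_set_scope.
Local Open Scope ring_scope.

Notation leb2 R := (@lebesgue_measure R \x @lebesgue_measure R)%E.

(** Functions on the torus [T^2 = [0,L]^2] are functions on [R * R], L-periodic
    in each variable; integrals are taken over the closed cell [torus L]. *)
Section Torus.
Context {R : realType}.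
Implicit Types (L : R) (x z : R * R) (u v phi : R * R -> R).

Definition torus L : set (R * R) := `[0, L]%classic `*` `[0, L]%classic.

Definition torus_periodic L u :=
  forall x, u (x.1 + L, x.2) = u x /\ u (x.1, x.2 + L) = u x.

Definition enorm z : R := Num.sqrt (z.1 ^+ 2 + z.2 ^+ 2).

Definition dot z x : R := z.1 * x.1 + z.2 * x.2.

Definition partial1 u x : R := derive1 (fun a : R => u (a, x.2)) x.1.
Definition partial2 u x : R := derive1 (fun a : R => u (x.1, a)) x.2.

Definition grad u x : R * R := (partial1 u x, partial2 u x).

Fixpoint Ck (n : nat) u : Prop :=
  continuous u /\
  if n is n'.+1 then
    [/\ (forall x, derivable (fun a : R => u (a, x.2)) x.1 1),
        (forall x, derivable (fun a : R => u (x.1, a)) x.2 1),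
        Ck n' (partial1 u) & Ck n' (partial2 u)]
  else True.

Definition smooth u := forall n, Ck n u.

Definition is_weak_grad L u (G : R * R -> R * R) :=
  [/\ measurable_fun (torus L) (fun x => (G x).1),
      measurable_fun (torus L) (fun x => (G x).2) &
      forall phi, smooth phi -> torus_periodic L phi ->
        (\int[leb2 R]_(x in torus L) (u x * partial1 phi x) =
           - \int[leb2 R]_(x in torus L) ((G x).1 * phi x))%R /\
        (\int[leb2 R]_(x in torus L) (u x * partial2 phi x) =
           - \int[leb2 R]_(x in torus L) ((G x).2 * phi x))%R].

Definition Linfty_norm L u : \bar R :=
  'N[leb2 R]_+oo [(EFin \o u) \_ (torus L)].

(** [u] belongs to [W^{1,oo}(T^2)] and its norm there, taken to be
    [|u|_oo + | |grad u| |_oo], is [m]. *)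
Definition W1infty_with_norm L u (m : R) :=
  [/\ torus_periodic L u, measurable_fun (torus L) u &
      exists G, is_weak_grad L u G /\
        (Linfty_norm L u + Linfty_norm L (enorm \o G))%E = m%:E].

End Torus.

(** An element [\sum_(k != 0) u_k e_k] of [H^s] is the family of its
    coefficients, with [u_0 = 0]. *)
Section Fourier.
Context {R : realType}.
Implicit Types (L s t : R) (k : int * int) (c : int * int -> R) (x z : R * R).

Definition omega L (j : int) (z : R) : R :=
  if (0 < j)%R then Num.sqrt (2 / L) * sin (2 * pi * j%:~R * z / L)
  else if j == 0 then (Num.sqrt L)^-1
  else Num.sqrt (2 / L) * cos (2 * pi * j%:~R * z / L).

Definition ebasis L k x : R := omega L k.1 x.1 * omega L k.2 x.2.

Definition knorm k : R := enorm (k.1%:~R, k.2%:~R).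

Definition mu L k : R := (2 * pi * knorm k / L) ^+ 2.

Definition nonzero k := k <> (0, 0).

Definition Hnorm2 L s c : \bar R :=
  \esum_(k in nonzero) (mu L k `^ s * c k ^+ 2)%:E.

Definition Hs L s c := c (0, 0) = 0 /\ (Hnorm2 L s c < +oo)%E.

Definition fourier L (u : R * R -> R) k : R :=
  (\int[leb2 R]_(x in torus L) (u x * ebasis L k x))%R.

Definition kball (M : R) : set (int * int) :=
  [set k | 0 < knorm k <= M].

Definition partial_sum L c (n : nat) x : R :=
  \sum_(k \in kball n%:R) c k * ebasis L k x.

(** [v = \sum_(k != 0) c k e_k] in [L^2(T^2)]. *)
Definition L2_sum L c (v : R * R -> R) :=
  measurable_fun (torus L) v /\
  (\int[leb2 R]_(x in torus L) ((v x - partial_sum L c n x) ^+ 2)%:E)%E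
    @[n --> \oo] --> 0%E.

(** [G = \sum_(k != 0) c k (grad e_k)] in [L^2(T^2; R^2)]. *)
Definition L2_grad L c (G : R * R -> R * R) :=
  [/\ measurable_fun (torus L) (fun x => (G x).1),
      measurable_fun (torus L) (fun x => (G x).2) &
      (\int[leb2 R]_(x in torus L)
        (enorm (G x - grad (partial_sum L c n) x) ^+ 2)%:E)%E
      @[n --> \oo] --> 0%E].

(** The gradient of [c] in [H^1], as an element of [L^2(T^2; R^2)]; it is
    determined up to a null set. *)
Definition wgrad L c : R * R -> R * R :=
  xget (fun _ => (0, 0)) [set G | L2_grad L c G].

(** The nonlinearity [z / (1 + |z|^2)]. *)
Definition fnl z : R * R :=
  (z.1 / (1 + enorm z ^+ 2), z.2 / (1 + enorm z ^+ 2)).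

(** The coefficients of [- div f(grad c)] in [H^-1], that is its duality
    pairings with the [e_k]. *)
Definition frakF L c k : R :=
  (\int[leb2 R]_(x in torus L)
     dot (fnl (wgrad L c x)) (grad (ebasis L k) x))%R.

(** [v] is a continuously differentiable function on the torus equal to [c];
    there is at most one such [v]. *)
Definition is_C1_repr L c v := [/\ torus_periodic L v, Ck 1 v & L2_sum L c v].

Definition has_C1_repr L c := exists v, is_C1_repr L c v.

(** Pointwise gradient of an element of [H^1] that is continuously
    differentiable; meaningful only under [has_C1_repr L c]. *)
Definition grad_at L c x : R * R :=
  grad (xget (fun _ => 0) [set v | is_C1_repr L c v]) x.

End Fourier.

Section Probability.
Context {R : realType} {d : measure_display} {Omega : measurableType d}.
Variable P : probability Omega R.

(** The sigma-algebra generated by the random variables [X i], [i] in [D]. *)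
Definition sigma_gen {I : Type} (D : set I) (X : I -> Omega -> R) :
    set (set Omega) :=
  <<s [set A | exists2 i, D i &
         exists2 B : set R, measurable B & A = X i @^-1` B] >>.

(** Mutual independence of the families of events [F i], [i] in [D]. *)
Definition mutually_indep {I : eqType} (D : set I) (F : I -> set (set Omega)) :=
  forall (r : seq I) (A : I -> set Omega), uniq r ->
    (forall i, i \in r -> D i /\ F i (A i)) ->
    P (\bigcap_(i in [set` r]) A i) = (\prod_(i <- r) P (A i))%E.

(** Standard real Brownian motion on [0, +oo[. The second parameter of
    [normal_prob] is the standard deviation. *)
Definition brownian (b : R -> Omega -> R) :=
  [/\ (forall t : R, 0 <= t -> measurable_fun setT (b t)),
      {ae P, forall w, b 0 w = 0},
      (forall tt : nat -> R, 0 <= tt 0%N -> nondecreasing_seq tt ->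
         mutually_indep setT
           (fun i => sigma_gen [set: unit]
                       (fun _ w => b (tt i.+1) w - b (tt i) w))),
      (forall s t : R, 0 <= s -> s < t -> forall B : set R, measurable B ->
         P ((fun w => b t w - b s w) @^-1` B) =
         normal_prob 0 (Num.sqrt (t - s)) B) &
      {ae P, forall w, {within `[0, +oo[, continuous (fun t => b t w)}}].

Definition iid_brownian (beta : int * int -> R -> Omega -> R) :=
  (forall k, nonzero k -> brownian (beta k)) /\
  mutually_indep nonzero
    (fun k => sigma_gen [set t | 0 <= t] (beta k)).

(** [I] is the stochastic integral over [[0, t]] of the continuous
    deterministic function [g] against [b]: the limit in [L^2(P)] of the
    left-point Riemann sums. *)
Definition wiener_integral (b : R -> Omega -> R) (g : R -> R) (t : R)
    (I : Omega -> R) :=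
  measurable_fun setT I /\
  (\int[P]_w ((I w - \sum_(i < n.+1)
       g (t * i%:R / n.+1%:R) *
       (b (t * i.+1%:R / n.+1%:R) w - b (t * i%:R / n.+1%:R) w)) ^+ 2)%:E)%E
    @[n --> \oo] --> 0%E.

(** [Z k t] is the stochastic integral of [e^{-(t - s) mu_k^2}] over [[0, t]]
    against [beta k]. *)
Definition stoch_conv (L : R) (beta Z : int * int -> R -> Omega -> R) :=
  forall k, nonzero k -> forall t : R, 0 <= t ->
    wiener_integral (beta k)
      (fun s => expR (- ((t - s) * mu L k ^+ 2))) t (Z k t).

Definition PNZ (L alpha : R) (Z : int * int -> R -> Omega -> R) (N : nat)
    (t : R) (w : Omega) (k : int * int) : R :=
  if 0 < @knorm R k <= N%:R then mu L k `^ (alpha / 2) * Z k t w else 0.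

(** Mild solution on [[0, T]]: an [H^1]-valued, time-continuous process
    satisfying, for each [t], almost surely, the mild equation, read on the
    coefficients; part of the requirement is that the time integrals make
    sense. *)
Definition mild_solution (L T alpha sigma : R) (u0 : int * int -> R)
    (Z : int * int -> R -> Omega -> R) (N : nat)
    (u : R -> Omega -> int * int -> R) :=
  [/\ (forall t : R, 0 <= t <= T -> forall k,
         measurable_fun setT (fun w => u t w k)),
      {ae P, forall w, forall t : R, 0 <= t <= T -> Hs L 1 (u t w)},
      {ae P, forall w, forall t : R, 0 <= t <= T ->
         Hnorm2 L 1 (fun k => u s w k - u t w k)
           @[s --> within `[0, T]%classic (nbhs t)] --> 0%E} &
      (forall t : R, 0 <= t <= T -> {ae P, forall w, forall k, nonzero k ->
         (@lebesgue_measure R).-integrable `[0, t]%classic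
           (fun s => (expR (- ((t - s) * mu L k ^+ 2)) *
                      frakF L (u s w) k)%:E) /\
         u t w k =
           expR (- (t * mu L k ^+ 2)) * u0 k +
           (\int[@lebesgue_measure R]_(s in `[0, t]%classic)
              (expR (- ((t - s) * mu L k ^+ 2)) * frakF L (u s w) k))%R +
           sigma * PNZ L alpha Z N t w k})].

End Probability.

(* Main.v *)
Require Import Defs.
From HB Require Import structures.
From mathcomp Require Import all_boot all_order all_algebra.
From mathcomp Require Import all_classical all_reals all_analysis.
From mathcomp Require Import measurable_realfun.
From mathcomp Require Import ring lra zify.

Set Implicit Arguments.
Unset Strict Implicit.
Unset Printing Implicit Defensive.

Import Order.TTheory GRing.Theory Num.Theory.
Import numFieldNormedType.Exports.
Local Open Scope classical_set_scope.
Local Open Scope ring_scope.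

(** At time [t] and point [x] the gradient of the solution splits as
    [h + V + X]: the gradient [h] of [e^{tA} u_0] is deterministic; the gradient
    [V] of the nonlinear convolution is bounded by a constant [D] that depends
    on [L] and [T] only; and the gradient [X] of the truncated stochastic
    convolution is a centred Gaussian vector of the plane whose covariance
    matrix is [s^2 I] with [s^2 >= c N^{2 alpha}]. Since
    [|f z| <= min (1, 1 / |z|)], for every [r > 0]

      [E |f (h + V + X)|^p <= P (|h + X| <= 2 r + 2 D) + r^{-p}].

    A planar Gaussian vector of covariance [s^2 I] gives mass at most
    [C rho^2 / s^2] to every disc of radius [rho], wherever its centre is. So
    the first term is [O (r^2 N^{-2 alpha})] as soon as [r >= 1], and
    [r = N^{2 alpha / (p + 2)}] makes both terms of order
    [N^{-2 alpha p / (p + 2)}].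

    Drift. Because [f] is bounded, Bessel's inequality bounds the family
    [<f(grad u), grad e_k> / |k|] in [l^2] ([frakF_bessel]). Smoothing through
    [e^{-y} <= y^{-7/8}] costs the integrable singularity [(t - s)^{-7/8}] in
    time and leaves the convergent lattice sum of [|k|^{-3}], so that the
    Fourier series of [V] converges absolutely with a deterministic bound
    ([convolution_bound]). Absolute convergence also gives the continuously
    differentiable representative of the solution and its gradient
    ([crepr_spec], [C1_repr_unique], [grad_atE]).

    Noise. The Riemann sums of the stochastic integrals are linear in
    independent normal increments. Averaging the Gaussian kernel of covariance
    [S] over an independent increment of covariance [B] yields the kernel of
    covariance [S + B] ([integral_gauss2_normal]); iterated, this gives the mass
    of discs under a Riemann sum ([gaussian_small_ball]). The symmetries
    [k -> (-k_1, k_2)], [(k_1, -k_2)], [(k_2, k_1)] of the set of modes make the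
    covariance scalar ([sum_cross0], [sum_diag1], [sum_diag2]), the modes of size
    comparable to [N] bound it from below ([radial_mass_ge]), and Chebyshev's
    inequality carries the bound to the limit ([noise_small_ball]). *)

(** * The planar Gaussian kernel *)

(** [2 pi] times the density at [x] of the centred normal law of the plane with
    covariance matrix of rows [(a, b)] and [(b, c)]. *)
Definition gauss2 (R : realType) (a b c : R) (x : R * R) : R :=
  (Num.sqrt (a * c - b ^+ 2))^-1 *
  expR (- (c * x.1 ^+ 2 - 2 * b * x.1 * x.2 + a * x.2 ^+ 2) /
        (2 * (a * c - b ^+ 2))).

Lemma normal_pdf_expand (R : realType) (m s x : R) : 0 < s ->
  normal_pdf m s x = (Num.sqrt (2 * pi * s ^+ 2))^-1 *
                     expR (- (x - m) ^+ 2 / (2 * s ^+ 2)).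
Proof.
move=> s0; rewrite normal_pdfE ?gt_eqF// /normal_peak /normal_fun.
have E (y : R) : y *+ 2 = 2 * y by rewrite mulr_natl.
by rewrite (E (s ^+ 2)) (E (s ^+ 2 * pi)) (mulrC (s ^+ 2) pi) mulrA.
Qed.

(** Completing the square: with [Sigma] the matrix [(a, b; b, c)] and
    [B = (b1, b2)], the joint density of [x + xi B] and [xi] factors into the
    kernel of covariance [Sigma + s^2 B B^T] at [x] and a normal density in
    [xi]. [D] and [D'] are the determinants of the two covariance matrices. *)
Lemma gauss2_convolution (R : realType) (a b c s b1 b2 xi : R) (x : R * R) :
  0 < a -> 0 < a * c - b ^+ 2 -> 0 < s ->
  let D := a * c - b ^+ 2 in
  let D' := D + s ^+ 2 * (a * b2 ^+ 2 - 2 * b * b1 * b2 + c * b1 ^+ 2) in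
  let p := c * x.1 * b1 - b * (x.1 * b2 + x.2 * b1) + a * x.2 * b2 in
  0 < D' /\
  gauss2 a b c (x.1 + b1 * xi, x.2 + b2 * xi) * normal_pdf 0 s xi =
  gauss2 (a + s ^+ 2 * b1 ^+ 2) (b + s ^+ 2 * b1 * b2) (c + s ^+ 2 * b2 ^+ 2) x *
  normal_pdf (- (s ^+ 2 * p / D')) (s * Num.sqrt (D / D')) xi.
Proof.
move=> a0; set D := a * c - b ^+ 2 => D0 s0 /=.
set q := a * b2 ^+ 2 - 2 * b * b1 * b2 + c * b1 ^+ 2.
set p := c * x.1 * b1 - b * (x.1 * b2 + x.2 * b1) + a * x.2 * b2.
have q0 : 0 <= q.
  have -> : q = ((a * b2 - b * b1) ^+ 2 + D * b1 ^+ 2) / a.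
    by rewrite /q /D; field; rewrite gt_eqF.
  by rewrite divr_ge0 ?(ltW a0)// addr_ge0 ?sqr_ge0// mulr_ge0 ?sqr_ge0 ?ltW.
set D' := D + s ^+ 2 * q.
have D'0 : 0 < D' by rewrite ltr_pwDl// mulr_ge0// sqr_ge0.
split=> //.
have DE : (a + s ^+ 2 * b1 ^+ 2) * (c + s ^+ 2 * b2 ^+ 2) -
          (b + s ^+ 2 * b1 * b2) ^+ 2 = D'.
  by rewrite /D' /D /q; ring.
have tau0 : 0 < s * Num.sqrt (D / D') by rewrite mulr_gt0// sqrtr_gt0 divr_gt0.
rewrite !normal_pdf_expand// /gauss2 DE -/D subr0.
rewrite mulrACA [RHS]mulrACA -!expRD.
have tau2 : (s * Num.sqrt (D / D')) ^+ 2 = s ^+ 2 * (D / D').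
  by rewrite exprMn sqr_sqrtr// divr_ge0 ?ltW.
rewrite tau2; congr (_ * expR _).
  rewrite -!invfM -!sqrtrM ?ltW//; congr (Num.sqrt _)^-1.
  by field; rewrite gt_eqF.
pose Q := c * x.1 ^+ 2 - 2 * b * x.1 * x.2 + a * x.2 ^+ 2.
pose r := (b2 * x.1 - b1 * x.2) ^+ 2.
rewrite (_ : c * _ ^+ 2 - _ + _ = Q + 2 * p * xi + q * xi ^+ 2); last first.
  by rewrite /Q /p /q /=; ring.
rewrite (_ : _ * x.1 ^+ 2 - _ + _ = Q + s ^+ 2 * r); last first.
  by rewrite /Q /r; ring.
have D1 : D != 0 by rewrite gt_eqF.
have D2 : D' != 0 by rewrite gt_eqF.
have s1 : s != 0 by rewrite gt_eqF.
(* the Lagrange identity for the quadratic form of the matrix *)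
have rE : r = (q * Q - p ^+ 2) / D.
  have -> : q * Q - p ^+ 2 = r * D by rewrite /q /Q /p /r /D; ring.
  by rewrite mulfK.
have qE : q = (D' - D) / s ^+ 2.
  by rewrite /D' addrAC subrr add0r mulrAC divff ?mul1r// expf_neq0.
rewrite rE qE; clearbody q r D' p Q D; clear -D1 D2 s1.
by field; rewrite D1 D2 s1.
Qed.

Lemma bounded_integrable d (T : measurableType d) (R : realType)
    (mu : {measure set T -> \bar R}) (A : set T) (f : T -> R) (M : R) :
  measurable A -> (mu A < +oo)%E -> measurable_fun A f ->
  (forall x, A x -> `|f x| <= M) -> mu.-integrable A (EFin \o f).
Proof.
move=> mA Aoo mf fM; apply: measurable_bounded_integrable => //.
exists M; split; first exact: num_real.
by move=> x Mx y Ay /=; exact: le_trans (fM _ Ay) (ltW Mx).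
Qed.

Lemma integral_normal_prob (R : realType) (s M : R) (f : R -> R) :
  measurable_fun setT f -> (forall x, 0 <= f x <= M) ->
  (\int[normal_prob 0 s]_x (f x)%:E =
   \int[@lebesgue_measure R]_x (f x * normal_pdf 0 s x)%:E)%E.
Proof.
move=> mf fM.
have dom := normal_prob_dominates (0 : R) s.
have mf' := mf; move/measurable_EFinP in mf'.
have fi : (normal_prob 0 s).-integrable setT (EFin \o f).
  apply: (bounded_integrable (M := M)) => //.
    by rewrite (le_lt_trans (probability_le1 _ _))// ltry.
  by move=> x _; have /andP[f0 fl] := fM x; rewrite ger0_norm.
rewrite -(Radon_Nikodym_change_of_variables dom)//=.
under [RHS]eq_integral do rewrite EFinM.
apply: ae_eq_integral => //.
- apply: emeasurable_funM; first exact: mf'.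
  apply: (measurable_int (@lebesgue_measure R)).
  by apply: Radon_Nikodym_integrable; exact: dom.
- apply: emeasurable_funM; first exact: mf'.
  apply/measurable_EFinP.
  exact: measurable_normal_pdf.
- apply: ae_eqe_mul2l.
  rewrite Radon_NikodymE//=; case: cid => /= h [h1 h2 h3].
  apply: integral_ae_eq => //=.
  + by apply/measurable_EFinP; exact: measurable_normal_pdf.
  + by move=> E E01 mE; rewrite -h3.
Qed.

Lemma gauss2_ge0 (R : realType) (a b c : R) x : 0 <= gauss2 a b c x.
Proof. by rewrite mulr_ge0 ?expR_ge0// invr_ge0 sqrtr_ge0. Qed.

Lemma measurable_gauss2 (R : realType) (a b c : R) d (T : measurableType d)
    (f g : T -> R) : measurable_fun setT f -> measurable_fun setT g ->
  measurable_fun setT (fun t => gauss2 a b c (f t, g t)).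
Proof.
move=> mf mg; apply: measurable_funM => //=; apply: measurableT_comp => //=.
apply: measurable_funM => //=; apply: measurableT_comp => //=.
apply: measurable_funD => //=; last first.
  by apply: measurable_funM => //; exact: measurable_funX.
apply: measurable_funB => /=.
  by apply: measurable_funM => //; exact: measurable_funX.
by do 2 apply: measurable_funM => //.
Qed.

Lemma gauss2_le (R : realType) (a b c : R) x : 0 < a -> 0 < a * c - b ^+ 2 ->
  gauss2 a b c x <= (Num.sqrt (a * c - b ^+ 2))^-1.
Proof.
move=> a0 D0; rewrite /gauss2 ler_piMr ?invr_ge0 ?sqrtr_ge0// -[leRHS]expR0 ler_expR.
rewrite mulNr oppr_le0; apply: divr_ge0; last by rewrite mulr_ge0// ltW.
have -> : c * x.1 ^+ 2 - 2 * b * x.1 * x.2 + a * x.2 ^+ 2 =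
    ((a * x.2 - b * x.1) ^+ 2 + (a * c - b ^+ 2) * x.1 ^+ 2) / a.
  by field; rewrite gt_eqF.
by rewrite divr_ge0 ?(ltW a0)// addr_ge0 ?sqr_ge0// mulr_ge0 ?sqr_ge0 ?ltW.
Qed.

(** Convolving with a normal law on a line adds the covariances. *)
Lemma integral_gauss2_normal (R : realType) (a b c s b1 b2 : R) (x : R * R) :
  0 < a -> 0 < a * c - b ^+ 2 -> 0 < s ->
  (\int[normal_prob 0 s]_xi (gauss2 a b c (x.1 + b1 * xi, x.2 + b2 * xi))%:E =
  (gauss2 (a + s ^+ 2 * b1 ^+ 2) (b + s ^+ 2 * b1 * b2)
     (c + s ^+ 2 * b2 ^+ 2) x)%:E)%E.
Proof.
move=> a0 D0 s0.
have mg : measurable_fun setT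
    (fun xi => gauss2 a b c (x.1 + b1 * xi, x.2 + b2 * xi)).
  by apply: measurable_gauss2; apply: measurable_funD => //;
    exact: measurable_funM.
rewrite (integral_normal_prob s mg (M := (Num.sqrt (a * c - b ^+ 2))^-1)); last first.
  by move=> xi; rewrite gauss2_ge0 gauss2_le.
under eq_integral do rewrite (gauss2_convolution _ _ _ _ a0 D0 s0).2 EFinM.
rewrite integralZl//; last exact: integrable_normal_pdf.
by rewrite integral_normal_pdf mule1.
Qed.

(** * Independence and sums of normal variables *)

(** Independence of the finite family [xi i], [i] in [J]; a factor is dropped by
    taking [B i] to be the whole line, so subfamilies need no separate clause. *)
Definition product_law d (Omega : measurableType d) (R : realType)
    (P : probability Omega R) (I : eqType) (J : seq I)
    (xi : I -> Omega -> R) :=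
  forall B : I -> set R, (forall i, measurable (B i)) ->
    P (\bigcap_(i in [set` J]) (xi i @^-1` B i)) =
    (\prod_(i <- J) P (xi i @^-1` B i))%E.

Lemma measurable_fun_big d (T : measurableType d) (R : realType) (I : eqType)
    (J : seq I) (h : I -> T -> R) :
  (forall i, i \in J -> measurable_fun setT (h i)) ->
  measurable_fun setT (fun t => \sum_(i <- J) h i t).
Proof.
elim: J => [|j J IH] mh.
  by under eq_fun do rewrite big_nil; exact: measurable_cst.
under eq_fun do rewrite big_cons; apply: measurable_funD.
  by apply: mh; rewrite mem_head.
by apply: IH => i iJ; apply: mh; rewrite in_cons iJ orbT.
Qed.

Lemma measurable_preimage d (T : measurableType d) (R : realType)
    (f : T -> R) (B : set R) :
  measurable_fun setT f -> measurable B -> measurable (f @^-1` B).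
Proof. by move=> mf mB; rewrite -[X in measurable X]setTI; exact: mf. Qed.

Lemma bigcap_cons (T : Type) (J : eqType) (j : J) (s : seq J)
    (F : J -> set T) :
  \bigcap_(i in [set` j :: s]) F i = F j `&` \bigcap_(i in [set` s]) F i.
Proof.
rewrite eqEsubset; split=> w.
  move=> h; split; first by apply: h; rewrite /= mem_head.
  by move=> i /= iJ; apply: h; rewrite /= in_cons iJ orbT.
move=> [h1 h2] i /=; rewrite in_cons => /orP[/eqP->//|iJ].
exact: h2.
Qed.

(** An affine function [W] of the variables of [J] is measurable for the
    sigma-algebra generated by the intersections of the events
    [xi i \in B i], which are stable under intersection. Those events
    are independent of [xi j], hence so is every event of that sigma-algebra. *)
Lemma product_law_split d (Omega : measurableType d) (R : realType)
    (P : probability Omega R) (I : eqType) (j : I) (J : seq I)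
    (xi : I -> Omega -> R) :
  uniq (j :: J) -> (forall i, i \in j :: J -> measurable_fun setT (xi i)) ->
  product_law P (j :: J) xi ->
  product_law P J xi /\
  forall A (b1 b2 : I -> R) (x : R * R) (C : set (R * R)),
    measurable A -> measurable C ->
    let W w := (x.1 + \sum_(i <- J) b1 i * xi i w,
                x.2 + \sum_(i <- J) b2 i * xi i w) in
    P (xi j @^-1` A `&` W @^-1` C) = (P (xi j @^-1` A) * P (W @^-1` C))%E.
Proof.
move=> /= /andP[jJ uJ] mxi plaw.
have notj i : i \in J -> i != j by move=> iJ; apply: contraNneq jJ => <-.
have mxiJ i : i \in J -> measurable_fun setT (xi i).
  by move=> iJ; apply: mxi; rewrite in_cons iJ orbT.
have split1 (A : set R) (B : I -> set R) :
    measurable A -> (forall i, measurable (B i)) ->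
    P (xi j @^-1` A `&` \bigcap_(i in [set` J]) (xi i @^-1` B i)) =
    (P (xi j @^-1` A) * \prod_(i <- J) P (xi i @^-1` B i))%E.
  move=> mA mB; pose B' i := if i == j then A else B i.
  have B'j : B' j = A by rewrite /B' eqxx.
  have := plaw B'; rewrite bigcap_cons big_cons B'j.
  rewrite (eq_bigcapr (G := fun i => xi i @^-1` B i)); last first.
    by move=> i /= /notj/negPf E; rewrite /B' E.
  rewrite (eq_big_seq (fun i => P (xi i @^-1` B i))); last first.
    by move=> i /= /notj/negPf E; rewrite /B' E.
  by apply=> i; rewrite /B'; case: ifP.
have plawJ : product_law P J xi.
  move=> B mB; have := split1 setT B measurableT mB.
  by rewrite preimage_setT setTI probability_setT mul1e.
split; [exact: plawJ|move=> A b1 b2 x C mA mC].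
pose W w := (x.1 + \sum_(i <- J) b1 i * xi i w,
             x.2 + \sum_(i <- J) b2 i * xi i w).
rewrite -/W.
pose G := [set E | exists2 B : I -> set R, (forall i, measurable (B i)) &
                   E = \bigcap_(i in [set` J]) (xi i @^-1` B i)].
have mE : measurable (xi j @^-1` A).
  by apply: measurable_preimage => //; apply: mxi; rewrite mem_head.
have GT : G setT.
  exists (fun=> setT) => //; apply/seteqP; split=> // w _ i _ //.
have Gm : G `<=` measurable.
  move=> _ [B mB ->]; apply: fin_bigcap_measurable => // i /= iJ.
  exact: measurable_preimage (mxiJ _ iJ) (mB i).
have GI : setI_closed G.
  move=> _ _ [B mB ->] [B' mB' ->]; exists (fun i => B i `&` B' i).
    by move=> i; exact: measurableI.
  by rewrite -bigcapI; apply: eq_bigcapr => i _; rewrite preimage_setI.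
have mG i : i \in J ->
    measurable_fun (setT : set (g_sigma_algebraType G)) (xi i).
  move=> iJ _ B mB; rewrite setTI; apply: sub_sigma_algebra.
  exists (fun k => if k == i then B else setT); first by move=> k; case: ifP.
  apply/seteqP; split=> w.
    by move=> wB k _; case: (eqVneq k i) => [->|].
  by move=> /(_ i iJ) /=; rewrite eqxx.
have mW : <<s G >> (W @^-1` C).
  have mWf : measurable_fun (setT : set (g_sigma_algebraType G)) W.
    apply/measurable_fun_pairP; split => /=; apply: measurable_funD => //;
      apply: measurable_fun_big => i iJ; apply: measurable_funM => //;
      exact: mG.
  by have := mWf measurableT _ mC; rewrite setTI.
have c0 : (0 <= fine (P (xi j @^-1` A)))%R by exact: fine_ge0.
pose m1 : {measure set Omega -> \bar R} := mrestr P mE.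
pose m2 : {measure set Omega -> \bar R} := mscale (NngNum c0) P.
have : m1 (W @^-1` C) = m2 (W @^-1` C).
  apply: (g_sigma_algebra_measure_unique G Gm (fun=> setT)) => //.
  - by rewrite bigcup_const//; exists 0%N.
  - move=> _ [B mB ->].
    rewrite /m1 /m2 /= /mscale /mrestr fineK ?fin_num_measure//.
    by rewrite setIC split1//; congr (_ * _)%E; exact/esym/plawJ.
  - move=> _; rewrite /m1 /= /mrestr setTI.
    by rewrite (le_lt_trans (probability_le1 _ _))// ltry.
by rewrite /m1 /m2 /= /mscale /mrestr fineK ?fin_num_measure// setIC.
Qed.

(** Induction on the family: the head variable is independent of the sum of the
    others, so the joint law is a product, and Fubini's theorem integrates the
    head first by [integral_gauss2_normal]. *)
Lemma integral_gauss2_sum d (Omega : measurableType d) (R : realType)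
    (P : probability Omega R) (I : eqType) (J : seq I)
    (xi : I -> Omega -> R) (s b1 b2 : I -> R) (a b c : R) (x : R * R) :
  uniq J -> (forall i, i \in J -> measurable_fun setT (xi i)) ->
  (forall i, i \in J -> 0 < s i) ->
  (forall i, i \in J -> forall B : set R, measurable B ->
     P (xi i @^-1` B) = normal_prob 0 (s i) B) ->
  product_law P J xi ->
  0 < a -> 0 < a * c - b ^+ 2 ->
  (\int[P]_w (gauss2 a b c (x.1 + \sum_(i <- J) b1 i * xi i w,
                            x.2 + \sum_(i <- J) b2 i * xi i w)%R)%:E =
   (gauss2 (a + \sum_(i <- J) s i ^+ 2 * b1 i ^+ 2)
           (b + \sum_(i <- J) s i ^+ 2 * b1 i * b2 i)
           (c + \sum_(i <- J) s i ^+ 2 * b2 i ^+ 2) x)%:E)%E.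
Proof.
elim: J a b c => [|j J IH] a b c uJ mxi s0 lawxi plaw a0 D0.
  under eq_integral do rewrite !big_nil !addr0.
  rewrite !big_nil !addr0 integral_cst// [X in (_ * X)%E]probability_setT mule1.
  by case: x.
have [plawJ splitJ] := product_law_split uJ mxi plaw.
have sub i : i \in J -> i \in j :: J by move=> iJ; rewrite in_cons iJ orbT.
have mxij : measurable_fun setT (xi j) by apply: mxi; rewrite mem_head.
have sj0 : 0 < s j by apply: s0; rewrite mem_head.
pose W w := (x.1 + \sum_(i <- J) b1 i * xi i w,
             x.2 + \sum_(i <- J) b2 i * xi i w).
have mW : measurable_fun setT W.
  apply/measurable_fun_pairP; split => /=; apply: measurable_funD => //;
    apply: measurable_fun_big => i iJ; apply: measurable_funM => //;
    by apply: mxi; exact: sub.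
have mV : measurable_fun setT
    (fun w => (xi j w : measurableTypeR R, W w)).
  exact: measurable_fun_pair.
pose Wm : {mfun Omega >-> (R * R)%type} := mfun_Sub (mem_set mW).
pose Vm : {mfun Omega >-> (measurableTypeR R * (R * R))%type} :=
  mfun_Sub (mem_set mV).
pose F (z : measurableTypeR R * (R * R)) : \bar R :=
  (gauss2 a b c (z.2.1 + b1 j * z.1, z.2.2 + b2 j * z.1))%:E.
have mF : measurable_fun setT F.
  apply/measurable_EFinP/measurable_gauss2; apply: measurable_funD => //.
  - exact: measurableT_comp measurable_fst measurable_snd.
  - by apply: measurable_funM.
  - exact: measurableT_comp measurable_snd measurable_snd.
  - by apply: measurable_funM.
transitivity (\int[P]_w F (Vm w))%E.
  apply: eq_integral => w _; rewrite /F /= !big_cons; congr (gauss2 _ _ _ _)%:E.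
  by congr pair; rewrite addrAC -addrA.
transitivity (\int[distribution P Vm]_z F z)%E.
  by rewrite ge0_integral_distribution// => z; rewrite lee_fin gauss2_ge0.
transitivity (\int[normal_prob 0 (s j) \x distribution P Wm]_z F z)%E.
  apply: (eq_measure_integral (normal_prob 0 (s j) \x distribution P Wm)%E).
  move=> E mE _; apply/esym.
  apply: product_measure_unique => // A C mA mC.
  transitivity (P (xi j @^-1` A `&` W @^-1` C)).
    by congr (P _); apply/seteqP; split.
  rewrite splitJ//; congr (_ * _)%E.
  by apply: lawxi => //; rewrite mem_head.
rewrite fubini_tonelli2//=; last by move=> z; rewrite lee_fin gauss2_ge0.
have [D'0 _] := gauss2_convolution (b1 j) (b2 j) 0 x a0 D0 sj0.
rewrite /fubini_G /F /=.
under eq_integral => y _ do rewrite (integral_gauss2_normal (b1 j) (b2 j) y a0 D0 sj0).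
rewrite ge0_integral_distribution//=; last 2 first.
- by apply/measurable_EFinP; exact: measurable_gauss2.
- by move=> z; rewrite lee_fin gauss2_ge0.
rewrite (IH _ _ _ _ _ _ _ plawJ)//.
- by rewrite !big_cons !addrA.
- by case/andP: uJ.
- by move=> i /sub; exact: mxi.
- by move=> i /sub; exact: s0.
- by move=> i /sub; exact: lawxi.
- by rewrite ltr_pwDl// mulr_ge0// sqr_ge0.
- by move: D'0; congr (_ < _); ring.
Qed.

(** * Small balls under Gaussian sums; Brownian increments *)

(** On the disc of radius [r] the kernel of covariance [r^2 I] is at least
    [1 / (e r^2)], and its mean value is at most [1 / (r^2 + v)] whatever the
    centre [x]. *)
Lemma gaussian_small_ball d (Omega : measurableType d) (R : realType)
    (P : probability Omega R) (I : eqType) (J : seq I)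
    (xi : I -> Omega -> R) (s b1 b2 : I -> R) (x : R * R) (v r : R) :
  uniq J -> (forall i, i \in J -> measurable_fun setT (xi i)) ->
  (forall i, i \in J -> 0 < s i) ->
  (forall i, i \in J -> forall B : set R, measurable B ->
     P (xi i @^-1` B) = normal_prob 0 (s i) B) ->
  product_law P J xi ->
  \sum_(i <- J) s i ^+ 2 * b1 i ^+ 2 = v ->
  \sum_(i <- J) s i ^+ 2 * b1 i * b2 i = 0 ->
  \sum_(i <- J) s i ^+ 2 * b2 i ^+ 2 = v -> 0 < v -> 0 < r ->
  (P [set w | ((x.1 + \sum_(i <- J) b1 i * xi i w) ^+ 2 +
               (x.2 + \sum_(i <- J) b2 i * xi i w) ^+ 2 <= r ^+ 2)%R]
   <= (expR 1 * r ^+ 2 / v)%:E)%E.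
Proof.
move=> uJ mxi s0 lawxi plaw v1 v12 v2 v0 r0.
have r20 : 0 < r ^+ 2 by rewrite exprn_gt0.
have D0 : 0 < r ^+ 2 * r ^+ 2 - 0 ^+ 2 :> R.
  by rewrite expr0n subr0 mulr_gt0.
have := integral_gauss2_sum b1 b2 x uJ mxi s0 lawxi plaw r20 D0.
rewrite v1 v12 v2 addr0.
set X1 := fun w => x.1 + \sum_(i <- J) b1 i * xi i w.
set X2 := fun w => x.2 + \sum_(i <- J) b2 i * xi i w.
have mX1 : measurable_fun setT X1.
  apply: measurable_funD => //; apply: measurable_fun_big => i iJ.
  by apply: measurable_funM => //; exact: mxi.
have mX2 : measurable_fun setT X2.
  apply: measurable_funD => //; apply: measurable_fun_big => i iJ.
  by apply: measurable_funM => //; exact: mxi.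
rewrite -[fun w => _]/(fun w => (gauss2 (r ^+ 2) 0 (r ^+ 2) (X1 w, X2 w))%:E).
move=> intE.
set A := [set w | _].
have mA : measurable A.
  have mf : measurable_fun setT (fun w => X1 w ^+ 2 + X2 w ^+ 2).
    by apply: measurable_funD; exact: measurable_funX.
  rewrite (_ : A = (fun w => X1 w ^+ 2 + X2 w ^+ 2) @^-1` `]-oo, r ^+ 2]).
    exact: measurable_preimage.
  by apply/seteqP; split=> w; rewrite /A /= in_itv.
have mg : measurable_fun setT (fun w => gauss2 (r ^+ 2) 0 (r ^+ 2) (X1 w, X2 w)).
  exact: measurable_gauss2.
have c0 : 0 <= expR 1 * r ^+ 2 :> R by rewrite mulr_ge0 ?expR_ge0// ltW.
have le1 : (P A <= \int[P]_w ((expR 1 * r ^+ 2)%:E *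
              (gauss2 (r ^+ 2) 0 (r ^+ 2) (X1 w, X2 w))%:E))%E.
  rewrite -(setIT A) -integral_indic//; apply: ge0_le_integral => //.
  - exact/measurable_EFinP/measurable_indic.
  - by apply/measurable_EFinP; exact: measurable_funM.
  move=> w _; rewrite -EFinM lee_fin indicE.
  have [wA|_] := boolP (w \in A); last by rewrite mulr_ge0// gauss2_ge0.
  move: wA; rewrite inE /A /= => wA.
  rewrite /gauss2 /= expr0n subr0 mulr0 !mul0r subr0 -mulrDr -expr2.
  rewrite sqrtr_sqr (ger0_norm (ltW r20)) mulrA mulfK ?gt_eqF// -expRD.
  rewrite -[leLHS]expR0.
  rewrite ler_expR.
  have -> : 1 + - (r ^+ 2 * (X1 w ^+ 2 + X2 w ^+ 2)) / (2 * r ^+ 2 ^+ 2) =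
            (2 - (X1 w ^+ 2 + X2 w ^+ 2) / r ^+ 2) / 2.
    by field; rewrite gt_eqF.
  by rewrite divr_ge0// subr_ge0 ler_pdivrMr// (le_trans wA)// ler_peMl ?(ltW r20)// ler1n.
rewrite (le_trans le1)// ge0_integralZl//=; last 2 first.
- exact/measurable_EFinP.
- by move=> w _; rewrite lee_fin gauss2_ge0.
rewrite intE -EFinM lee_fin -mulrA.
have rv0 : 0 < r ^+ 2 + v by rewrite addr_gt0.
rewrite -mulrA ler_wpM2l ?expR_ge0// ler_wpM2l ?(ltW r20)//.
apply: (le_trans (gauss2_le _ _ _)) => //.
  by rewrite expr0n subr0 mulr_gt0.
rewrite expr0n subr0 -expr2 sqrtr_sqr (ger0_norm (ltW rv0)).
by rewrite lef_pV2 ?posrE// lerDr (ltW r20).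
Qed.

(** The increment over the [j.2]-th step of mesh [h] of the motion number [j.1]. *)
Definition incr (R : realType) Omega (beta : int * int -> R -> Omega -> R)
    (h : R) (j : (int * int) * nat) (w : Omega) : R :=
  beta j.1 (h * j.2.+1%:R) w - beta j.1 (h * j.2%:R) w.

Section BrownianIncrements.
Context d (Omega : measurableType d) (R : realType) (P : probability Omega R).
Variable beta : int * int -> R -> Omega -> R.
Hypothesis iid : iid_brownian P beta.
Variable h : R.
Hypothesis h0 : 0 < h.

Lemma measurable_incr j : nonzero j.1 -> measurable_fun setT (incr beta h j).
Proof.
move=> nz; have [mb _ _ _ _] := iid.1 _ nz.
by apply: measurable_funB; apply: mb; rewrite mulr_ge0// ltW.
Qed.

Lemma law_incr j : nonzero j.1 -> forall B : set R, measurable B ->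
  P (incr beta h j @^-1` B) = normal_prob 0 (Num.sqrt h) B.
Proof.
move=> nz B mB; have [_ _ _ + _] := iid.1 _ nz => /(_ (h * j.2%:R) (h * j.2.+1%:R)).
rewrite -mulrBr -natrB// subSnn mulr1; apply=> //.
  by rewrite mulr_ge0// ltW.
by rewrite ltr_pM2l// ltr_nat.
Qed.

(** Independence is used twice: between the motions, for the events
    [A k] generated by a single motion, and then between the increments of one
    motion. *)
Lemma product_law_incr (ks : seq (int * int)) (n : nat) :
  uniq ks -> (forall k, k \in ks -> nonzero k) ->
  product_law P [seq (k, i) | k <- ks, i <- iota 0 n] (incr beta h).
Proof.
move=> uks nz B mB.
pose A k := \bigcap_(i in [set` iota 0 n]) (incr beta h (k, i) @^-1` B (k, i)).
transitivity (P (\bigcap_(k in [set` ks]) A k)).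
  congr (P _); apply/seteqP; split=> w.
    by move=> wB k /= kks i /= ii; apply: wB; apply/allpairsP; exists (k, i).
  move=> wA _ /= /allpairsP[[k i] /= [kks ii ->]].
  exact: (wA k kks i ii).
rewrite big_allpairs; rewrite iid.2//; last first.
  move=> k kks; split; first exact: nz.
  rewrite /sigma_gen; set G := (X in <<s X >>).
  have mb s : 0 <= s ->
      measurable_fun (setT : set (g_sigma_algebraType G)) (beta k s).
    move=> s0 _ C mC; rewrite setTI; apply: sub_sigma_algebra.
    by exists s => //; exists C.
  apply: (@fin_bigcap_measurable _ (g_sigma_algebraType G)) => // i _.
  have mi : measurable_fun (setT : set (g_sigma_algebraType G))
      (incr beta h (k, i)).
    by apply: measurable_funB; apply: mb; rewrite mulr_ge0// ltW.
  by have := mi measurableT _ (mB (k, i)); rewrite setTI.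
rewrite !big_seq; apply: eq_bigr => k kks.
have [_ _ inc _ _] := iid.1 _ (nz _ kks).
rewrite /A (inc (fun i => h * i%:R)) ?mulr0//.
- by move=> i j ij; rewrite ler_pM2l// ler_nat.
- exact: iota_uniq.
move=> i _; split=> //; apply: sub_sigma_algebra.
by exists tt => //; exists (B (k, i)).
Qed.

End BrownianIncrements.

(** * The trigonometric basis *)

Section Omega.
Context {R : realType}.
Variable L : R.
Hypothesis L0 : 0 < L.
Implicit Types (i j : int) (z : R).

Definition freq j : R := 2 * pi * j%:~R / L.

Lemma freqN j : freq (- j) = - freq j.
Proof. by rewrite /freq mulrNz mulrN mulNr. Qed.

Lemma freq0 : freq 0 = 0.
Proof. by rewrite /freq mulr0z mulr0 mul0r. Qed.

Lemma freq_neq0 j : j != 0 -> freq j != 0.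
Proof.
move=> j0; rewrite /freq !mulf_eq0 !negb_or invr_eq0 intr_eq0 j0.
by rewrite (gt_eqF (pi_gt0 R)) (gt_eqF L0) pnatr_eq0.
Qed.

Lemma omegaE j z : omega L j z =
  if 0 < j then Num.sqrt (2 / L) * sin (freq j * z)
  else if j == 0 then (Num.sqrt L)^-1
  else Num.sqrt (2 / L) * cos (freq j * z).
Proof.
have E : 2 * pi * j%:~R * z / L = freq j * z by rewrite /freq mulrAC.
by rewrite /omega E.
Qed.

(** With signed frequencies the three cases of [omega] obey one rule:
    differentiation exchanges the modes [j] and [- j]. *)
Lemma is_derive_omega j z :
  is_derive z 1 (omega L j) (freq j * omega L (- j) z).
Proof.
have -> : omega L j = fun y => omega L j y by [].
have dlin : is_derive z 1 (fun y => freq j * y) (freq j).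
  by apply: is_derive_eq; rewrite /GRing.scale /= mulr1.
case: (ltgtP j 0) => [j0|j0|->].
- have -> : (fun y => omega L j y) =
      (fun y => Num.sqrt (2 / L) * cos (freq j * y)).
    by apply/funext => y; rewrite omegaE ltNge ltW//= lt_eqF.
  have -> : omega L (- j) z = Num.sqrt (2 / L) * sin (freq (- j) * z).
    by rewrite omegaE oppr_gt0 j0.
  rewrite freqN mulNr sinN.
  by apply: is_derive_eq; rewrite /GRing.scale /=; ring.
- have -> : (fun y => omega L j y) =
      (fun y => Num.sqrt (2 / L) * sin (freq j * y)).
    by apply/funext => y; rewrite omegaE j0.
  have -> : omega L (- j) z = Num.sqrt (2 / L) * cos (freq (- j) * z).
    by rewrite omegaE oppr_gt0 ltNge ltW//= oppr_eq0 gt_eqF.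
  rewrite freqN mulNr cosN.
  by apply: is_derive_eq; rewrite /GRing.scale /=; ring.
- have -> : (fun y => omega L 0 y) = cst (Num.sqrt L)^-1.
    by apply/funext => y; rewrite omegaE ltxx eqxx.
  by rewrite freq0 mul0r; exact: is_derive_cst.
Qed.

Lemma omega_sqr_add j z : omega L j z ^+ 2 + omega L (- j) z ^+ 2 = 2 / L.
Proof.
have s2 : Num.sqrt (2 / L) ^+ 2 = 2 / L by rewrite sqr_sqrtr// divr_ge0// ltW.
rewrite !omegaE oppr_gt0 oppr_eq0 freqN mulNr sinN cosN.
case: (ltgtP j 0) => j0 /=.
- by rewrite !exprMn s2 sqrrN -mulrDr cos2Dsin2 mulr1.
- by rewrite !exprMn s2 -mulrDr addrC cos2Dsin2 mulr1.
- by rewrite exprVn sqr_sqrtr ?ltW// mulrDl mul1r.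
Qed.

Lemma omega_le j z : `|omega L j z| <= Num.sqrt (2 / L).
Proof.
rewrite -sqrtr_sqr ler_wsqrtr// -(omega_sqr_add j z) lerDl.
exact: sqr_ge0.
Qed.

Lemma sin_periodz j z : sin (z + 2 * pi * j%:~R) = sin z.
Proof.
have E n : 2 * pi * n%:R = (pi *+ 2) *+ n :> R.
  by rewrite mulr_natr -(mulr_natl pi).
have per := @periodicn _ _ _ _ (@sinD2pi R).
case: j => n; first by rewrite [_ * _]E per.
by rewrite NegzE mulrNz mulrN [_ * _]E -(per n.+1) subrK.
Qed.

Lemma cos_periodz j z : cos (z + 2 * pi * j%:~R) = cos z.
Proof.
have E n : 2 * pi * n%:R = (pi *+ 2) *+ n :> R.
  by rewrite mulr_natr -(mulr_natl pi).
have per := @periodicn _ _ _ _ (@cosD2pi R).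
case: j => n; first by rewrite [_ * _]E per.
by rewrite NegzE mulrNz mulrN [_ * _]E -(per n.+1) subrK.
Qed.

Lemma omega_period j z : omega L j (z + L) = omega L j z.
Proof.
have E : freq j * (z + L) = freq j * z + 2 * pi * j%:~R.
  by rewrite mulrDr /freq divfK// gt_eqF.
by rewrite !omegaE E sin_periodz cos_periodz.
Qed.

Lemma continuous_omega j : continuous (omega L j).
Proof.
move=> z; apply/differentiable_continuous/derivable1_diffP.
by have [] := is_derive_omega j z.
Qed.

(** The product of two modes, minus its mean, has an [L]-periodic primitive. For
    distinct [|i|], [|j|] it is a multiple of the Wronskian of the two modes; for
    nonzero [i = - j] of the square of a mode, and for nonzero [i = j] of
    [omega i * omega (- i)]. *)
Lemma omega_primitive i j : exists F : R -> R,
  [/\ (forall z, is_derive z 1 F (omega L i z * omega L j z - (i == j)%:R / L)),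
      F 0 = F L & continuous F].
Proof.
have Fi z := is_derive_omega i z; have Fj z := is_derive_omega j z.
have FNi z : is_derive z 1 (omega L (- i)) (- freq i * omega L i z).
  by have := is_derive_omega (- i) z; rewrite opprK freqN.
have FNj z : is_derive z 1 (omega L (- j)) (- freq j * omega L j z).
  by have := is_derive_omega (- j) z; rewrite opprK freqN.
have per k : omega L k 0 = omega L k L by rewrite -(omega_period k 0) add0r.
suff [F [dF F0]] : exists F : R -> R,
    (forall z, is_derive z 1 F (omega L i z * omega L j z - (i == j)%:R / L)) /\
    F 0 = F L.
  exists F; split=> // z; apply/differentiable_continuous/derivable1_diffP.
  by have [] := dF z.
case: (eqVneq i j) => [ij|ij].
  subst j; case: (eqVneq i 0) => [->|in0].
    exists (cst 0); split=> // z.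
    have -> : omega L 0 z * omega L 0 z - true%:R / L = 0.
      rewrite omegaE ltxx eqxx -invfM -expr2 sqr_sqrtr ?ltW//.
      by rewrite div1r subrr.
    exact: is_derive_cst.
  exists (fun z => - (omega L i z * omega L (- i) z) / (2 * freq i)).
  split=> [z|]; last by rewrite !per.
  apply: is_derive_eq; rewrite /GRing.scale /=.
  have -> : 1%:R / L = (omega L i z ^+ 2 + omega L (- i) z ^+ 2) / 2.
    by rewrite omega_sqr_add /=; field; rewrite gt_eqF.
  by field; exact: freq_neq0.
case: (eqVneq i (- j)) => [ij'|ij'].
  have j0 : j != 0 by apply: contraNneq ij => j0; rewrite ij' j0 oppr0.
  exists (fun z => omega L j z ^+ 2 / (2 * freq j)).
  split=> [z|]; last by rewrite !per.
  rewrite ij' /= mul0r subr0; apply: is_derive_eq; rewrite /GRing.scale /=.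
  by field; exact: freq_neq0.
have D : freq j ^+ 2 - freq i ^+ 2 != 0.
  rewrite subr_eq0 eqf_sqr -freqN negb_or.
  have inj : forall a b, freq a = freq b -> a = b.
    move=> a b /divIf; rewrite gt_eqF// => /(_ isT) /mulfI.
    by rewrite mulf_neq0// ?gt_eqF ?pi_gt0// => /(_ isT)/intr_inj.
  apply/andP; split.
    by apply: contraNneq ij => /inj ->.
  by apply: contraNneq ij' => /inj ->; rewrite opprK.
exists (fun z => (freq i * omega L (- i) z * omega L j z -
   freq j * omega L (- j) z * omega L i z) / (freq j ^+ 2 - freq i ^+ 2)).
split=> [z|]; last by rewrite !per.
rewrite /= mul0r subr0; apply: is_derive_eq; rewrite /GRing.scale /=.
by field.
Qed.

Lemma integral_omega i j :
  (\int[lebesgue_measure]_(z in `[0%R, L]) (omega L i z * omega L j z)%:E =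
   (i == j)%:R%:E)%E.
Proof.
have [F [dF F0 cF]] := omega_primitive i j.
pose G z := F z + (i == j)%:R / L * z.
have dG z : is_derive z 1 G (omega L i z * omega L j z).
  by apply: is_derive_eq; rewrite /GRing.scale /=; ring.
have cG : continuous G.
  move=> z; apply/differentiable_continuous/derivable1_diffP.
  by have [] := dG z.
rewrite (continuous_FTC2 (F := G) L0).
- transitivity (G L - G 0)%:E; first by [].
  by congr EFin; rewrite /G F0 mulr0 (divfK (lt0r_neq0 L0)) addr0 addrAC subrr add0r.
- apply: continuous_subspaceT => z; apply: cvgM; exact: continuous_omega.
- split.
  + by move=> z _; have [] := dG z.
  + exact: cvg_at_right_filter (cG 0).
  + exact: cvg_at_left_filter (cG L).
- by move=> z _; rewrite derive1E; have [_ ->] := dG z.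
Qed.

End Omega.

Section Ebasis.
Context {R : realType}.
Variable L : R.
Hypothesis L0 : 0 < L.
Implicit Types (k : int * int) (x : R * R).

(** Differentiation in one variable of [e_k] yields a multiple of the mode with
    that component of [k] reversed. *)
Definition flip1 k : int * int := (- k.1, k.2).
Definition flip2 k : int * int := (k.1, - k.2).

Lemma is_derive_ebasis1 k x :
  is_derive x.1 1 (fun a => ebasis L k (a, x.2))
    (freq L k.1 * ebasis L (flip1 k) x).
Proof.
have := is_derive_omega L k.1 x.1 => d1.
rewrite /ebasis /=; apply: is_derive_eq; rewrite /GRing.scale /=; ring.
Qed.

Lemma is_derive_ebasis2 k x :
  is_derive x.2 1 (fun a => ebasis L k (x.1, a))
    (freq L k.2 * ebasis L (flip2 k) x).
Proof.
have := is_derive_omega L k.2 x.2 => d1.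
rewrite /ebasis /=; apply: is_derive_eq; rewrite /GRing.scale /=; ring.
Qed.

Lemma partial1_ebasis k : partial1 (ebasis L k) =
  (fun x => freq L k.1 * ebasis L (flip1 k) x).
Proof.
apply/funext => x; rewrite /partial1 derive1E.
by have [_ ->] := is_derive_ebasis1 k x.
Qed.

Lemma partial2_ebasis k : partial2 (ebasis L k) =
  (fun x => freq L k.2 * ebasis L (flip2 k) x).
Proof.
apply/funext => x; rewrite /partial2 derive1E.
by have [_ ->] := is_derive_ebasis2 k x.
Qed.

Lemma ebasis_le k x : `|ebasis L k x| <= 2 / L.
Proof.
rewrite normrM (le_trans (ler_pM _ _ (omega_le L0 _ _) (omega_le L0 _ _)))//.
by rewrite -expr2 sqr_sqrtr// divr_ge0// ltW.
Qed.

Lemma continuous_ebasis k : continuous (ebasis L k).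
Proof.
move=> x; apply: cvgM.
  by apply: continuous_comp; [exact: cvg_fst|exact: continuous_omega].
by apply: continuous_comp; [exact: cvg_snd|exact: continuous_omega].
Qed.

Lemma periodic_ebasis k : torus_periodic L (ebasis L k).
Proof. by move=> x; rewrite /ebasis /= !omega_period. Qed.

Lemma measurable_omega j : measurable_fun setT (omega L j).
Proof. by apply: continuous_measurable_fun; exact: continuous_omega. Qed.

Lemma measurable_ebasis k : measurable_fun setT (ebasis L k).
Proof.
apply: measurable_funM.
  by apply: measurableT_comp; [exact: measurable_omega|exact: measurable_fst].
by apply: measurableT_comp; [exact: measurable_omega|exact: measurable_snd].
Qed.

Lemma measurable_torus : measurable (torus L).
Proof. by apply: measurableX; exact: measurable_itv. Qed.

Lemma leb2_torus : leb2 R (torus L) = (L * L)%:E.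
Proof.
rewrite /torus product_measure1E//=.
by rewrite !lebesgue_measure_itv/= lte_fin L0 EFinN sube0.
Qed.

Lemma torus_integrable (f : R * R -> R) M :
  measurable_fun (torus L) f -> (forall x, torus L x -> `|f x| <= M) ->
  (leb2 R).-integrable (torus L) (EFin \o f).
Proof.
move=> mf fM; apply: (bounded_integrable (M := M)) => //.
- exact: measurable_torus.
- by move: (ltry (L * L)); rewrite -leb2_torus.
Qed.

Lemma integral_torus_prod (a b : R -> R) M :
  measurable_fun setT a -> measurable_fun setT b ->
  (forall z : R, `|a z| <= M) -> (forall z : R, `|b z| <= M) ->
  ((\int[leb2 R]_(x in torus L) (a x.1 * b x.2)%:E) =
   (\int[lebesgue_measure]_(z in `[0%R, L]) (a z)%:E) *
   (\int[lebesgue_measure]_(z in `[0%R, L]) (b z)%:E))%E.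
Proof.
move=> ma mb aM bM.
have M0 : 0 <= M by rewrite (le_trans _ (aM 0)).
pose f (x : R * R) := a x.1 * b x.2.
have mf : measurable_fun setT f.
  by apply: measurable_funM; apply: measurableT_comp => //.
have fi : (leb2 R).-integrable (torus L) (EFin \o f).
  apply: (torus_integrable (M := M * M)); first exact: measurable_funTS.
  by move=> x _; rewrite normrM ler_pM.
have ib : (@lebesgue_measure R).-integrable `[0%R, L] (EFin \o b).
  apply: (bounded_integrable (M := M)) => //; last exact: measurable_funTS.
  by rewrite /= lebesgue_measure_itv/= lte_fin L0 EFinN sube0 ltry.
have ia : (@lebesgue_measure R).-integrable `[0%R, L] (EFin \o a).
  apply: (bounded_integrable (M := M)) => //; last exact: measurable_funTS.
  by rewrite /= lebesgue_measure_itv/= lte_fin L0 EFinN sube0 ltry.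
have fi' : (leb2 R).-integrable setT ((EFin \o f) \_ (torus L)).
  have mt := measurable_torus.
  by rewrite -integrable_mkcond.
rewrite integral_mkcond -(integral12_prod_meas1 fi').
pose Ib := \int[lebesgue_measure]_(z in `[0%R, L]) b z.
have IbE : (\int[lebesgue_measure]_(z in `[0%R, L]) (b z)%:E = Ib%:E)%E.
  by rewrite fineK//; exact: integrable_fin_num.
rewrite IbE -integralZr//; rewrite [RHS]integral_mkcond.
apply: eq_integral => z _; rewrite /fubini_F [RHS]patchE.
case: ifPn => zL.
  rewrite -IbE -integralZl//= [RHS]integral_mkcond.
  apply: eq_integral => y _; rewrite !patchE.
  have -> : ((z, y) \in torus L) = (y \in `[0%R, L]%classic).
    by apply/idP/idP; rewrite !inE => -[]//; split => //; rewrite inE in zL.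
  by [].
rewrite integral0_eq// => y _; rewrite patchE; case: ifPn => //.
by rewrite inE => -[] /= zL'; move: zL; rewrite notin_setE.
Qed.

(** The class in which all integrals over the torus below are taken: it is stable
    under sums and products, and its members are integrable. *)
Definition bounded_meas (f : R * R -> R) :=
  measurable_fun (torus L) f /\ exists M, forall x, torus L x -> `|f x| <= M.

Definition tint (f : R * R -> R) : R := \int[leb2 R]_(x in torus L) f x.

Lemma bounded_meas_int f : bounded_meas f ->
  (leb2 R).-integrable (torus L) (EFin \o f).
Proof. by move=> [mf [M fM]]; exact: torus_integrable fM. Qed.

Lemma bounded_measD f g : bounded_meas f -> bounded_meas g ->
  bounded_meas (fun x => f x + g x).
Proof.
move=> [mf [M fM]] [mg [N gN]]; split; first exact: measurable_funD.
exists (M + N) => x tx; rewrite (le_trans (ler_normD _ _))// lerD//.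
  exact: fM.
exact: gN.
Qed.

Lemma bounded_measM f g : bounded_meas f -> bounded_meas g ->
  bounded_meas (fun x => f x * g x).
Proof.
move=> [mf [M fM]] [mg [N gN]]; split; first exact: measurable_funM.
by exists (M * N) => x tx; rewrite normrM ler_pM// ?fM// gN.
Qed.

Lemma bounded_meas_cst r : bounded_meas (fun=> r).
Proof. by split; [exact: measurable_cst|exists `|r|]. Qed.

Lemma bounded_meas_ebasis k : bounded_meas (ebasis L k).
Proof.
split; first exact: measurable_funTS (measurable_ebasis k).
by exists (2 / L) => x _; exact: ebasis_le.
Qed.

Lemma tintD f g : bounded_meas f -> bounded_meas g ->
  tint (fun x => f x + g x) = tint f + tint g.
Proof.
move=> bf bg; rewrite /tint RintegralD//; first exact: measurable_torus.
- exact: bounded_meas_int.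
- exact: bounded_meas_int.
Qed.

Lemma tintZ r f : bounded_meas f -> tint (fun x => r * f x) = r * tint f.
Proof.
move=> bf; rewrite /tint RintegralZl//; first exact: measurable_torus.
exact: bounded_meas_int.
Qed.

Lemma ebasis_orthonormal k l :
  tint (fun x => ebasis L k x * ebasis L l x) = (k == l)%:R.
Proof.
rewrite /tint /Rintegral.
have -> : (fun x => (ebasis L k x * ebasis L l x)%:E) = (fun x : R * R =>
   ((omega L k.1 x.1 * omega L l.1 x.1) *
    (omega L k.2 x.2 * omega L l.2 x.2))%:E).
  by apply/funext => x; rewrite /ebasis mulrACA.
have B i j (z : R) : `|omega L i z * omega L j z| <= 2 / L.
  rewrite normrM (le_trans (ler_pM _ _ (omega_le L0 _ _) (omega_le L0 _ _)))//.
  by rewrite -expr2 sqr_sqrtr// divr_ge0// ltW.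
have mm i j : measurable_fun setT (fun z => omega L i z * omega L j z).
  by apply: measurable_funM; exact: measurable_omega.
rewrite (integral_torus_prod (mm _ _) (mm _ _) (B _ _) (B _ _)).
rewrite !integral_omega// -EFinM/= -natrM mulnb.
by case: k l => [k1 k2] [l1 l2].
Qed.

Lemma bessel (g : R * R -> R) (s : seq (int * int)) :
  bounded_meas g -> uniq s ->
  \sum_(k <- s) tint (fun x => g x * ebasis L k x) ^+ 2 <=
  tint (fun x => g x ^+ 2).
Proof.
move=> bg us; pose c k := tint (fun x => g x * ebasis L k x).
pose r s x := g x - \sum_(k <- s) c k * ebasis L k x.
have rE k s' : r (k :: s') = fun x => r s' x + (- c k) * ebasis L k x.
  by apply/funext => x; rewrite /r big_cons mulNr; ring.
have rnil : r [::] = g by apply/funext => x; rewrite /r big_nil subr0.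
have bZ a f : bounded_meas f -> bounded_meas (fun x => a * f x).
  by move=> bf; apply: bounded_measM => //; exact: bounded_meas_cst.
have br s' : bounded_meas (r s').
  elim: s' => [|k s' IH]; first by rewrite rnil.
  rewrite rE; apply: bounded_measD => //; apply: (bZ _ (ebasis L k)).
  exact: bounded_meas_ebasis.
have be := bounded_meas_ebasis.
have rk k s' : k \notin s' -> tint (fun x => r s' x * ebasis L k x) = c k.
  elim: s' => [|l s' IH]; first by rewrite rnil.
  rewrite in_cons negb_or => /andP[kl ks'].
  under eq_fun do rewrite rE mulrDl -mulrA.
  rewrite tintD; last 2 first.
  - exact: bounded_measM.
  - by apply: bZ; exact: bounded_measM.
  rewrite tintZ; last exact: bounded_measM.
  by rewrite ebasis_orthonormal eq_sym (negPf kl) mulr0 addr0 IH.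
have main : tint (fun x => r s x ^+ 2) =
    tint (fun x => g x ^+ 2) - \sum_(k <- s) c k ^+ 2.
  elim: s us => [|k s' IH]; first by rewrite rnil big_nil subr0.
  rewrite cons_uniq => /andP[ks' us'].
  have -> : (fun x => r (k :: s') x ^+ 2) = (fun x =>
      r s' x ^+ 2 + ((- 2 * c k) * (r s' x * ebasis L k x) +
      c k ^+ 2 * (ebasis L k x * ebasis L k x))).
    by apply/funext => x; rewrite rE; ring.
  have b1 : bounded_meas (fun x => r s' x * ebasis L k x).
    exact: bounded_measM.
  have b2 : bounded_meas (fun x => ebasis L k x * ebasis L k x).
    exact: bounded_measM.
  rewrite tintD; last 2 first.
  - exact: (bounded_measM (br s') (br s')).
  - by apply: bounded_measD; exact: bZ.
  rewrite tintD; [|exact: bZ|exact: bZ].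
  rewrite !tintZ// rk// ebasis_orthonormal eqxx IH// big_cons /=.
  by ring.
rewrite -subr_ge0 -main; apply: Rintegral_ge0 => x _.
exact: sqr_ge0.
Qed.

End Ebasis.

(** * Fourier modes and lattice sums *)

Section Modes.
Context {R : realType}.
Implicit Types (k : int * int) (n : nat).

Lemma knorm_sqr k : knorm k ^+ 2 = k.1%:~R ^+ 2 + k.2%:~R ^+ 2 :> R.
Proof. by rewrite sqr_sqrtr// addr_ge0// sqr_ge0. Qed.

Lemma knorm_ge0 k : 0 <= knorm k :> R.
Proof. exact: sqrtr_ge0. Qed.

Lemma int_sqr_ge1 (i : int) : i != 0 -> 1 <= i%:~R ^+ 2 :> R.
Proof.
move=> i0; rewrite -real_normK ?num_real// exprn_ege1// -intr_norm.
by rewrite ler1z -gtz0_ge1 normr_gt0.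
Qed.

Lemma knorm_ge1 k : nonzero k -> 1 <= knorm k :> R.
Proof.
move=> nz; rewrite -[leLHS](ger0_norm ler01) -[leRHS](ger0_norm (knorm_ge0 k)).
rewrite -ler_sqr ?nnegrE// !real_normK ?num_real// expr1n knorm_sqr.
have [k1|k1] := eqVneq k.1 0.
  have k2 : k.2 != 0.
    by apply/eqP => k2; apply: nz; move: k1 k2; case: k => /= a b -> ->.
  by rewrite (le_trans (int_sqr_ge1 k2))// lerDr sqr_ge0.
by rewrite (le_trans (int_sqr_ge1 k1))// lerDl sqr_ge0.
Qed.

Lemma knorm_gt0 k : (0 < knorm k :> R) <-> nonzero k.
Proof.
split=> [k0 kE|/knorm_ge1]; last exact: lt_le_trans.
by move: k0; rewrite kE /knorm /enorm /= expr0n addr0 sqrtr0 ltxx.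
Qed.

Lemma knorm_ge_coord k :
  `|k.1%:~R| <= knorm k :> R /\ `|k.2%:~R| <= knorm k :> R.
Proof.
by split; rewrite -sqrtr_sqr ler_wsqrtr//= ?lerDl ?lerDr sqr_ge0.
Qed.

Definition int_range n : seq int :=
  [seq Posz i | i <- iota 0 n.+1] ++ [seq Negz i | i <- iota 0 n].

Lemma mem_int_range n (i : int) : (i \in int_range n) = (`|i| <= n)%N.
Proof.
rewrite mem_cat; case: i => i.
  have -> : (Posz i \in [seq Negz j | j <- iota 0 n]) = false.
    by apply/negP => /mapP[].
  rewrite mem_map; last by move=> a b [].
  by rewrite mem_iota /= add0n ltnS orbF.
have -> : (Negz i \in [seq Posz j | j <- iota 0 n.+1]) = false.
  by apply/negP => /mapP[].
rewrite mem_map; last by move=> a b [].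
by rewrite mem_iota.
Qed.

Lemma uniq_int_range n : uniq (int_range n).
Proof.
rewrite cat_uniq !map_inj_uniq ?iota_uniq//=; last 2 first.
- by move=> a b [].
- by move=> a b [].
rewrite andbT; apply/hasPn => _ /mapP[i _ ->].
by apply/negP => /mapP[].
Qed.

(** The modes of [kball n] as a list without repetition. *)
Definition kseq n : seq (int * int) :=
  [seq k <- [seq (i, j) | i <- int_range n, j <- int_range n] |
    0 < @knorm R k <= n%:R].

Lemma uniq_kseq n : uniq (kseq n).
Proof.
apply: filter_uniq; apply: allpairs_uniq; try exact: uniq_int_range.
by move=> [a b] [c d] _ _ [-> ->].
Qed.

Lemma mem_kseq n k : (k \in kseq n) = (0 < @knorm R k <= n%:R).
Proof.
rewrite mem_filter; case: (boolP (_ < _ <= _)) => //= /andP[_ kn].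
have [k1 k2] := knorm_ge_coord k.
have B (i : int) : `|i%:~R| <= knorm k :> R -> i \in int_range n.
  move=> ik; rewrite mem_int_range -(ler_nat R) natr_absz.
  by rewrite intr_norm; exact: le_trans ik kn.
by have := allpairs_f pair (B _ k1) (B _ k2); case: (k) => a b /= ->.
Qed.

Lemma kseq_nonzero n k : k \in kseq n -> nonzero k.
Proof. by rewrite mem_kseq => /andP[/knorm_gt0]. Qed.

Lemma sum_kseq_sub (V : nmodType) n m (F : int * int -> V) : (n <= m)%N ->
  \sum_(k <- kseq n) F k = \sum_(k <- kseq m | @knorm R k <= n%:R) F k.
Proof.
move=> nm; rewrite -[RHS]big_filter; apply: perm_big.
apply: uniq_perm; [exact: uniq_kseq|exact/filter_uniq/uniq_kseq|].
move=> k; rewrite mem_kseq [RHS]mem_filter mem_kseq; case: (ltP 0 (knorm k)) => //= _.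
  case: (leP (knorm k) n%:R) => //= kn.
  by rewrite (le_trans kn)// ler_nat.
by rewrite andbF.
Qed.

Lemma partial_sumE (L : R) c n x :
  partial_sum L c n x = \sum_(k <- kseq n) c k * ebasis L k x.
Proof.
rewrite /partial_sum (_ : kball n%:R = [set` kseq n]).
  by rewrite -fsbig_seq//; exact: uniq_kseq.
by apply/seteqP; split=> k; rewrite /kball /= mem_kseq.
Qed.

(** Telescoping: [i^{-3/2}] is at most [4 (i^{-1/2} - (i+1)^{-1/2})]. *)
Lemma sum_inv_three_halves n :
  \sum_(i <- iota 0 n) (Num.sqrt i.+1%:R ^+ 3)^-1 <=
  4 - 4 / Num.sqrt n.+1%:R :> R.
Proof.
elim: n => [|n IH]; first by rewrite big_nil sqrtr1 divr1 subrr.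
rewrite -[n.+1]addn1 iotaD big_cat /= big_seq1 add0n addn1.
apply: (le_trans (lerD IH (lexx _))).
set a := Num.sqrt n.+1%:R; set b := Num.sqrt n.+2%:R.
have a2 : a ^+ 2 = n.+1%:R by rewrite sqr_sqrtr.
have b2 : b ^+ 2 = n.+2%:R by rewrite sqr_sqrtr.
have a0 : 0 < a by rewrite sqrtr_gt0 ltr0n.
have b0 : 0 < b by rewrite sqrtr_gt0 ltr0n.
have ba : b ^+ 2 = a ^+ 2 + 1 by rewrite a2 b2 natr1.
have a1 : 1 <= a ^+ 2 by rewrite a2 ler1n.
rewrite -subr_ge0.
have -> : 4 - 4 / b - (4 - 4 / a + (a ^+ 3)^-1) =
    (4 * a ^+ 2 * (b - a) - b) / (a ^+ 3 * b).
  by field; rewrite !gt_eqF.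
rewrite divr_ge0 ?mulr_ge0 ?exprn_ge0 ?(ltW a0) ?(ltW b0)// subr_ge0.
have -> : b - a = (b + a)^-1.
  apply: (mulIf (x := b + a)); first by rewrite gt_eqF ?addr_gt0.
  by rewrite mulVf ?gt_eqF ?addr_gt0// -subr_sqr ba addrAC subrr add0r.
rewrite ler_pdivlMr ?addr_gt0//.
have : 0 <= (a - b) ^+ 2 by exact: sqr_ge0.
by nra.
Qed.

Lemma sum_int_range n :
  \sum_(i <- int_range n) (Num.sqrt (1 + `|i%:~R|) ^+ 3)^-1 <= 8 :> R.
Proof.
rewrite big_cat !big_map /=.
have B m : \sum_(i <- iota 0 m) (Num.sqrt i.+1%:R ^+ 3)^-1 <= 4 :> R.
  apply: (le_trans (sum_inv_three_halves m)).
  by rewrite gerBl divr_ge0// sqrtr_ge0.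
have -> : 8 = 4 + 4 :> R by ring.
apply: lerD.
  apply: le_trans (B n.+1); apply: ler_sum => i _.
  by rewrite ger0_norm ?ler0n// -[i%:~R]/(i%:R : R) nat1r.
apply: le_trans (B n); apply: ler_sum => i _.
rewrite NegzE mulrNz normrN ger0_norm ?ler0n//.
rewrite -[i.+1%:~R]/(i.+1%:R : R) lef_pV2 ?posrE ?exprn_gt0 ?sqrtr_gt0 ?addr_gt0 ?ltr0n//.
by rewrite lerXn2r ?nnegrE ?sqrtr_ge0// ler_wsqrtr// lerDr.
Qed.

(** The lattice sum splits into a product of two one-dimensional sums since
    [(1 + |k_1|) (1 + |k_2|) <= 4 |k|^2]. *)
Lemma sum_knorm_cube n : \sum_(k <- kseq n) (knorm k ^+ 3)^-1 <= 512 :> R.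
Proof.
pose w (i : int) : R := (Num.sqrt (1 + `|i%:~R|) ^+ 3)^-1.
have w0 i : 0 <= w i by rewrite invr_ge0 exprn_ge0// sqrtr_ge0.
apply: (@le_trans _ _ (\sum_(k <- kseq n) 8 * (w k.1 * w k.2))).
  rewrite big_seq [leRHS]big_seq; apply: ler_sum => k kn.
  have k1 := knorm_ge1 (kseq_nonzero kn).
  have k0 : 0 < @knorm R k by rewrite (lt_le_trans _ k1).
  have [c1 c2] := knorm_ge_coord k.
  pose p : R := Num.sqrt (1 + `|k.1%:~R|); pose q : R := Num.sqrt (1 + `|k.2%:~R|).
  have p2 : p ^+ 2 = 1 + `|k.1%:~R| by rewrite sqr_sqrtr// addr_ge0.
  have q2 : q ^+ 2 = 1 + `|k.2%:~R| by rewrite sqr_sqrtr// addr_ge0.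
  have p0 : 0 < p by rewrite sqrtr_gt0 ltr_pwDl.
  have q0 : 0 < q by rewrite sqrtr_gt0 ltr_pwDl.
  have pq : p * q <= 2 * knorm k.
    rewrite -ler_sqr ?nnegrE ?mulr_ge0 ?(ltW p0) ?(ltW q0) ?(ltW k0)//.
    rewrite !exprMn p2 q2.
    apply: (@le_trans _ _ ((2 * knorm k) * (2 * knorm k))).
      apply: ler_pM; rewrite ?addr_ge0//; lra.
    by rewrite -expr2 exprMn.
  rewrite /w -/p -/q -invfM -[8]invrK -invfM lef_pV2 ?posrE; last 2 first.
  - by rewrite exprn_gt0.
  - by rewrite mulr_gt0// ?invr_gt0// mulr_gt0// exprn_gt0.
  rewrite -exprMn mulrC ler_pdivrMr//.
  have -> : knorm k ^+ 3 * 8 = (2 * @knorm R k) ^+ 3 by rewrite exprMn; ring.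
  by rewrite lerXn2r ?nnegrE ?mulr_ge0// ltW.
apply: (@le_trans _ _ (\sum_(k <- [seq (i, j) | i <- int_range n, j <- int_range n])
   8 * (w k.1 * w k.2))).
  rewrite big_filter big_mkcond; apply: ler_sum => k _; case: ifP => // _.
  by rewrite !mulr_ge0.
rewrite big_allpairs /=.
have S0 : 0 <= \sum_(i <- int_range n) w i by apply: sumr_ge0.
have -> : \sum_(i <- int_range n) \sum_(j <- int_range n) 8 * (w i * w j) =
    8 * ((\sum_(i <- int_range n) w i) * (\sum_(i <- int_range n) w i)).
  rewrite mulr_suml mulr_sumr; apply: eq_bigr => i _.
  by rewrite mulr_sumr mulr_sumr; apply: eq_bigr.
have := sum_int_range n; rewrite -/w => S8.
have -> : 512 = 8 * (8 * 8) :> R by ring.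
by rewrite ler_pM2l// ler_pM.
Qed.

End Modes.
Arguments kseq R n : clear implicits.

(** * Limits of derivatives and absolutely summable coefficients *)

Section DerivativeOfLimits.
Context {R : realType}.

Lemma lipschitz_of_derivative (f df : R -> R) (K : R) :
  (forall x : R, is_derive x 1 f (df x)) ->
  (forall x, `|df x| <= K) -> forall x y, `|f x - f y| <= K * `|x - y|.
Proof.
move=> dfx dfK x y; wlog xy : x y / x < y.
  move=> H; case: (ltgtP x y) => [xy|xy|->].
  - exact: H.
  - by rewrite distrC (distrC x); exact: H.
  - by rewrite !subrr normr0 mulr0.
have [z _ E] : exists2 z, z \in `]x, y[ & f y - f x = df z * (y - x).
  apply: MVT => //.
  apply: derivable_within_continuous => w _.
  by have [] := dfx w.
by rewrite distrC E normrM (distrC x) ler_wpM2r.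
Qed.

(** The bound on the derivatives makes [F m - F n] Lipschitz with constant
    [eps n]; this survives the limit in [m], so the difference quotients of [G]
    and of [F n] differ by at most [eps n]. *)
Lemma is_derive_limit (F F' : nat -> R -> R) (G G' : R -> R) (eps : nat -> R)
    (x : R) :
  (forall n (y : R), is_derive y 1 (F n) (F' n y)) ->
  (forall n m y, (n <= m)%N -> `|F' m y - F' n y| <= eps n) ->
  (forall y, F n y @[n --> \oo] --> G y) ->
  (forall y, F' n y @[n --> \oo] --> G' y) ->
  eps n @[n --> \oo] --> 0 ->
  is_derive x 1 G (G' x).
Proof.
move=> dF cF' FG FG' eps0.
have lip n y z : `|(G y - F n y) - (G z - F n z)| <= eps n * `|y - z|.
  have lim : `|(F m y - F n y) - (F m z - F n z)| @[m --> \oo] -->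
             `|(G y - F n y) - (G z - F n z)|.
    apply: cvg_norm; apply: cvgB; apply: cvgB; (exact: FG || exact: cvg_cst).
  apply: (cvgr_to_le lim); near=> m.
  have nm : (n <= m)%N by near: m; exists n.
  have dFmn (w : R) : is_derive w 1 (fun y => F m y - F n y) (F' m w - F' n w).
    exact: is_deriveB.
  apply: (lipschitz_of_derivative dFmn) => w; exact: cF'.
have main : h^-1 *: ((G \o shift x) (h *: 1) - G x) @[h --> 0^'] --> G' x.
  apply/cvgrPdist_le => e e0.
  have e30 : 0 < e / 3 by rewrite divr_gt0.
  have [N [epsN F'N]] : exists N, eps N <= e / 3 /\ `|G' x - F' N x| <= e / 3.
    have A1 : \forall n \near \oo, eps n <= e / 3.
      move/cvgrPdist_le : eps0 => /(_ _ e30); apply: filterS => n.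
      by rewrite sub0r normrN; apply: le_trans; exact: ler_norm.
    have A2 : \forall n \near \oo, `|G' x - F' n x| <= e / 3.
      by have /cvgrPdist_le/(_ _ e30) := FG' x.
    have [N _ H] := filterI A1 A2; exists N; exact: (H N (leqnn N)).
  have [dFN dFNE] := dF N x.
  have : h^-1 *: ((F N \o shift x) (h *: 1) - F N x) @[h --> 0^'] --> F' N x.
    by rewrite -dFNE; exact: dFN.
  move/cvgrPdist_le => /(_ _ e30) near0; near=> h.
  have h0 : h != 0 by near: h; exact: nbhs_dnbhs_neq.
  have qF : `|F' N x - h^-1 *: ((F N \o shift x) (h *: 1) - F N x)| <= e / 3.
    by near: h.
  have qG : `|h^-1 *: ((F N \o shift x) (h *: 1) - F N x) -
              h^-1 *: ((G \o shift x) (h *: 1) - G x)| <= e / 3.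
    rewrite -scalerBr normrZ normfV ler_pdivrMl ?normr_gt0//.
    rewrite distrC; move: (lip N (h *: 1 + x) x); rewrite /= addrK.
    rewrite [h *: 1]mulr1 => H; rewrite mulrC.
    apply: le_trans (ler_wpM2r (normr_ge0 h) epsN).
    by apply: le_trans H; rewrite le_eqVlt; apply/orP; left; apply/eqP; congr `|_|; ring.
  have -> : e = e / 3 + e / 3 + e / 3 by field.
  have -> : G' x - h^-1 *: ((G \o shift x) (h *: 1) - G x) =
    (G' x - F' N x) + (F' N x - h^-1 *: ((F N \o shift x) (h *: 1) - F N x)) +
    (h^-1 *: ((F N \o shift x) (h *: 1) - F N x) -
              h^-1 *: ((G \o shift x) (h *: 1) - G x)) by ring.
  rewrite (le_trans (ler_normD _ _))// lerD//.
  by rewrite (le_trans (ler_normD _ _))// lerD.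
apply: DeriveDef.
- by apply/cvg_ex; exists (G' x).
- by apply/cvg_lim.
Unshelve. all: by end_near. Qed.

End DerivativeOfLimits.

Section AbsolutelySummable.
Context {R : realType}.
Variable c : int * int -> R.
Variable M : R.
Hypothesis cM : forall n, \sum_(k <- kseq R n) knorm k * `|c k| <= M.

Let a n := \sum_(k <- kseq R n) knorm k * `|c k|.
Let tail n := lim (a m @[m --> \oo]) - a n.

Lemma nd_a : nondecreasing_seq a.
Proof.
move=> n m nm; rewrite /a (sum_kseq_sub _ nm).
rewrite [leRHS](bigID (fun k : int * int => @knorm R k <= n%:R)).
by rewrite lerDl sumr_ge0// => k _; rewrite mulr_ge0// knorm_ge0.
Qed.

Lemma cvg_a : cvgn a.
Proof.
apply: nondecreasing_is_cvgn; first exact: nd_a.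
by exists M => _ [n _ <-]; exact: cM.
Qed.

Lemma tail_cvg0 : tail n @[n --> \oo] --> 0.
Proof.
rewrite -[X in _ --> X](subrr (lim (a m @[m --> \oo]))).
by apply: cvgB; [exact: cvg_cst|exact: cvg_a].
Qed.

Lemma sum_kseq_cauchy (F : int * int -> R) B n m :
  (forall k, nonzero k -> `|F k| <= B * (knorm k * `|c k|)) -> (n <= m)%N ->
  `|\sum_(k <- kseq R m) F k - \sum_(k <- kseq R n) F k| <= B * (a m - a n).
Proof.
move=> FB nm; rewrite /a !(sum_kseq_sub _ nm).
rewrite [X in X - _](bigID (fun k : int * int => @knorm R k <= n%:R)) addrAC subrr add0r.
rewrite [X in B * (X - _)](bigID (fun k : int * int => @knorm R k <= n%:R)) addrAC subrr add0r.
rewrite (le_trans (ler_norm_sum _ _ _))// mulr_sumr.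
rewrite big_seq_cond [leRHS]big_seq_cond; apply: ler_sum => k /andP[kn _].
by apply: FB; exact: kseq_nonzero kn.
Qed.

(** Summation over growing balls of any series dominated by [|k| |c_k|], with the
    tail of the dominating series as rate of convergence. *)
Lemma sum_kseq_cvg (F : int * int -> R) B : 0 <= B ->
  (forall k, nonzero k -> `|F k| <= B * (knorm k * `|c k|)) ->
  let l : R := lim (\sum_(k <- kseq R n) F k @[n --> \oo]) in
  [/\ (\sum_(k <- kseq R n) F k @[n --> \oo] --> l),
      (forall n, `|l - \sum_(k <- kseq R n) F k| <= B * tail n) &
      `|l| <= B * M].
Proof.
move=> B0 FB l.
have cv : cvgn (fun n => \sum_(k <- kseq R n) F k).
  apply/cauchy_cvgP/cauchy_exP => e e0.
  have e2 : 0 < e / (B + 1) by rewrite divr_gt0// ltr_pwDr.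
  have /cvgrPdist_lt/(_ _ e2)[N _ HN] := tail_cvg0.
  pose S n := \sum_(k <- kseq R n) F k.
  have B1 : 0 < B + 1 by rewrite ltr_pwDr.
  have H n m : (N <= n)%N -> (n <= m)%N -> `|S m - S n| < e.
    move=> Nn nm; rewrite (le_lt_trans (sum_kseq_cauchy FB nm))//.
    have am : a m <= lim (a m @[m --> \oo]) by exact: (nondecreasing_cvgn_le nd_a cvg_a).
    have := HN n Nn; rewrite sub0r normrN => /(le_lt_trans (ler_norm _)).
    rewrite ltr_pdivlMr// => Ht.
    have an : a n <= a m := nd_a nm.
    apply: le_lt_trans Ht; rewrite mulrC /tail.
    by apply: ler_pM; rewrite ?subr_ge0// ?lerD2r// lerDl.
  exists (S N); exists N => // m Nm.
  by rewrite /ball /= distrC; exact: H.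
split=> // [n|].
  have cvn : `|\sum_(k <- kseq R m) F k - \sum_(k <- kseq R n) F k|
      @[m --> \oo] --> `|l - \sum_(k <- kseq R n) F k|.
    by apply: cvg_norm; apply: cvgB; [exact: cv|exact: cvg_cst].
  apply: (cvgr_to_le cvn).
  near=> m; have nm : (n <= m)%N by near: m; exists n.
  rewrite (le_trans (sum_kseq_cauchy FB nm))// ler_wpM2l// lerD2r.
  exact: (nondecreasing_cvgn_le nd_a cvg_a).
have cvn : `|\sum_(k <- kseq R m) F k| @[m --> \oo] --> `|l|.
  by apply: cvg_norm; exact: cv.
apply: (cvgr_to_le cvn).
near=> m; rewrite (le_trans (ler_norm_sum _ _ _))//.
rewrite (le_trans _ (ler_wpM2l B0 (cM m)))// mulr_sumr.
rewrite big_seq [leRHS]big_seq; apply: ler_sum => k kn.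
by apply: FB; exact: kseq_nonzero kn.
Unshelve. all: by end_near. Qed.

End AbsolutelySummable.

(** * Continuously differentiable representatives *)

Lemma continuous_uniform_limit (R : realType) (T : topologicalType)
    (f : nat -> T -> R) (G : T -> R) (eps : nat -> R) :
  (forall n, continuous (f n)) -> (forall n x, `|G x - f n x| <= eps n) ->
  eps n @[n --> \oo] --> 0 -> continuous G.
Proof.
move=> cf Gf eps0 x; apply/cvgrPdist_le => e e0.
have e30 : 0 < e / 3 by rewrite divr_gt0.
have [N _ HN] : \forall n \near \oo, eps n <= e / 3.
  move/cvgrPdist_le : eps0 => /(_ _ e30); apply: filterS => n.
  by rewrite sub0r normrN; apply: le_trans; exact: ler_norm.
have eN : eps N <= e / 3 by exact: (HN N (leqnn N)).
have /cvgrPdist_le/(_ _ e30) := cf N x; apply: filterS => y fxy.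
have -> : e = e / 3 + e / 3 + e / 3 by field.
have -> : G x - G y = (G x - f N x) + (f N x - f N y) - (G y - f N y) by ring.
rewrite (le_trans (ler_normB _ _))// lerD ?(le_trans (Gf _ _))//.
by rewrite (le_trans (ler_normD _ _))// lerD ?(le_trans (Gf _ _)).
Qed.

Section C1Representative.
Context {R : realType}.
Variable L : R.
Hypothesis L0 : 0 < L.
Variable c : int * int -> R.
Variable M : R.
Hypothesis cM : forall n, \sum_(k <- kseq R n) knorm k * `|c k| <= M.

Let t0 k x := c k * ebasis L k x.
Let t1 k x := c k * (freq L k.1 * ebasis L (flip1 k) x).
Let t2 k x := c k * (freq L k.2 * ebasis L (flip2 k) x).

(** Sum over all modes, as the limit over growing balls. *)
Definition series_lim (t : int * int -> R * R -> R) (x : R * R) : R :=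
  lim (\sum_(k <- kseq R n) t k x @[n --> \oo]).

Definition grad_bound : R := 2 * pi / L * (2 / L).

Lemma grad_bound_ge0 : 0 <= grad_bound.
Proof.
by rewrite /grad_bound !mulr_ge0// ?invr_ge0 ?(ltW L0)// pi_ge0.
Qed.

Lemma term0_le k x : nonzero k -> `|t0 k x| <= 2 / L * (knorm k * `|c k|).
Proof.
move=> nz; rewrite /t0 normrM mulrC.
have L20 : 0 <= 2 / L by rewrite divr_ge0// ltW.
rewrite ler_pM ?ebasis_le// ler_peMl//; exact: knorm_ge1.
Qed.

Lemma freq_le (j : int) (y : R) : `|j%:~R| <= y -> `|freq L j| <= 2 * pi / L * y.
Proof.
have p0 : 0 <= 2 * pi / L :> R.
  by rewrite !mulr_ge0// ?invr_ge0 ?(ltW L0)// pi_ge0.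
move=> jy; rewrite /freq mulrAC normrM (ger0_norm p0).
by rewrite ler_wpM2l.
Qed.

Lemma term1_le k x : `|t1 k x| <= grad_bound * (knorm k * `|c k|).
Proof.
have [k1 _] := @knorm_ge_coord R k.
rewrite /t1 normrM (normrM (freq _ _)).
have -> : grad_bound * (knorm k * `|c k|) =
    `|c k| * ((2 * pi / L * knorm k) * (2 / L)) by rewrite /grad_bound; ring.
apply: ler_wpM2l; first exact: normr_ge0.
by apply: ler_pM => //; [exact: freq_le|exact: ebasis_le].
Qed.

Lemma term2_le k x : `|t2 k x| <= grad_bound * (knorm k * `|c k|).
Proof.
have [_ k1] := @knorm_ge_coord R k.
rewrite /t2 normrM (normrM (freq _ _)).
have -> : grad_bound * (knorm k * `|c k|) =
    `|c k| * ((2 * pi / L * knorm k) * (2 / L)) by rewrite /grad_bound; ring.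
apply: ler_wpM2l; first exact: normr_ge0.
by apply: ler_pM => //; [exact: freq_le|exact: ebasis_le].
Qed.

Let a n := \sum_(k <- kseq R n) knorm k * `|c k|.
Let tail n := lim (a m @[m --> \oo]) - a n.

Lemma series_lim_spec (t : int * int -> R * R -> R) B : 0 <= B ->
  (forall k x, nonzero k -> `|t k x| <= B * (knorm k * `|c k|)) ->
  (forall k, continuous (t k)) ->
  [/\ (forall x, \sum_(k <- kseq R n) t k x @[n --> \oo] --> series_lim t x),
      (forall n x, `|series_lim t x - \sum_(k <- kseq R n) t k x| <= B * tail n),
      (forall x, `|series_lim t x| <= B * M) & continuous (series_lim t)].
Proof.
move=> B0 tB ct.
have H x := sum_kseq_cvg cM B0 (tB ^~ x).
have Hn n x : `|series_lim t x - \sum_(k <- kseq R n) t k x| <= B * tail n.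
  by have [_ + _] := H x; exact.
split=> [x|//|x|].
- by have [] := H x.
- by have [] := H x.
apply: (continuous_uniform_limit (f := fun n x => \sum_(k <- kseq R n) t k x) _ Hn).
  move=> n x; elim: (kseq R n) => [|k s IH].
    under eq_fun do rewrite big_nil; exact: cvg_cst.
  under eq_fun do rewrite big_cons.
  by apply: cvgD; [exact: ct|exact: IH].
rewrite -(mulr0 B); apply: cvgM; first exact: cvg_cst.
exact: (tail_cvg0 cM).
Qed.

Definition crepr : R * R -> R := series_lim t0.

(** The series of [c] and of its term-by-term derivatives are dominated by
    [|k| |c_k|], hence converge uniformly. *)
Lemma crepr_spec :
  [/\ is_C1_repr L c crepr, partial1 crepr = series_lim t1,
      partial2 crepr = series_lim t2,
      (forall x, `|series_lim t1 x| <= grad_bound * M) &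
      (forall x, `|series_lim t2 x| <= grad_bound * M)].
Proof.
have L20 : 0 <= 2 / L by rewrite divr_ge0// ltW.
have gb0 := grad_bound_ge0.
have c0 k : continuous (t0 k).
  by move=> x; apply: cvgM; [exact: cvg_cst|exact: continuous_ebasis].
have c1 k : continuous (t1 k).
  move=> x; apply: cvgM; first exact: cvg_cst.
  by apply: cvgM; [exact: cvg_cst|exact: continuous_ebasis].
have c2 k : continuous (t2 k).
  move=> x; apply: cvgM; first exact: cvg_cst.
  by apply: cvgM; [exact: cvg_cst|exact: continuous_ebasis].
have [S0 T0 _ C0] := series_lim_spec L20 (fun k x => @term0_le k x) c0.
have [S1 T1 B1 C1] := series_lim_spec gb0 (fun k x _ => @term1_le k x) c1.
have [S2 T2 B2 C2] := series_lim_spec gb0 (fun k x _ => @term2_le k x) c2.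
have tail0 : tail n @[n --> \oo] --> 0 by exact: (tail_cvg0 cM).
have gtail0 : grad_bound * tail n @[n --> \oo] --> 0.
  by rewrite -(mulr0 grad_bound); apply: cvgM => //; exact: cvg_cst.
have gcauchy (t : int * int -> R * R -> R) n m x :
    (forall k x, nonzero k -> `|t k x| <= grad_bound * (knorm k * `|c k|)) ->
    (n <= m)%N ->
    `|\sum_(k <- kseq R m) t k x - \sum_(k <- kseq R n) t k x| <=
      grad_bound * tail n.
  move=> tB nm; rewrite (le_trans (sum_kseq_cauchy (fun k => tB k x) nm))//.
  rewrite ler_wpM2l// lerD2r.
  exact: (nondecreasing_cvgn_le (@nd_a _ c) (cvg_a cM)).
have d1 (x : R * R) : is_derive x.1 1 (fun a => crepr (a, x.2)) (series_lim t1 x).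
  have := @is_derive_limit R (fun n a => \sum_(k <- kseq R n) t0 k (a, x.2))
    (fun n a => \sum_(k <- kseq R n) t1 k (a, x.2))
    (fun a => crepr (a, x.2)) (fun a => series_lim t1 (a, x.2))
    (fun n => grad_bound * tail n) x.1.
  rewrite -surjective_pairing; apply=> //.
  - move=> n y; elim: (kseq R n) => [|k s IH].
      under eq_fun do rewrite big_nil; rewrite big_nil; exact: is_derive_cst.
    under eq_fun do rewrite big_cons; rewrite big_cons.
    apply: is_deriveD; rewrite /t0 /t1.
    have := is_derive_ebasis1 L k (y, x.2) => /= dk.
    by apply: is_derive_eq.
  - by move=> n m y nm; apply: gcauchy => // k z _; exact: term1_le.
have d2 (x : R * R) : is_derive x.2 1 (fun a => crepr (x.1, a)) (series_lim t2 x).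
  have := @is_derive_limit R (fun n a => \sum_(k <- kseq R n) t0 k (x.1, a))
    (fun n a => \sum_(k <- kseq R n) t2 k (x.1, a))
    (fun a => crepr (x.1, a)) (fun a => series_lim t2 (x.1, a))
    (fun n => grad_bound * tail n) x.2.
  rewrite -surjective_pairing; apply=> //.
  - move=> n y; elim: (kseq R n) => [|k s IH].
      under eq_fun do rewrite big_nil; rewrite big_nil; exact: is_derive_cst.
    under eq_fun do rewrite big_cons; rewrite big_cons.
    apply: is_deriveD; rewrite /t0 /t2.
    have := is_derive_ebasis2 L k (x.1, y) => /= dk.
    by apply: is_derive_eq.
  - by move=> n m y nm; apply: gcauchy => // k z _; exact: term2_le.
have p1 : partial1 crepr = series_lim t1.
  by apply/funext => x; rewrite /partial1 derive1E; have [_ ->] := d1 x.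
have p2 : partial2 crepr = series_lim t2.
  by apply/funext => x; rewrite /partial2 derive1E; have [_ ->] := d2 x.
have congr_crepr y z : (forall k, ebasis L k y = ebasis L k z) ->
    crepr y = crepr z.
  move=> yz; rewrite /crepr /series_lim.
  suff -> : (fun n => \sum_(k <- kseq R n) t0 k y) =
            (fun n => \sum_(k <- kseq R n) t0 k z) by [].
  by apply/funext => n; apply: eq_bigr => k _; rewrite /t0 yz.
split; [split|exact: p1|exact: p2|exact: B1|exact: B2].
- by move=> x; split; apply: congr_crepr => k;
    have [] := periodic_ebasis L0 k x.
- split; first exact: C0.
  split.
  + by move=> x; have [] := d1 x.
  + by move=> x; have [] := d2 x.
  + by rewrite p1; split.
  + by rewrite p2; split.
have mS n : measurable_fun setT (fun x => \sum_(k <- kseq R n) t0 k x).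
  apply: measurable_fun_big => k _; apply: measurable_funM => //.
  exact: measurable_ebasis.
have mc : measurable_fun setT crepr.
  by apply: (measurable_fun_cvg mS) => x _; exact: S0.
split; first exact: measurable_funTS.
have ub n : (\int[leb2 R]_(x in torus L)
    ((crepr x - partial_sum L c n x) ^+ 2)%:E <=
    ((2 / L * tail n) ^+ 2 * (L * L))%:E)%E.
  have -> : ((2 / L * tail n) ^+ 2 * (L * L))%:E =
     (\int[leb2 R]_(x in torus L) ((2 / L * tail n) ^+ 2)%:E)%E.
    rewrite integral_cst; last exact: measurable_torus.
    by rewrite EFinM; congr (_ * _)%E; rewrite -leb2_torus.
  apply: ge0_le_integral.
  - exact: measurable_torus.
  - by move=> x _; rewrite lee_fin sqr_ge0.
  - apply/measurable_EFinP/measurable_funX/measurable_funTS.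
    apply: measurable_funB => //.
    by rewrite (funext (partial_sumE L c n)); exact: mS.
  - exact: measurable_cst.
  move=> x _; rewrite lee_fin partial_sumE -real_normK ?num_real//.
  rewrite lerXn2r ?nnegrE//.
  exact: le_trans (normr_ge0 _) (T0 n x).
apply: (@squeeze_cvge _ _ _ _ (cst 0%E) _ (fun n => ((2 / L * tail n) ^+ 2 * (L * L))%:E)).
- apply: nearW => n; rewrite ub andbT; apply: integral_ge0 => x _.
  by rewrite lee_fin sqr_ge0.
- exact: cvg_cst.
apply: cvg_EFin; first exact: nearW.
have -> : 0 = (2 / L * 0) ^+ 2 * (L * L) :> R by rewrite mulr0 expr0n mul0r.
apply: cvgM; last exact: cvg_cst.
have tt : 2 / L * tail n @[n --> \oo] --> 2 / L * 0.
  by apply: cvgM => //; exact: cvg_cst.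
by rewrite expr2; apply: cvgM.
Qed.

End C1Representative.

Lemma periodic_shiftz (R : realType) (f : R -> R) (L : R) :
  (forall a, f (a + L) = f a) -> forall (z : int) a, f (a + z%:~R * L) = f a.
Proof.
move=> fL; have fn (n : nat) a : f (a + n%:R * L) = f a.
  elim: n a => [|n IH] a; first by rewrite mul0r addr0.
  by rewrite -addn1 natrD mulrDl mul1r addrA fL.
case=> n a; first exact: fn.
rewrite NegzE mulrNz mulNr -[n.+1%:~R]/(n.+1%:R : R).
by rewrite -(fn n.+1 (a - _)) subrK.
Qed.

(** Half-open cells: the point [y] has room on its right inside the closed cell. *)
Lemma periodic_reduce (R : realType) (L : R) (x : R * R) : 0 < L ->
  exists y : R * R, [/\ 0 <= y.1 < L, 0 <= y.2 < L &
    forall u, torus_periodic L u -> u x = u y].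
Proof.
move=> L0.
have red (a : R) : exists z : int, 0 <= a + z%:~R * L < L.
  exists (- Num.floor (a / L)); rewrite mulrNz mulNr subr_ge0 ltrBlDr.
  have /andP[fl lf] := floor_itv (a / L).
  rewrite -ler_pdivlMr// fl /= -[X in _ < X + _]mul1r -mulrDl -ltr_pdivrMr//.
  by rewrite addrC; move: lf; rewrite intrD1.
have [z1 h1] := red x.1; have [z2 h2] := red x.2.
exists (x.1 + z1%:~R * L, x.2 + z2%:~R * L); split=> // u pu.
rewrite (@periodic_shiftz _ (fun a => u (a, x.2 + z2%:~R * L)) L); last first.
  by move=> a; have [] := pu (a, x.2 + z2%:~R * L).
rewrite (@periodic_shiftz _ (fun a => u (x.1, a)) L); last first.
  by move=> a; have [] := pu (x.1, a).
by case: x {h1 h2}.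
Qed.

(** Were [g x > 0], then [g > g x / 2] on a small square with lower left corner
    [x], which lies in the cell. *)
Lemma continuous_int0 (R : realType) (L : R) (g : R * R -> R) (x : R * R) :
  continuous g -> (forall y, 0 <= g y) -> measurable_fun (torus L) g ->
  (\int[leb2 R]_(y in torus L) (g y)%:E = 0)%E ->
  0 <= x.1 < L -> 0 <= x.2 < L -> g x = 0.
Proof.
move=> cg g0 mg I0 /andP[x10 x1L] /andP[x20 x2L].
apply/eqP; rewrite eq_le g0 andbT leNgt; apply/negP => gx0.
have e0 : 0 < g x / 2 by rewrite divr_gt0.
have : \forall y \near x, g x / 2 < g y.
  have /cvgrPdist_lt/(_ _ e0) := cg x; apply: filterS => y.
  move=> /(le_lt_trans (ler_norm _)); rewrite ltrBlDr -ltrBlDl.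
  by rewrite {1}(splitr (g x)) addrK.
move/nbhs_ballP => [r /= r0 xr].
pose h := Num.min (r / 2) (Num.min (L - x.1) (L - x.2)).
have h0 : 0 < h by rewrite !lt_min divr_gt0// !subr_gt0 x1L x2L.
have hr : h < r.
  apply: (@le_lt_trans _ _ (r / 2)); first by rewrite ge_min lexx.
  by rewrite ltr_pdivrMr// ltr_pMr// ltr1n.
have h1 : x.1 + h <= L.
  by rewrite -lerBrDl !ge_min lexx orbT.
have h2 : x.2 + h <= L.
  by rewrite -lerBrDl !ge_min lexx !orbT.
pose B : set (R * R) := `[x.1, x.1 + h]%classic `*` `[x.2, x.2 + h]%classic.
have mB : measurable B by apply: measurableX; exact: measurable_itv.
have BT : B `<=` torus L.
  move=> y [] /=; rewrite !in_itv/= => /andP[a1 a2] /andP[b1 b2].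
  split; rewrite /= in_itv/=.
    by rewrite (le_trans x10)//= (le_trans a2).
  by rewrite (le_trans x20)//= (le_trans b2).
have BB y : B y -> g x / 2 < g y.
  move=> [] /=; rewrite !in_itv/= => /andP[a1 a2] /andP[b1 b2]; apply: xr.
  split; rewrite /ball /= distrC ger0_norm ?subr_ge0// ltrBlDl.
    by rewrite (le_lt_trans a2)// ltrD2l.
  by rewrite (le_lt_trans b2)// ltrD2l.
have mBE : leb2 R B = (h * h)%:E.
  rewrite /B product_measure1E//= !lebesgue_measure_itv/= !lte_fin !ltrDl h0.
  by rewrite -!EFinD -EFinM !(addrAC _ h) !subrr !add0r.
have : ((g x / 2 * (h * h))%:E <= \int[leb2 R]_(y in torus L) (g y)%:E)%E.
  apply: (@le_trans _ _ (\int[leb2 R]_(y in B) (g y)%:E)%E); last first.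
    apply: ge0_subset_integral => //; first exact: measurable_torus.
      exact/measurable_EFinP.
    by move=> y _; rewrite lee_fin.
  have -> : (g x / 2 * (h * h))%:E = (\int[leb2 R]_(y in B) (g x / 2)%:E)%E.
    by rewrite integral_cst// EFinM; congr (_ * _)%E; rewrite -mBE.
  apply: ge0_le_integral => //.
  - by move=> y _; rewrite lee_fin ltW.
  - apply/measurable_EFinP; apply: measurable_funS mg => //.
    exact: measurable_torus.
  - by move=> y By; rewrite lee_fin ltW// BB.
by rewrite I0 lee_fin leNgt !mulr_gt0.
Qed.

(** Both functions are [L^2] limits of the same partial sums, so the integral of
    [(v - w)^2] vanishes; continuity and periodicity turn this into equality. *)
Lemma C1_repr_unique (R : realType) (L : R) (c : int * int -> R) v w :
  0 < L -> is_C1_repr L c v -> is_C1_repr L c w -> v = w.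
Proof.
move=> L0 [pv [cv _] [mv Iv]] [pw [cw _] [mw Iw]].
pose g x := (v x - w x) ^+ 2.
have mg : measurable_fun (torus L) g.
  by apply: measurable_funX; exact: measurable_funB.
have cg : continuous g.
  by move=> x; apply: cvgM; apply: cvgB; [exact: cv|exact: cw|exact: cv|exact: cw].
have mps n : measurable_fun (torus L) (partial_sum L c n).
  rewrite (funext (partial_sumE L c n)); apply: measurable_funTS.
  apply: measurable_fun_big => k _; apply: measurable_funM => //.
  exact: measurable_ebasis.
have I0 : (\int[leb2 R]_(y in torus L) (g y)%:E = 0)%E.
  set I := (\int[_]_(y in _) _)%E.
  have le n : (I <= 2%:E *
      (\int[leb2 R]_(x in torus L) ((v x - partial_sum L c n x) ^+ 2)%:E) +
      2%:E *
      (\int[leb2 R]_(x in torus L) ((w x - partial_sum L c n x) ^+ 2)%:E))%E.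
    have msq (u : R * R -> R) : measurable_fun (torus L) u ->
        measurable_fun (torus L) (fun x => ((u x - partial_sum L c n x) ^+ 2)%:E).
      move=> mu; apply/measurable_EFinP/measurable_funX.
      by apply: measurable_funB => //; exact: mps.
    have mt := measurable_torus L.
    have msq2 (u : R * R -> R) : measurable_fun (torus L) u ->
        measurable_fun (torus L)
          (fun x => (2%:E * ((u x - partial_sum L c n x) ^+ 2)%:E)%E).
      by move=> mu; apply: emeasurable_funM => //; exact: msq.
    have sq0 (u : R * R -> R) x : (0 <= ((u x - partial_sum L c n x) ^+ 2)%:E)%E.
      by rewrite lee_fin sqr_ge0.
    have sq20 (u : R * R -> R) x :
        (0 <= 2%:E * ((u x - partial_sum L c n x) ^+ 2)%:E)%E.
      by rewrite -EFinM lee_fin mulr_ge0// sqr_ge0.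
    have Z (u : R * R -> R) : measurable_fun (torus L) u ->
        (2%:E * (\int[leb2 R]_(x in torus L)
                   ((u x - partial_sum L c n x) ^+ 2)%:E) =
         \int[leb2 R]_(x in torus L)
           (2%:E * ((u x - partial_sum L c n x) ^+ 2)%:E))%E.
      move=> mu; by rewrite ge0_integralZl//; exact: msq.
    rewrite (Z _ mv) (Z _ mw) -ge0_integralD; last 5 first.
    - exact: mt.
    - by move=> x _; exact: sq20.
    - exact: msq2.
    - by move=> x _; exact: sq20.
    - exact: msq2.
    apply: ge0_le_integral => //.
    - by move=> x _; rewrite lee_fin sqr_ge0.
    - exact/measurable_EFinP.
    - by apply: emeasurable_funD; exact: msq2.
    move=> x _; rewrite -!EFinM -EFinD lee_fin /g.
    set p := partial_sum L c n x.
    have : 0 <= (v x - p + (w x - p)) ^+ 2 by exact: sqr_ge0.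
    by nra.
  pose A (u : R * R -> R) n :=
    (\int[leb2 R]_(x in torus L) ((u x - partial_sum L c n x) ^+ 2)%:E)%E.
  have cvh : (2%:E * A v n + 2%:E * A w n @[n --> \oo] --> 0)%E.
    have -> : 0%E = (2%:E * 0 + 2%:E * 0 :> \bar R)%E by rewrite !mule0 adde0.
    apply: cvgeD; [by rewrite !mule0| |]; apply: cvgeZl => //.
  have : (cst I n @[n --> \oo] --> 0)%E.
    apply: (squeeze_cvge _ (cvg_cst 0%E) cvh).
    apply: nearW => n; rewrite le andbT; apply: integral_ge0 => x _.
    by rewrite lee_fin sqr_ge0.
  by move=> /(cvg_unique _ (cvg_cst I)) ->.
apply/funext => x; have [y [y1 y2 E]] := periodic_reduce x L0.
have := continuous_int0 cg (fun z => sqr_ge0 _) mg I0 y1 y2.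
rewrite (E _ pv) (E _ pw) => /eqP.
by rewrite sqrf_eq0 subr_eq0 => /eqP.
Qed.

(** Uniqueness identifies the function selected by [grad_at] with the sum of the
    series. *)
Lemma grad_atE (R : realType) (L : R) (c : int * int -> R) M (x : R * R) :
  0 < L -> (forall n, \sum_(k <- kseq R n) knorm k * `|c k| <= M) ->
  has_C1_repr L c /\
  grad_at L c x =
   (series_lim (fun k x => c k * (freq L k.1 * ebasis L (flip1 k) x)) x,
    series_lim (fun k x => c k * (freq L k.2 * ebasis L (flip2 k) x)) x).
Proof.
move=> L0 cM; have [rv p1 p2 _ _] := crepr_spec L0 cM.
split; first by exists (crepr L c).
rewrite /grad_at (@xget_unique _ _ _ (crepr L c) rv).
  by rewrite /grad p1 p2.
by move=> w rw; exact: (C1_repr_unique L0 rw rv).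
Qed.

(** * The nonlinearity *)

Section Nonlinearity.
Context {R : realType}.
Variable L : R.
Hypothesis L0 : 0 < L.
Implicit Types (c : int * int -> R) (z : R * R).

Lemma fnl1_le z : `|(fnl z).1| <= 1 / 2.
Proof.
have n0 : 0 < 1 + enorm z ^+ 2 by rewrite ltr_pwDl// sqr_ge0.
rewrite /= normrM normfV (gtr0_norm n0) ler_pdivrMr//.
rewrite sqr_sqrtr ?addr_ge0 ?sqr_ge0//.
have := sqr_ge0 (`|z.1| - 1); have := sqr_ge0 z.2.
by rewrite -(real_normK (num_real z.1)); nra.
Qed.

Lemma fnl2_le z : `|(fnl z).2| <= 1 / 2.
Proof.
have n0 : 0 < 1 + enorm z ^+ 2 by rewrite ltr_pwDl// sqr_ge0.
rewrite /= normrM normfV (gtr0_norm n0) ler_pdivrMr//.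
rewrite sqr_sqrtr ?addr_ge0 ?sqr_ge0//.
have := sqr_ge0 (`|z.2| - 1); have := sqr_ge0 z.1.
by rewrite -(real_normK (num_real z.2)); nra.
Qed.

Lemma enorm_fnl z : enorm (fnl z) = enorm z / (1 + enorm z ^+ 2).
Proof.
have n0 : 0 < 1 + enorm z ^+ 2 by rewrite ltr_pwDl// sqr_ge0.
rewrite {1}/enorm /= !expr_div_n -mulrDl sqrtrM ?addr_ge0 ?sqr_ge0//.
by congr (_ * _); rewrite sqrtrV ?sqr_ge0// sqrtr_sqr gtr0_norm.
Qed.

(** Either the selected gradient is an [L^2] limit, measurable by definition, or
    it is the default constant. *)
Lemma measurable_wgrad c :
  measurable_fun (torus L) (fun x => (wgrad L c x).1) /\
  measurable_fun (torus L) (fun x => (wgrad L c x).2).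
Proof.
rewrite /wgrad; case: xgetP => [G _ [mG1 mG2 _]|_]; first by split.
by split; exact: measurable_cst.
Qed.

Lemma bounded_meas_fnl c :
  bounded_meas L (fun x => (fnl (wgrad L c x)).1) /\
  bounded_meas L (fun x => (fnl (wgrad L c x)).2).
Proof.
have [m1 m2] := measurable_wgrad c.
have mn : measurable_fun (torus L) (fun x => (1 + enorm (wgrad L c x) ^+ 2)^-1).
  have -> : (fun x => (1 + enorm (wgrad L c x) ^+ 2)^-1) =
      (fun x => (1 + ((wgrad L c x).1 ^+ 2 + (wgrad L c x).2 ^+ 2)) `^ (-1)).
    apply/funext => x; rewrite sqr_sqrtr ?addr_ge0 ?sqr_ge0//.
    by rewrite powR_inv1// !addr_ge0 ?sqr_ge0.
  apply: (measurableT_comp (measurable_powR (-1))).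
  apply: measurable_funD => //; apply: measurable_funD; exact: measurable_funX.
split; split.
- exact: measurable_funM.
- by exists (1 / 2) => x _; exact: fnl1_le.
- exact: measurable_funM.
- by exists (1 / 2) => x _; exact: fnl2_le.
Qed.

Lemma muE k : mu L k = freq L k.1 ^+ 2 + freq L k.2 ^+ 2.
Proof.
rewrite /mu /freq !expr_div_n -mulrDl; congr (_ / _).
by rewrite exprMn knorm_sqr; ring.
Qed.

Lemma mu_gt0 k : nonzero k -> 0 < mu L k.
Proof.
by move=> /(@knorm_gt0 R) k0; rewrite exprn_gt0// divr_gt0// !mulr_gt0// pi_gt0.
Qed.

Lemma tint_sqr_le g : bounded_meas L g ->
  (forall x, `|g x| <= 1 / 2) -> tint L (fun x => g x ^+ 2) <= L * L / 4.
Proof.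
move=> bg gle.
have -> : L * L / 4 = tint L (fun=> 1 / 4).
  rewrite /tint Rintegral_cst; last exact: measurable_torus.
  by rewrite [X in fine X]leb2_torus//=; ring.
apply: le_Rintegral.
- exact: measurable_torus.
- exact: bounded_meas_int (bounded_measM bg bg).
- exact: bounded_meas_int (bounded_meas_cst _ _).
move=> x _; rewrite -real_normK ?num_real//.
have := gle x; have := normr_ge0 (g x); nra.
Qed.

(** [frakF L c k] pairs the two components of [f(grad c)] with
    [freq k_i e_{flip_i k}]; Cauchy's inequality in the two components divides
    out [mu_k = freq k_1^2 + freq k_2^2], and Bessel's inequality applies to
    each component, of modulus at most [1/2]. *)
Lemma frakF_bessel c (s : seq (int * int)) : uniq s ->
  (forall k, k \in s -> nonzero k) ->
  \sum_(k <- s) frakF L c k ^+ 2 / mu L k <= L * L / 2.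
Proof.
move=> us nz; have [b1 b2] := bounded_meas_fnl c.
set g1 := fun x => _ in b1; set g2 := fun x => _ in b2.
pose p1 k := tint L (fun x => g1 x * ebasis L k x).
pose p2 k := tint L (fun x => g2 x * ebasis L k x).
have FE k : frakF L c k = freq L k.1 * p1 (flip1 k) + freq L k.2 * p2 (flip2 k).
  have q1 := bounded_measM b1 (bounded_meas_ebasis L0 (flip1 k)).
  have q2 := bounded_measM b2 (bounded_meas_ebasis L0 (flip2 k)).
  rewrite /frakF /p1 /p2 -(tintZ L0 _ q1) -(tintZ L0 _ q2) -(tintD L0); last 2 first.
  - exact: bounded_measM (bounded_meas_cst _ _) q1.
  - exact: bounded_measM (bounded_meas_cst _ _) q2.
  congr (Rintegral _ _ _); apply/funext => x.
  rewrite /dot /grad partial1_ebasis partial2_ebasis /g1 /g2 /=; ring.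
have s1 : \sum_(k <- s) p1 (flip1 k) ^+ 2 <= L * L / 4.
  rewrite -(big_map flip1 xpredT (fun k => p1 k ^+ 2)).
  apply: (le_trans (bessel L0 b1 _)).
    by rewrite map_inj_uniq// => -[a b] [a' b'] [/oppr_inj -> ->].
  by apply: tint_sqr_le => // x; exact: fnl1_le.
have s2 : \sum_(k <- s) p2 (flip2 k) ^+ 2 <= L * L / 4.
  rewrite -(big_map flip2 xpredT (fun k => p2 k ^+ 2)).
  apply: (le_trans (bessel L0 b2 _)).
    by rewrite map_inj_uniq// => -[a b] [a' b'] [-> /oppr_inj ->].
  by apply: tint_sqr_le => // x; exact: fnl2_le.
have -> : L * L / 2 = L * L / 4 + L * L / 4 by field.
apply: le_trans (lerD s1 s2); rewrite -big_split /=.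
rewrite big_seq [leRHS]big_seq; apply: ler_sum => k /nz nk.
rewrite ler_pdivrMr ?mu_gt0// FE muE -subr_ge0.
set a := freq L k.1; set b := freq L k.2; set u := p1 _; set v := p2 _.
have -> : (u ^+ 2 + v ^+ 2) * (a ^+ 2 + b ^+ 2) - (a * u + b * v) ^+ 2 =
          (a * v - b * u) ^+ 2 by ring.
exact: sqr_ge0.
Qed.

End Nonlinearity.

(** * The nonlinear convolution *)

Lemma expRN_le_powR (R : realType) (x th : R) : 0 < x -> 0 <= th <= 1 ->
  expR (- x) <= (x `^ th)^-1.
Proof.
move=> x0 /andP[th0 th1]; rewrite expRN lef_pV2 ?posrE ?expR_gt0 ?powR_gt0//.
have [x1|x1] := leP x 1.
  have H : x `^ th <= 1 `^ th by rewrite ge0_ler_powR// ?nnegrE// ltW.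
  rewrite powR1 in H; apply: (le_trans H).
  by rewrite -[leLHS]expR0 ler_expR ltW.
apply: (le_trans (ler1_powR (ltW x1) th1)).
by apply: le_trans (expR_ge1Dx x); rewrite lerDr.
Qed.

(** The shift by [eps] keeps [(t - s)^{-7/8}] continuous up to [s = t]; the
    integral stays bounded as [eps] decreases. *)
Section SingularKernel.
Context {R : realType}.
Variables (t eps : R).
Hypotheses (t0 : 0 < t) (eps0 : 0 < eps).

Let q (s : R) : R := (t - s + eps) `^ (8^-1 - 1).
Let G (s : R) : R := - (8 * (t - s + eps) `^ 8^-1).

Let dG (s : R) : s <= t -> is_derive s 1 G (q s).
Proof.
move=> st.
have p0 : 0 < t - s + eps by rewrite ltr_wpDl// subr_ge0.
have d1 : is_derive s 1 (fun s : R => t - s + eps) (- 1).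
  by apply: is_derive_eq; rewrite /GRing.scale /=; ring.
have d2 := is_derive1_powR 8^-1 p0.
have d3 := @is_derive1_comp R (fun y => y `^ 8^-1) (fun s : R => t - s + eps) s _ _ d2 d1.
rewrite /G /q.
have -> : (fun s0 => - (8 * (t - s0 + eps) `^ 8^-1)) =
  - (8 *: ((fun y => y `^ 8^-1) \o (fun s : R => t - s + eps))) by apply/funext.
by apply: is_derive_eq; rewrite /GRing.scale /=; field.
Qed.

Let cq : {within `[0, t], continuous q}.
Proof.
apply: continuous_in_subspaceT => s; rewrite inE /= in_itv/= => /andP[_ st].
have p0 : 0 < t - s + eps by rewrite ltr_wpDl// subr_ge0.
have d2 := is_derive1_powR (8^-1 - 1) p0.
apply: (@continuous_comp _ _ _ (fun s : R => t - s + eps) (fun y => y `^ (8^-1 - 1))).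
  apply: cvgD; last exact: cvg_cst.
  by apply: cvgB; [exact: cvg_cst|exact: cvg_id].
apply/differentiable_continuous/derivable1_diffP.
by have [] := d2.
Qed.

Lemma integrable_singular :
  lebesgue_measure.-integrable `[0, t] (EFin \o q).
Proof.
by apply: continuous_compact_integrable => //; exact: segment_compact.
Qed.

Lemma integral_singular :
  \int[lebesgue_measure]_(s in `[0, t]) q s <= 8 * (t + eps) `^ 8^-1.
Proof.
have contG (s : R) : s <= t -> {for s, continuous G}.
  move=> st; apply/differentiable_continuous/derivable1_diffP.
  by have [] := dG st.
rewrite /Rintegral (continuous_FTC2 (F := G) t0 cq).
- rewrite /G subrr add0r subr0 /= opprK.
  by rewrite gerDr oppr_le0 mulr_ge0// powR_ge0.
- split.
  + move=> s; rewrite in_itv/= => /andP[_ /ltW st].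
    by have [] := dG st.
  + exact/cvg_at_right_filter/contG/ltW.
  + exact/cvg_at_left_filter/contG.
- move=> s; rewrite in_itv/= => /andP[_ /ltW st].
  by rewrite derive1E; have [_ ->] := dG st.
Qed.

End SingularKernel.

Section ConvolutionBound.
Context {R : realType}.
Variables (L T : R).
Hypotheses (L0 : 0 < L) (T0 : 0 < T).

(** The unit of frequency: [sqrt mu_k = wave |k|]. *)
Definition wave : R := 2 * pi / L.

Lemma wave_gt0 : 0 < wave.
Proof. by rewrite /wave divr_gt0// mulr_gt0// pi_gt0. Qed.

Lemma mu_wave k : mu L k = (wave * knorm k) ^+ 2.
Proof. by rewrite /mu /wave mulrAC. Qed.

Definition conv_bound (E : R) : R :=
  8 * (T + 1) `^ 8^-1 * (expR 1 / (2 * wave) * (512 / wave ^+ 3 + E)).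

(** Put [kappa = sqrt mu_k] and [F_k = kappa f_k], with [f] bounded in [l^2] by
    [E]. Then, up to constants, [kappa e^{-tau kappa^4} |F_k|] is at most
    [tau^{-7/8} kappa^{-3/2} |f_k|], hence at most
    [tau^{-7/8} (kappa^{-3} + f_k^2) / 2], which is summable in [k] and
    integrable in [tau = t - s]. *)
Lemma convolution_bound (F : R -> int * int -> R) (E t : R) (n : nat) :
  0 < t <= T ->
  (forall k, k \in kseq R n -> lebesgue_measure.-integrable `[0, t]
     (fun s => (expR (- ((t - s) * mu L k ^+ 2)) * F s k)%:E)) ->
  (forall s, \sum_(k <- kseq R n) F s k ^+ 2 / mu L k <= E) ->
  \sum_(k <- kseq R n) knorm k *
    `|\int[lebesgue_measure]_(s in `[0, t])
        (expR (- ((t - s) * mu L k ^+ 2)) * F s k)| <= conv_bound E.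
Proof.
move=> /andP[t0 tT] Fi FE.
pose h k s := expR (- ((t - s) * mu L k ^+ 2)) * F s k.
have w0 := wave_gt0.
(* with this shift [eps * mu_k ^+ 2 <= 1] for all modes of [kseq R n], so that
   replacing [t - s] by [t - s + eps] costs a factor [e] *)
pose eps := (1 + (wave * n%:R) ^+ 4)^-1.
have D1 : 1 <= 1 + (wave * n%:R) ^+ 4 by rewrite lerDl exprn_ge0// mulr_ge0// ltW.
have D0 : 0 < 1 + (wave * n%:R) ^+ 4 by rewrite (lt_le_trans _ D1).
have eps0 : 0 < eps by rewrite invr_gt0.
have eps1 : eps <= 1 by rewrite invf_le1.
pose q s := (t - s + eps) `^ (8^-1 - 1).
pose K := expR 1 / (2 * wave) * (512 / wave ^+ 3 + E).
have ptw s : 0 <= s <= t -> \sum_(k <- kseq R n) knorm k * `|h k s| <= K * q s.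
  move=> /andP[s0 st].
  have p0 : 0 < t - s + eps by rewrite ltr_wpDl// subr_ge0.
  have q0 : 0 < q s by rewrite powR_gt0.
  have key k : k \in kseq R n -> knorm k * `|h k s| <=
      expR 1 / (2 * wave) * (((knorm k ^+ 3)^-1 / wave ^+ 3 + F s k ^+ 2 / mu L k)) * q s.
    move=> kn; have nz := kseq_nonzero kn.
    have k0 : 0 < @knorm R k by apply/knorm_gt0.
    have kle : @knorm R k <= n%:R by move: kn; rewrite mem_kseq => /andP[].
    (* [r ^ 2 = sqrt mu_k] makes all the powers below integral *)
    pose r := Num.sqrt (wave * knorm k).
    have r0 : 0 < r by rewrite sqrtr_gt0 mulr_gt0.
    have r2 : r ^+ 2 = wave * knorm k by rewrite sqr_sqrtr// mulr_ge0// ltW.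
    have muE : mu L k = r ^+ 4 by rewrite mu_wave -r2 -exprM.
    have knE : knorm k = r ^+ 2 / wave by rewrite r2 mulrAC divff ?mul1r ?gt_eqF.
    have eE : expR (- ((t - s) * mu L k ^+ 2)) <= expR 1 * (q s * (r ^+ 7)^-1).
      have -> : - ((t - s) * mu L k ^+ 2) =
          eps * mu L k ^+ 2 + - ((t - s + eps) * mu L k ^+ 2) by ring.
      rewrite expRD; apply: ler_pM; rewrite ?expR_ge0//.
        rewrite ler_expR /eps mulrC ler_pdivrMr// mul1r.
        rewrite mu_wave -exprM (le_trans (y := (wave * n%:R) ^+ 4))//.
          have wk : wave * knorm k <= wave * n%:R by rewrite ler_wpM2l// ltW.
          by apply: lerXn2r; rewrite ?nnegrE// mulr_ge0// ltW.
        by rewrite lerDr.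
      have x0 : 0 < (t - s + eps) * mu L k ^+ 2.
        by rewrite mulr_gt0// muE -exprM exprn_gt0.
      have th : 0 <= (1 - 8^-1 : R) <= 1 by lra.
      apply: (le_trans (expRN_le_powR x0 th)).
      rewrite powRM ?(ltW p0)// ?sqr_ge0// invfM /q -powRN opprB.
      rewrite muE -exprM -(powR_mulrn _ (ltW r0)) -powRrM.
      have -> : (4 * 2)%:R * (1 - 8^-1) = 7%:R :> R by rewrite natrM; field.
      by rewrite powR_mulrn// ltW.
    have hE : `|h k s| <= expR 1 * (q s * (r ^+ 7)^-1) * `|F s k|.
      by rewrite normrM ger0_norm ?expR_ge0// ler_wpM2r.
    apply: (le_trans (ler_wpM2l (ltW k0) hE)).
    rewrite muE knE.
    have -> : ((r ^+ 2 / wave) ^+ 3)^-1 / wave ^+ 3 = r ^- 6.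
      by field; rewrite !gt_eqF.
    rewrite -(real_normK (num_real (F s k))).
    set f := `|F s k|.
    have -> : r ^+ 2 / wave * (expR 1 * (q s * (r ^+ 7)^-1) * f) =
        expR 1 / (2 * wave) * (2 * (r ^- 3 * (f / r ^+ 2))) * q s.
      by field; rewrite !gt_eqF.
    apply: ler_wpM2r; first exact: ltW.
    apply: ler_wpM2l; first by rewrite divr_ge0 ?expR_ge0// mulr_ge0// ltW.
    have -> : r ^- 6 = (r ^- 3) ^+ 2 by rewrite exprVn -exprM.
    have -> : f ^+ 2 / r ^+ 4 = (f / r ^+ 2) ^+ 2 by rewrite expr_div_n -exprM.
    have := sqr_ge0 (r ^- 3 - f / r ^+ 2); nra.
  rewrite /K; apply: (@le_trans _ _ (\sum_(k <- kseq R n) expR 1 / (2 * wave) *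
      (((knorm k ^+ 3)^-1 / wave ^+ 3 + F s k ^+ 2 / mu L k)) * q s)).
    by rewrite big_seq [leRHS]big_seq; apply: ler_sum => k; exact: key.
  rewrite -mulr_suml -mulr_sumr; apply: ler_wpM2r; first exact: ltW.
  apply: ler_wpM2l; first by rewrite divr_ge0 ?expR_ge0// mulr_ge0// ltW.
  rewrite big_split /= -mulr_suml lerD ?FE//.
  by rewrite ler_pM2r ?invr_gt0 ?exprn_gt0// sum_knorm_cube.
have K0 : 0 <= K.
  have E0 : 0 <= E.
    apply: le_trans (FE 0); apply: sumr_ge0 => k _; apply: divr_ge0.
      exact: sqr_ge0.
    exact: sqr_ge0.
  apply: mulr_ge0; first by rewrite divr_ge0 ?expR_ge0// mulr_ge0// ltW.
  apply: addr_ge0; last exact: E0.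
  by apply: divr_ge0; [exact: ler0n|apply/exprn_ge0/ltW].
have iq : lebesgue_measure.-integrable `[0, t] (EFin \o q).
  exact: integrable_singular.
have ih k : k \in kseq R n -> lebesgue_measure.-integrable `[0, t]
    (EFin \o (fun s => knorm k * `|h k s|)).
  move=> kn; have := integrable_abse (Fi k kn) => /integrableZl - /(_ _ (knorm k)).
  move=> /(_ (measurable_itv _)); apply: eq_integrable => //.
have mI : @measurable _ (measurableTypeR R) `[0, t] by exact: measurable_itv.
have step s : (forall k, k \in s -> k \in kseq R n) ->
  \sum_(k <- s) knorm k * `|\int[lebesgue_measure]_(u in `[0, t]) h k u| <=
  \int[lebesgue_measure]_(u in `[0, t]) (\sum_(k <- s) knorm k * `|h k u|) /\
  lebesgue_measure.-integrable `[0, t]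
    (EFin \o (fun u => \sum_(k <- s) knorm k * `|h k u|)).
  elim: s => [|k s IH] sub.
    have -> : (fun u => \sum_(k <- [::]) knorm k * `|h k u|) = (fun=> 0).
      by apply/funext => u; rewrite big_nil.
    split; last exact: integrable0.
    by rewrite big_nil; exact: Rintegral_ge0.
  have [|IH1 IH2] := IH; first by move=> l ls; apply: sub; rewrite in_cons ls orbT.
  have kn : k \in kseq R n by apply: sub; rewrite mem_head.
  have -> : (fun u => \sum_(k <- k :: s) knorm k * `|h k u|) =
      (fun u => knorm k * `|h k u| + \sum_(k <- s) knorm k * `|h k u|).
    by apply/funext => u; rewrite big_cons.
  split; last first.
    have := integrableD mI (ih k kn) IH2.
    by apply: eq_integrable.
  rewrite big_cons RintegralD//; last exact: ih.
  apply: lerD IH1.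
  rewrite RintegralZl//; last exact: integrable_norm (Fi k kn).
  by rewrite ler_wpM2l ?knorm_ge0// le_normr_Rintegral//; exact: Fi.
have [S1 S2] := step (kseq R n) (fun k kn => kn).
apply: (le_trans S1).
apply: (@le_trans _ _ (\int[lebesgue_measure]_(u in `[0, t]) (K * q u))).
  apply: le_Rintegral => //.
  have := integrableZl mI K iq.
  by apply: eq_integrable.
rewrite RintegralZl// /conv_bound -/K mulrC ler_wpM2r//.
apply: (le_trans (integral_singular t0 eps0)).
rewrite ler_pM2l// ge0_ler_powR// ?nnegrE ?addr_ge0 ?(ltW t0) ?(ltW T0) ?(ltW eps0)//.
exact: lerD.
Qed.

End ConvolutionBound.

(** * Covariance of the noise gradient *)

Section Covariance.
Context {R : realType}.
Variable L : R.
Hypothesis L0 : 0 < L.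
Implicit Types (k : int * int) (x : R * R) (N n : nat).

Definition swap k : int * int := (k.2, k.1).

(** The balls of modes are stable under every involution that preserves [|k|]. *)
Lemma sum_kseq_reindex (F : int * int -> R) (f : int * int -> int * int) N :
  involutive f -> (forall k, @knorm R (f k) = knorm k) ->
  \sum_(k <- kseq R N) F (f k) = \sum_(k <- kseq R N) F k.
Proof.
move=> invf normf; rewrite -(big_map f xpredT F); apply: perm_big.
apply: uniq_perm.
- rewrite map_inj_uniq ?uniq_kseq//; exact: inv_inj.
- exact: uniq_kseq.
move=> k; rewrite -{1}(invf k) (mem_map (inv_inj invf)).
by rewrite !mem_kseq normf.
Qed.

Lemma flip1K : involutive flip1.
Proof. by case=> a b; rewrite /flip1 /= opprK. Qed.

Lemma flip2K : involutive flip2.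
Proof. by case=> a b; rewrite /flip2 /= opprK. Qed.

Lemma swapK : involutive swap.
Proof. by case. Qed.

Lemma knorm_flip1 k : @knorm R (flip1 k) = knorm k.
Proof. by rewrite /knorm /enorm /= mulrNz sqrrN. Qed.

Lemma knorm_flip2 k : @knorm R (flip2 k) = knorm k.
Proof. by rewrite /knorm /enorm /= mulrNz sqrrN. Qed.

Lemma knorm_swap k : @knorm R (swap k) = knorm k.
Proof. by rewrite /knorm /enorm /= addrC. Qed.

Section Weighted.
Variables (w : R -> R) (N : nat) (x : R * R).

Let d1 k := freq L k.1 * ebasis L (flip1 k) x.
Let d2 k := freq L k.2 * ebasis L (flip2 k) x.
(** The common value of the two diagonal entries of the covariance matrix when
    the mode [k] carries the variance [w |k|]. *)
Definition radial_mass : R :=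
  \sum_(k <- kseq R N) w (knorm k) * mu L k / (2 * L ^+ 2).

(** Reversing [k_1] permutes the factors [omega (+-k_i)] of the product of the
    two derivatives and changes the sign of [freq k_1]. *)
Lemma sum_cross0 : \sum_(k <- kseq R N) w (knorm k) * d1 k * d2 k = 0.
Proof.
set S := \sum_(k <- _) _.
suff : S = - S by lra.
rewrite /S -[LHS](sum_kseq_reindex _ N flip1K knorm_flip1) -sumrN.
apply: eq_bigr => k _; rewrite knorm_flip1 /d1 /d2 /ebasis /flip1 /flip2 /=.
by rewrite freqN opprK; ring.
Qed.

(** Averaging with the exchange of [k_1] and [k_2] replaces [freq k_1^2] by
    [mu_k / 2]. *)
Lemma sum_freq : \sum_(k <- kseq R N) w (knorm k) * freq L k.1 ^+ 2 / L ^+ 2 =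
  radial_mass.
Proof.
set S := \sum_(k <- _) _.
have S' : S = \sum_(k <- kseq R N) w (knorm k) * freq L k.2 ^+ 2 / L ^+ 2.
  rewrite /S -[LHS](sum_kseq_reindex _ N swapK knorm_swap).
  by apply: eq_bigr => k _; rewrite knorm_swap.
suff : 2 * S = 2 * radial_mass by lra.
rewrite mulr2n mulrDl mul1r {2}S' /S -big_split /radial_mass mulr_sumr.
apply: eq_bigr => k _; rewrite muE/=.
by field; rewrite gt_eqF.
Qed.

(** [G] is the average of [F] over the four sign changes of the components. *)
Lemma four_flips (F : int * int -> R) (G : int * int -> R) :
  (forall k, F k + F (flip1 k) + (F (flip2 k) + F (flip1 (flip2 k))) = 4 * G k) ->
  \sum_(k <- kseq R N) F k = \sum_(k <- kseq R N) G k.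
Proof.
move=> FG; apply: (@mulfI _ 4) => //.
rewrite [RHS]mulr_sumr; under [RHS]eq_bigr do rewrite -FG.
rewrite !big_split /= (sum_kseq_reindex F N flip1K knorm_flip1).
rewrite (sum_kseq_reindex F N flip2K knorm_flip2).
rewrite (sum_kseq_reindex (fun k => F (flip1 k)) N flip2K knorm_flip2).
by rewrite (sum_kseq_reindex F N flip1K knorm_flip1); ring.
Qed.

(** Averaged over the sign changes, the squares of the modes add up to constants
    by [omega_sqr_add], so the dependence on [x] disappears. *)
Lemma sum_diag1 : \sum_(k <- kseq R N) w (knorm k) * d1 k ^+ 2 = radial_mass.
Proof.
rewrite -sum_freq; apply: four_flips => k.
rewrite !knorm_flip1 !knorm_flip2 /d1 /ebasis /flip1 /flip2 /= !freqN !opprK.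
have o1 := omega_sqr_add L0 k.1 x.1; have o2 := omega_sqr_add L0 k.2 x.2.
set a := omega L k.1 x.1 in o1 *; set a' := omega L (- k.1) x.1 in o1 *.
set b := omega L k.2 x.2 in o2 *; set b' := omega L (- k.2) x.2 in o2 *.
transitivity (w (knorm k) * freq L k.1 ^+ 2 *
  ((a ^+ 2 + a' ^+ 2) * (b ^+ 2 + b' ^+ 2))); first by ring.
by rewrite o1 o2; field; rewrite gt_eqF.
Qed.

Lemma sum_diag2 : \sum_(k <- kseq R N) w (knorm k) * d2 k ^+ 2 = radial_mass.
Proof.
rewrite -sum_diag1 -[LHS](sum_kseq_reindex _ N swapK knorm_swap).
transitivity (\sum_(k <- kseq R N) w (knorm k) * freq L k.1 ^+ 2 / L ^+ 2); last first.
  by rewrite sum_diag1 sum_freq.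
apply: four_flips => k.
rewrite !knorm_swap !knorm_flip1 !knorm_flip2 /d2 /ebasis /flip1 /flip2 /swap /=.
rewrite !freqN !opprK.
have o1 := omega_sqr_add L0 k.1 x.2; have o2 := omega_sqr_add L0 k.2 x.1.
set a := omega L k.1 x.2 in o1 *; set a' := omega L (- k.1) x.2 in o1 *.
set b := omega L k.2 x.1 in o2 *; set b' := omega L (- k.2) x.1 in o2 *.
transitivity (w (knorm k) * freq L k.1 ^+ 2 *
  ((a ^+ 2 + a' ^+ 2) * (b ^+ 2 + b' ^+ 2))); first by ring.
by rewrite o1 o2; field; rewrite gt_eqF.
Qed.

End Weighted.

Lemma expR_le_1D2x (y : R) : 0 <= y <= 1 / 2 -> expR y <= 1 + 2 * y.
Proof.
move=> /andP[y0 y1].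
have := expR_ge1Dx (- y); rewrite expRN.
have e0 := expR_gt0 y; move=> H.
have y1' : 0 < 1 - y by lra.
have : expR y * (1 - y) <= 1 by rewrite -ler_pdivlMl// mulr1.
by nra.
Qed.

(** The variance of the left-point Riemann sum with [n] steps of the integral of
    [e^{-(t - s) m}] over [[0, t]]. *)
Definition riemann_variance (t m : R) (n : nat) : R :=
  \sum_(i <- iota 0 n) t / n%:R * expR (- ((t - t / n%:R * i%:R) * m)) ^+ 2.

(** The exact value is [(1 - e^{-2 t m}) / (2 m)]. For the Riemann sum each term is
    compared with an increment of [E i = e^{-2 (t - h i) m}], at the cost of a
    factor 2 since [e^y - 1 <= 2 y] for [y = 2 h m <= 1/2]. *)
Lemma riemann_variance_ge (t m : R) (n : nat) :
  0 < t -> 0 < m -> 1 <= t * m -> 4 * t * m <= n.+1%:R ->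
  1 / (8 * m) <= riemann_variance t m n.+1.
Proof.
move=> t0 m0 tm nm; rewrite /riemann_variance; set h := t / n.+1%:R.
have n0 : 0 < n.+1%:R :> R by rewrite ltr0n.
have h0 : 0 < h by rewrite divr_gt0.
have hm : 0 <= 2 * h * m <= 1 / 2.
  have -> : 2 * h * m = 2 * t * m / n.+1%:R.
    by rewrite /h; field; rewrite gt_eqF.
  apply/andP; split; last by rewrite ler_pdivrMr//; lra.
  by rewrite divr_ge0 ?(ltW n0)// mulr_ge0 ?(ltW m0)// mulr_ge0// ltW.
pose E i := expR (- (2 * (t - h * i%:R) * m)).
have EE i : expR (- ((t - h * i%:R) * m)) ^+ 2 = E i.
  by rewrite expr2 -expRD /E; congr expR; ring.
have step i : (E i.+1 - E i) / (4 * m) <= h * E i.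
  have -> : E i.+1 = E i * expR (2 * h * m).
    rewrite /E -expRD; congr expR; rewrite -natr1; ring.
  have Ei := expR_gt0 (- (2 * (t - h * i%:R) * m)); rewrite -/(E i) in Ei.
  rewrite ler_pdivrMr ?mulr_gt0//.
  have := expR_le_1D2x hm; nra.
have tel j : (E j - E 0%N) / (4 * m) <= \sum_(i <- iota 0 j) h * E i.
  elim: j => [|j IH]; first by rewrite subrr mul0r big_nil.
  rewrite -[X in iota 0 X]addn1 iotaD big_cat big_seq1 add0n /=.
  apply: le_trans (lerD IH (step j)).
  have -> : E j.+1 - E 0%N = (E j - E 0%N) + (E j.+1 - E j) by ring.
  by rewrite mulrDl.
have En : E n.+1 = 1.
  rewrite /E (_ : t - h * n.+1%:R = 0) ?mulr0 ?mul0r ?oppr0 ?expR0//.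
  by rewrite /h divfK ?subrr// gt_eqF.
have E0 : E 0%N <= 1 / 2.
  rewrite /E mulr0 subr0 expRN div1r lef_pV2 ?posrE ?expR_gt0//.
  apply: le_trans (expR_ge1Dx _); nra.
under eq_bigr do rewrite EE.
apply: le_trans (tel n.+1); rewrite En.
rewrite ler_pdivlMr ?mulr_gt0// mulrAC -mulrA.
have -> : 1 * (4 * m / (8 * m)) = 1 / 2 by field; rewrite gt_eqF.
lra.
Qed.

End Covariance.

Lemma ler_sum_subseq (R : numDomainType) (I : eqType) (s s' : seq I)
    (F : I -> R) : uniq s -> uniq s' -> {subset s' <= s} ->
  (forall i, i \in s -> 0 <= F i) ->
  \sum_(i <- s') F i <= \sum_(i <- s) F i.
Proof.
move=> us us' sub F0.
have -> : \sum_(i <- s') F i = \sum_(i <- s | i \in s') F i.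
  rewrite -[RHS]big_filter; apply: perm_big; apply: uniq_perm => //.
    exact: filter_uniq.
  move=> i; rewrite mem_filter; case: (boolP (i \in s')) => //= /sub ->//.
rewrite [leRHS](bigID (mem s')) /= lerDl big_seq_cond sumr_ge0// => i.
by case/andP => /F0.
Qed.

Lemma leq_six_third (N : nat) : (3 <= N)%N -> (N <= 6 * (N %/ 3))%N.
Proof.
move=> N3; have := divn_eq N 3; have := ltn_pmod N (isT : (0 < 3)%N).
lia.
Qed.

Section VarianceLowerBound.
Context {R : realType}.
Variables L alpha sigma : R.
Hypotheses (L0 : 0 < L) (alpha01 : 0 < alpha < 1) (sigma0 : 0 < sigma).

(** The factor [sigma mu_k^{alpha/2}] of the mode [k], as a function of [|k|]. *)
Definition mode_amp (r : R) : R := sigma * ((wave L * r) ^+ 2) `^ (alpha / 2).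

Definition riemann_weight (t : R) (n : nat) (r : R) : R :=
  mode_amp r ^+ 2 * riemann_variance t (((wave L * r) ^+ 2) ^+ 2) n.+1.

(** The constant [c] of the lower bound [c N^{2 alpha}] for the variance; it
    collects [1/16] per mode ([1/8] from [riemann_variance_ge]) and the [1/36]
    lost in replacing [N / 3] by [N / 6]. *)
Definition var_const : R :=
  sigma ^+ 2 * (wave L ^+ 2) `^ (alpha - 1) / (24 * L) ^+ 2.

Lemma var_const_gt0 : 0 < var_const.
Proof.
rewrite /var_const divr_gt0//; last by rewrite exprn_gt0// mulr_gt0.
by rewrite mulr_gt0 ?exprn_gt0// powR_gt0// exprn_gt0// wave_gt0.
Qed.

Lemma riemann_variance_ge0 (t m : R) (n : nat) : 0 <= t ->
  0 <= riemann_variance t m n.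
Proof. by move=> t0; apply: sumr_ge0 => i _; rewrite mulr_ge0 ?sqr_ge0// divr_ge0. Qed.

(** A mode contributes [mu_k^{alpha - 1}] up to constants once
    [t mu_k^2 >= 1]. There are at least [(N/6)^2] such modes, those with both
    components in [[N/3, 2N/3)], and [mu_k^{alpha - 1}] is smallest at
    [|k| = N] since [alpha < 1]. *)
Lemma radial_mass_ge (t : R) (N n : nat) : (3 <= N)%N -> 0 < t ->
  1 <= t * (wave L * (N %/ 3)%:R) ^+ 4 ->
  4 * t * (wave L * N%:R) ^+ 4 <= n.+1%:R ->
  var_const * N%:R `^ (2 * alpha) <= radial_mass L (riemann_weight t n) N.
Proof.
move=> N3 t0 tM tN; set M := (N %/ 3)%N in tM.
have w0 : 0 < wave L := wave_gt0 L0.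
have [a0 a1] := andP alpha01.
have M0 : (0 < M)%N by rewrite divn_gt0.
have M3 : (M * 3 <= N)%N by rewrite leq_divM.
have M6 : (N <= M * 6)%N by rewrite mulnC leq_six_third.
have N0 : 0 < N%:R :> R by rewrite ltr0n (leq_trans _ N3).
pose G := [seq (Posz a, Posz b) | a <- iota M M, b <- iota M M].
have uG : uniq G.
  apply: allpairs_uniq; try exact: iota_uniq.
  by move=> [a b] [a' b'] _ _ [-> ->].
have GP k : k \in G -> exists a b : nat, [/\ k = (Posz a, Posz b),
    (M <= a < M + M)%N & (M <= b < M + M)%N].
  by move=> /allpairsP[[a b] /= []]; rewrite !mem_iota => ha hb ->; exists a, b.
have Gsqr k : k \in G -> M%:R <= knorm k :> R /\ knorm k <= N%:R :> R.
  move=> /GP[a [b [-> /andP[a1' a2] /andP[b1 b2]]]].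
  have kn0 := @knorm_ge0 R (Posz a, Posz b).
  split; rewrite -ler_sqr ?nnegrE// knorm_sqr /= -![_%:~R]/(_%:R : R).
    rewrite -!natrX -natrD ler_nat (leq_trans _ (leq_addr _ _))//.
    by rewrite leq_exp2r.
  rewrite -!natrX -natrD ler_nat.
  have Ha : (a ^ 2 <= (2 * M) ^ 2)%N by rewrite leq_exp2r// mul2n -addnn ltnW.
  have Hb : (b ^ 2 <= (2 * M) ^ 2)%N by rewrite leq_exp2r// mul2n -addnn ltnW.
  have HN : ((M * 3) ^ 2 <= N ^ 2)%N by rewrite leq_exp2r.
  rewrite !expnMn in Ha Hb HN; apply: leq_trans (leq_add Ha Hb) _.
  by apply: leq_trans HN; rewrite -mulnDl mulnC leq_mul2l orbT.
have Gk k : k \in G -> k \in kseq R N.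
  move=> /Gsqr[k1 k2]; rewrite mem_kseq k2 andbT (lt_le_trans _ k1)// ltr0n.
  exact: M0.
pose F k := riemann_weight t n (knorm k) * mu L k / (2 * L ^+ 2).
rewrite /radial_mass -[leRHS]/(\sum_(k <- kseq R N) F k).
have F0 k : 0 <= F k.
  apply: divr_ge0; last by rewrite mulr_ge0// sqr_ge0.
  apply: mulr_ge0; last exact: sqr_ge0.
  by apply: mulr_ge0; [exact: sqr_ge0|exact/riemann_variance_ge0/ltW].
have FG k : k \in G ->
    sigma ^+ 2 * ((wave L * N%:R) ^+ 2) `^ (alpha - 1) / (16 * L ^+ 2) <= F k.
  move=> kG; have [k1 k2] := Gsqr k kG.
  have k0 : 0 < @knorm R k by rewrite (lt_le_trans _ k1)// ltr0n.
  have wk0 : 0 <= wave L * knorm k by rewrite mulr_ge0// ltW.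
  have wM0 : 0 <= wave L * M%:R by rewrite mulr_ge0// ltW.
  have wN0 : 0 <= wave L * N%:R by rewrite mulr_ge0// ltW.
  have wMk : wave L * M%:R <= wave L * knorm k by rewrite ler_wpM2l// ltW.
  have wkN : wave L * knorm k <= wave L * N%:R by rewrite ler_wpM2l// ltW.
  set mu_ := mu L k.
  have muE' : mu_ = (wave L * knorm k) ^+ 2 by exact: mu_wave.
  have mu0 : 0 < mu_ by rewrite muE' exprn_gt0// mulr_gt0.
  rewrite /F /riemann_weight /mode_amp -muE' -/mu_.
  have V : 1 / (8 * mu_ ^+ 2) <= riemann_variance t (mu_ ^+ 2) n.+1.
    apply: riemann_variance_ge => //; first by rewrite exprn_gt0.
      apply: (le_trans tM); rewrite ler_pM2l// muE' -exprM.
      by apply: lerXn2r; rewrite ?nnegrE.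
    apply: le_trans tN; rewrite ler_pM2l ?mulr_gt0// muE' -exprM.
    by apply: lerXn2r; rewrite ?nnegrE.
  have amp : (sigma * mu_ `^ (alpha / 2)) ^+ 2 = sigma ^+ 2 * mu_ `^ alpha.
    rewrite exprMn; congr (_ * _).
    rewrite -powR_mulrn ?powR_ge0// -powRrM; by congr (_ `^ _); field.
  rewrite amp.
  apply: (@le_trans _ _ (sigma ^+ 2 * mu_ `^ alpha * (1 / (8 * mu_ ^+ 2)) *
      mu_ / (2 * L ^+ 2))); last first.
    rewrite ler_pM2r ?invr_gt0 ?mulr_gt0 ?exprn_gt0//.
    rewrite ler_pM2r// ler_pM2l// mulr_gt0 ?exprn_gt0//.
    exact: powR_gt0.
  have pE : mu_ `^ alpha = mu_ `^ (alpha - 1) * mu_.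
    rewrite -[X in _ * X]powRr1 ?ltW// -powRD ?subrK//.
    by rewrite gt_eqF// implybT.
  rewrite pE.
  have -> : sigma ^+ 2 * (mu_ `^ (alpha - 1) * mu_) * (1 / (8 * mu_ ^+ 2)) *
      mu_ / (2 * L ^+ 2) = sigma ^+ 2 * mu_ `^ (alpha - 1) / (16 * L ^+ 2).
    by field; rewrite !gt_eqF.
  rewrite ler_pM2r ?invr_gt0 ?mulr_gt0 ?exprn_gt0// ler_pM2l ?exprn_gt0//.
  have -> : alpha - 1 = - (1 - alpha) by ring.
  rewrite !powRN lef_pV2 ?posrE ?powR_gt0//; last first.
    by rewrite exprn_gt0// mulr_gt0.
  rewrite ge0_ler_powR ?nnegrE ?(ltW mu0) ?sqr_ge0//; first by lra.
  by rewrite muE'; apply: lerXn2r; rewrite ?nnegrE.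
apply: (@le_trans _ _ (\sum_(k <- G) F k)); last first.
  by apply: ler_sum_subseq => //; exact: uniq_kseq.
apply: (@le_trans _ _ (\sum_(k <- G)
    sigma ^+ 2 * ((wave L * N%:R) ^+ 2) `^ (alpha - 1) / (16 * L ^+ 2))); last first.
  by rewrite big_seq [leRHS]big_seq; apply: ler_sum => k; exact: FG.
rewrite big_const_seq count_predT /G size_allpairs size_iota.
rewrite iter_addr_0 -[leRHS]mulr_natl natrM.
rewrite exprMn powRM ?sqr_ge0//.
have -> : N%:R `^ (2 * alpha) = (N%:R ^+ 2) `^ (alpha - 1) * N%:R ^+ 2 :> R.
  rewrite -[N%:R ^+ 2]powR_mulrn ?(ltW N0)// -powRrM -powRD.
    by congr (_ `^ _); ring.
  by rewrite (gt_eqF N0) implybT.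
rewrite /var_const.
set A := (wave L ^+ 2) `^ _; set B := (N%:R ^+ 2) `^ _.
have A0 : 0 <= A by exact: powR_ge0.
have B0 : 0 <= B by exact: powR_ge0.
have -> : sigma ^+ 2 * A / (24 * L) ^+ 2 * (B * N%:R ^+ 2) =
   (sigma ^+ 2 * (A * B) / (16 * L ^+ 2)) * (N%:R ^+ 2 / 36).
  by field; rewrite gt_eqF.
rewrite mulrC; apply: ler_wpM2r.
  apply: divr_ge0; first by rewrite mulr_ge0 ?sqr_ge0// mulr_ge0.
  by rewrite mulr_ge0// sqr_ge0.
have NM : N%:R <= M%:R * 6 :> R by rewrite -natrM ler_nat.
by rewrite ler_pdivrMr//; nra.
Qed.

End VarianceLowerBound.

(** * Small balls under the noise gradient *)

Lemma markov_sqr d (Omega : measurableType d) (R : realType)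
    (P : probability Omega R) (D : Omega -> R) (dl : R) :
  measurable_fun setT D -> 0 < dl ->
  (P [set w | (dl < `|D w|)%R] <=
   (dl ^- 2)%:E * \int[P]_w (D w ^+ 2)%:E)%E.
Proof.
move=> mD d0; set A := [set w | _].
have mA : measurable A.
  rewrite (_ : A = (fun w => `|D w|) @^-1` `]dl, +oo[).
    by apply: measurable_preimage => //; exact: measurableT_comp.
  by apply/seteqP; split=> w; rewrite /A /= in_itv /= andbT.
have d20 : 0 <= dl ^- 2 by rewrite invr_ge0 sqr_ge0.
have mD2 : measurable_fun setT (fun w => (D w ^+ 2)%:E).
  by apply/measurable_EFinP; exact: measurable_funX.
rewrite -(setIT A) -integral_indic// -ge0_integralZl//; last first.
  by move=> w _; rewrite lee_fin sqr_ge0.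
apply: ge0_le_integral => //.
- exact/measurable_EFinP/measurable_indic.
- by apply: emeasurable_funM.
move=> w _; rewrite -EFinM lee_fin indicE.
have [wA|_] := boolP (w \in A); last by rewrite mulr_ge0// sqr_ge0.
move: wA; rewrite inE /A /= => /ltW wA.
rewrite mulrC ler_pdivlMr ?exprn_gt0// mul1r -(real_normK (num_real (D w))).
by apply: lerXn2r; rewrite ?nnegrE// ltW.
Qed.

Lemma cvge_sum0 (R : realType) (I : eqType) (s : seq I)
    (u : I -> nat -> \bar R) :
  (forall i, i \in s -> u i n @[n --> \oo] --> 0%E) ->
  (\sum_(i <- s) u i n)%E @[n --> \oo] --> 0%E.
Proof.
elim: s => [|i s IH] us.
  by under eq_fun do rewrite big_nil; exact: cvg_cst.
under eq_fun do rewrite big_cons.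
suff : (u i n + \sum_(j <- s) u j n)%E @[n --> \oo] --> (0 + 0)%E.
  by rewrite adde0.
apply: cvgeD => //; first by apply: us; rewrite mem_head.
by apply: IH => j js; apply: us; rewrite in_cons js orbT.
Qed.

Lemma measure_bigsetU_le d (Omega : measurableType d) (R : realType)
    (P : probability Omega R) (I : eqType) (s : seq I) (A : I -> set Omega) :
  (forall i, i \in s -> measurable (A i)) ->
  measurable (\bigcup_(i in [set` s]) A i) /\
  (P (\bigcup_(i in [set` s]) A i) <= \sum_(i <- s) P (A i))%E.
Proof.
elim: s => [|i s IH] mA.
  have -> : [set` ([::] : seq I)] = set0 by apply/seteqP; split.
  by rewrite bigcup_set0 measure0 big_nil.
have [|m1 le1] := IH; first by move=> j js; apply: mA; rewrite in_cons js orbT.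
have mi : measurable (A i) by apply: mA; rewrite mem_head.
have -> : \bigcup_(j in [set` i :: s]) A j =
    A i `|` \bigcup_(j in [set` s]) A j.
  apply/seteqP; split=> [w [j /=]|w [wi|[j js wj]]].
  - by rewrite in_cons => /orP[/eqP -> wi|js wj]; [left|right; exists j].
  - by exists i => //=; rewrite mem_head.
  - by exists j => //=; rewrite in_cons js orbT.
split; first exact: measurableU.
rewrite big_cons (le_trans (measureU2 P mi m1))//.
by rewrite leeD2l.
Qed.

(** Moving both coordinates of a point of the disc of radius [r] by at most
    [r / 2] keeps it in the disc of radius [2 r]. *)
Lemma sqr_perturb (R : realType) (a b a' b' r : R) : a ^+ 2 + b ^+ 2 <= r ^+ 2 ->
  `|a - a'| <= r / 2 -> `|b - b'| <= r / 2 -> a' ^+ 2 + b' ^+ 2 <= (2 * r) ^+ 2.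
Proof.
move=> ab ha hb.
have hsqr (y z : R) : `|y - z| <= r / 2 -> z ^+ 2 <= 2 * y ^+ 2 + r ^+ 2 / 2.
  move=> yz; have yz2 : (y - z) ^+ 2 <= (r / 2) ^+ 2.
    rewrite -real_normK ?num_real//; apply: lerXn2r; rewrite ?nnegrE//.
    exact: le_trans yz.
  have := sqr_ge0 (2 * y - z); nra.
have := hsqr _ _ ha; have := hsqr _ _ hb; nra.
Qed.

(** [Zn t n k] is the Riemann sum with [n + 1] steps of the stochastic integral
    [Z k t], and [amp1 x k], [amp2 x k] are its coefficients in the two
    components of the gradient at [x]. *)
Section NoiseSmallBall.
Context d (Omega : measurableType d) (R : realType) (P : probability Omega R).
Variables (L alpha sigma : R) (beta Z : int * int -> R -> Omega -> R).
Hypotheses (L0 : 0 < L) (alpha01 : 0 < alpha < 1) (sigma0 : 0 < sigma).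
Hypotheses (iid : iid_brownian P beta) (sconv : stoch_conv P L beta Z).

Let damp (t : R) (k : int * int) (s : R) := expR (- ((t - s) * mu L k ^+ 2)).

Let Zn (t : R) (n : nat) k (w : Omega) : R :=
  \sum_(i < n.+1) damp t k (t * i%:R / n.+1%:R) *
    (beta k (t * i.+1%:R / n.+1%:R) w - beta k (t * i%:R / n.+1%:R) w).

Definition amp1 (x : R * R) k : R :=
  mode_amp L alpha sigma (knorm k) * (freq L k.1 * ebasis L (flip1 k) x).
Definition amp2 (x : R * R) k : R :=
  mode_amp L alpha sigma (knorm k) * (freq L k.2 * ebasis L (flip2 k) x).

Lemma ZnE t n k w : Zn t n k w =
  \sum_(i <- iota 0 n.+1) damp t k (t / n.+1%:R * i%:R) *
     incr beta (t / n.+1%:R) (k, i) w.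
Proof.
rewrite /Zn -(big_mkord xpredT (fun i => damp t k (t * i%:R / n.+1%:R) *
  (beta k (t * i.+1%:R / n.+1%:R) w - beta k (t * i%:R / n.+1%:R) w))).
rewrite /index_iota subn0; apply: eq_bigr => i _.
by rewrite /incr /= !(mulrAC t _ (n.+1%:R)^-1).
Qed.

(** The double sum over modes and time steps is one Gaussian sum over increments
    of variance [h]; summing over the time steps first turns its covariance into
    the sums over modes computed in [sum_diag1], [sum_diag2], [sum_cross0]. *)
Lemma riemann_small_ball (t : R) (N n : nat) (x x0 : R * R) (r : R) :
  (3 <= N)%N -> 0 < t -> 1 <= t * (wave L * (N %/ 3)%:R) ^+ 4 ->
  4 * t * (wave L * N%:R) ^+ 4 <= n.+1%:R -> 0 < r ->
  (P [set w | ((x0.1 + \sum_(k <- kseq R N) amp1 x k * Zn t n k w) ^+ 2 +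
               (x0.2 + \sum_(k <- kseq R N) amp2 x k * Zn t n k w) ^+ 2 <=
               r ^+ 2)%R]
   <= (expR 1 * r ^+ 2 / (var_const L alpha sigma * N%:R `^ (2 * alpha)))%:E)%E.
Proof.
move=> N3 t0 tM tN r0; set h := t / n.+1%:R.
have n0 : 0 < n.+1%:R :> R by rewrite ltr0n.
have h0 : 0 < h by rewrite divr_gt0.
pose J := [seq (k, i) | k <- kseq R N, i <- iota 0 n.+1].
have uJ : uniq J.
  apply: allpairs_uniq; [exact: uniq_kseq|exact: iota_uniq|].
  by move=> [a b] [a' b'] _ _ [-> ->].
have nzJ j : j \in J -> nonzero j.1.
  by move=> /allpairsP[[k i] /= [/kseq_nonzero nk _ ->]].
pose g j := damp t j.1 (h * (j.2)%:R).
pose v := radial_mass L (riemann_weight L alpha sigma t n) N.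
have vge : var_const L alpha sigma * N%:R `^ (2 * alpha) <= v.
  exact: radial_mass_ge.
have c0 : 0 < var_const L alpha sigma * N%:R `^ (2 * alpha).
  rewrite mulr_gt0 ?var_const_gt0// powR_gt0// ltr0n.
  by rewrite (leq_trans _ N3).
have v0 : 0 < v by rewrite (lt_le_trans c0).
have sh2 : Num.sqrt h ^+ 2 = h by rewrite sqr_sqrtr// ltW.
have gsum k : \sum_(i <- iota 0 n.+1) h * g (k, i) ^+ 2 =
    riemann_variance t (mu L k ^+ 2) n.+1.
  by [].
have quad (e1 e2 : int * int -> R) :
    \sum_(j <- J) Num.sqrt h ^+ 2 *
      (mode_amp L alpha sigma (knorm j.1) * e1 j.1 * g j) *
      (mode_amp L alpha sigma (knorm j.1) * e2 j.1 * g j) =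
    \sum_(k <- kseq R N) riemann_weight L alpha sigma t n (knorm k) * e1 k * e2 k.
  rewrite big_allpairs; apply: eq_bigr => k _.
  rewrite /riemann_weight -mu_wave -gsum /= mulr_sumr 2!mulr_suml.
  by apply: eq_bigr => i _; rewrite sh2; ring.
have XE (amp : (R * R) -> int * int -> R) w :
    \sum_(k <- kseq R N) amp x k * Zn t n k w =
    \sum_(j <- J) (amp x j.1 * g j) * incr beta h j w.
  rewrite big_allpairs; apply: eq_bigr => k _.
  by rewrite ZnE mulr_sumr; apply: eq_bigr => i _; rewrite mulrA.
pose b1 j := amp1 x j.1 * g j; pose b2 j := amp2 x j.1 * g j.
have A1 j : j \in J -> measurable_fun setT (incr beta h j).
  by move=> /nzJ; exact: (measurable_incr iid h0).
have A2 (j : (int * int) * nat) : j \in J -> 0 < Num.sqrt h.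
  by rewrite sqrtr_gt0.
have A3 j : j \in J -> forall B : set R, measurable B ->
    P (incr beta h j @^-1` B) = normal_prob 0 (Num.sqrt h) B.
  by move=> /nzJ nj B mB; exact: (law_incr iid h0).
have A4 : product_law P J (incr beta h).
  apply: (product_law_incr iid h0); first exact: uniq_kseq.
  by move=> k; exact: kseq_nonzero.
pose e1 k := freq L k.1 * ebasis L (flip1 k) x.
pose e2 k := freq L k.2 * ebasis L (flip2 k) x.
have A5 : \sum_(j <- J) Num.sqrt h ^+ 2 * b1 j ^+ 2 = v.
  rewrite /v -(sum_diag1 L0 _ N x).
  transitivity (\sum_(j <- J) Num.sqrt h ^+ 2 * b1 j * b1 j).
    by apply: eq_bigr => j _; ring.
  rewrite (quad e1 e1); apply: eq_bigr => k _; rewrite /e1; ring.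
have A6 : \sum_(j <- J) Num.sqrt h ^+ 2 * b1 j * b2 j = 0.
  by rewrite (quad e1 e2) sum_cross0.
have A7 : \sum_(j <- J) Num.sqrt h ^+ 2 * b2 j ^+ 2 = v.
  rewrite /v -(sum_diag2 L0 _ N x).
  transitivity (\sum_(j <- J) Num.sqrt h ^+ 2 * b2 j * b2 j).
    by apply: eq_bigr => j _; ring.
  rewrite (quad e2 e2); apply: eq_bigr => k _; rewrite /e2; ring.
have H := gaussian_small_ball x0 uJ A1 A2 A3 A4 A5 A6 A7 v0 r0.
under eq_set do rewrite (XE amp1) (XE amp2).
apply: (le_trans H).
rewrite lee_fin ler_pM2l ?mulr_gt0 ?expR_gt0 ?exprn_gt0//.
by rewrite lef_pV2.
Qed.

(** If every [Z k t] is within [dl] of its Riemann sum, doubling the radius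
    absorbs the error; the probability of the exceptional event tends to [0] with
    the mesh, by [markov_sqr] and the [L^2] convergence defining the integral. *)
Lemma noise_small_ball (t : R) (N : nat) (x x0 : R * R) (r : R) :
  (3 <= N)%N -> 0 < t -> 1 <= t * (wave L * (N %/ 3)%:R) ^+ 4 -> 0 < r ->
  (P [set w | ((x0.1 + \sum_(k <- kseq R N) amp1 x k * Z k t w) ^+ 2 +
               (x0.2 + \sum_(k <- kseq R N) amp2 x k * Z k t w) ^+ 2 <=
               r ^+ 2)%R]
   <= (4 * (expR 1 * r ^+ 2 /
       (var_const L alpha sigma * N%:R `^ (2 * alpha))))%:E)%E.
Proof.
move=> N3 t0 tM r0.
have mZ k : k \in kseq R N -> measurable_fun setT (Z k t).
  by move=> /kseq_nonzero nz; have [] := sconv nz (ltW t0).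
have mZn n k : k \in kseq R N -> measurable_fun setT (Zn t n k).
  move=> /kseq_nonzero nz; rewrite (funext (ZnE t n k)).
  apply: measurable_fun_big => i _; apply: measurable_funM => //.
  by apply: (measurable_incr iid) => //; rewrite divr_gt0// ltr0n.
have mD n k : k \in kseq R N -> measurable_fun setT (fun w => Z k t w - Zn t n k w).
  by move=> kN; apply: measurable_funB; [exact: mZ|exact: mZn].
have cZ k : k \in kseq R N ->
    (\int[P]_w ((Z k t w - Zn t n k w) ^+ 2)%:E)%E @[n --> \oo] --> 0%E.
  by move=> /kseq_nonzero nz; have [] := sconv nz (ltW t0).
set A := [set w | _].
have mX (Y : int * int -> Omega -> R) :
    (forall k, k \in kseq R N -> measurable_fun setT (Y k)) -> forall rr,
    measurable [set w | (x0.1 + \sum_(k <- kseq R N) amp1 x k * Y k w) ^+ 2 +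
               (x0.2 + \sum_(k <- kseq R N) amp2 x k * Y k w) ^+ 2 <= rr].
  move=> mY rr.
  have mf : measurable_fun setT (fun w =>
      (x0.1 + \sum_(k <- kseq R N) amp1 x k * Y k w) ^+ 2 +
      (x0.2 + \sum_(k <- kseq R N) amp2 x k * Y k w) ^+ 2).
    apply: measurable_funD; apply: measurable_funX; apply: measurable_funD => //;
    apply: measurable_fun_big => k kN; apply: measurable_funM => //; exact: mY.
  have := measurable_preimage mf (measurable_itv `]-oo, rr]).
  by congr measurable; apply/seteqP; split=> w /=; rewrite in_itv.
pose S := \sum_(k <- kseq R N) (`|amp1 x k| + `|amp2 x k|).
have S0 : 0 <= S by apply: sumr_ge0 => k _; rewrite addr_ge0.
(* chosen so that errors [dl] in the [Z k t] move the sum by at most [r / 2] *)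
pose dl := r / (2 * (S + 1)).
have S1 : 0 < S + 1 by rewrite ltr_pwDr.
have dl0 : 0 < dl by rewrite divr_gt0// mulr_gt0.
pose B n k := [set w | dl < `|Z k t w - Zn t n k w|].
pose An n := [set w |
  (x0.1 + \sum_(k <- kseq R N) amp1 x k * Zn t n k w) ^+ 2 +
  (x0.2 + \sum_(k <- kseq R N) amp2 x k * Zn t n k w) ^+ 2 <= (2 * r) ^+ 2].
have mB n k : k \in kseq R N -> measurable (B n k).
  move=> kN; have mDn := measurableT_comp (@normr_measurable R setT) (mD n k kN).
  have := measurable_preimage mDn (measurable_itv `]dl, +oo[).
  by congr measurable; apply/seteqP; split=> w /=; rewrite in_itv /= andbT.
have close (amp : int * int -> R) n w : (forall k, `|amp k| <= `|amp1 x k| + `|amp2 x k|) ->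
    (forall k, k \in kseq R N -> `|Z k t w - Zn t n k w| <= dl) ->
    `|\sum_(k <- kseq R N) amp k * Z k t w - \sum_(k <- kseq R N) amp k * Zn t n k w|
    <= r / 2.
  move=> ampS cl; rewrite -sumrB (le_trans (ler_norm_sum _ _ _))//.
  apply: (@le_trans _ _ (S * dl)).
    rewrite /S mulr_suml big_seq [leRHS]big_seq; apply: ler_sum => k kN.
    by rewrite -mulrBr normrM; apply: ler_pM => //; exact: cl.
  have -> : r / 2 = (S + 1) * dl by rewrite /dl; field; rewrite gt_eqF.
  by rewrite ler_wpM2r ?(ltW dl0)// lerDl.
have sub n : A `<=` An n `|` \bigcup_(k in [set` kseq R N]) B n k.
  move=> w Aw; have [|nB] := pselect ((\bigcup_(k in [set` kseq R N]) B n k) w).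
    by right.
  left; have cl k : k \in kseq R N -> `|Z k t w - Zn t n k w| <= dl.
    by move=> kN; rewrite leNgt; apply/negP => Bw; apply: nB; exists k.
  have c1 : `|\sum_(k <- kseq R N) amp1 x k * Z k t w -
              \sum_(k <- kseq R N) amp1 x k * Zn t n k w| <= r / 2.
    by apply: close => // k; rewrite lerDl.
  have c2 : `|\sum_(k <- kseq R N) amp2 x k * Z k t w -
              \sum_(k <- kseq R N) amp2 x k * Zn t n k w| <= r / 2.
    by apply: close => // k; rewrite lerDr.
  apply: (sqr_perturb Aw).
    by rewrite opprD addrACA subrr add0r.
  by rewrite opprD addrACA subrr add0r.
pose C := 4 * (expR 1 * r ^+ 2 / (var_const L alpha sigma * N%:R `^ (2 * alpha))).
pose u n : \bar R := (\sum_(k <- kseq R N) ((dl ^- 2)%:E *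
   \int[P]_w ((Z k t w - Zn t n k w) ^+ 2)%:E))%E.
have bound n : 4 * t * (wave L * N%:R) ^+ 4 <= n.+1%:R -> (P A <= C%:E + u n)%E.
  move=> tN; have [mU PU] := measure_bigsetU_le P (fun k => mB n k).
  have mA : measurable A := mX _ mZ _.
  have mAn : measurable (An n) := mX _ (mZn n) _.
  apply: (le_trans (le_measure P _ _ (sub n))); rewrite ?inE//.
    exact: measurableU.
  apply: (le_trans (measureU2 P mAn mU)); apply: leeD.
    apply: (le_trans (riemann_small_ball x x0 N3 t0 tM tN _)).
      by rewrite mulr_gt0.
    by rewrite lee_fin le_eqVlt; apply/orP; left; apply/eqP; rewrite /C; ring.
  apply: (le_trans PU); rewrite /u big_seq [leRHS]big_seq.
  apply: lee_sum => k kN; apply: markov_sqr => //; exact: mD.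
have u0 : u n @[n --> \oo] --> 0%E.
  apply: cvge_sum0 => k kN.
  have -> : 0%E = ((dl ^- 2)%:E * 0)%E by rewrite mule0.
  by apply: cvgeZl; [|exact: cZ].
have Cu : (C%:E + u n)%E @[n --> \oo] --> C%:E.
  suff : (C%:E + u n)%E @[n --> \oo] --> (C%:E + 0)%E by rewrite adde0.
  by apply: cvgeD => //; exact: cvg_cst.
apply: (lee_cvg_to (cvg_cst (P A)) Cu); near=> n; apply: bound.
apply: (@le_trans _ _ n%:R); last by rewrite ler_nat.
by near: n; exact: nbhs_infty_ger.
Unshelve. all: by end_near. Qed.

End NoiseSmallBall.

(** * Decomposition of the gradient *)

(** Finiteness of the [H^s] norm bounds the coefficients, and
    [e^{-t mu_k^2} <= 1 / (t mu_k^2)] leaves the lattice sum of [|k|^{-3}]. *)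
Lemma heat_summable (R : realType) (L s t : R) (c : int * int -> R) :
  0 < L -> 0 <= s -> 0 < t -> Hs L s c ->
  exists M, forall n, \sum_(k <- kseq R n)
     knorm k * `|expR (- (t * mu L k ^+ 2)) * c k| <= M.
Proof.
move=> L0 s0 t0 [_ Hfin].
have w0 : 0 < wave L := wave_gt0 L0.
have Hge0 : (0 <= Hnorm2 L s c)%E.
  by apply: esum_ge0 => k _; rewrite lee_fin mulr_ge0 ?powR_ge0 ?sqr_ge0.
pose H := fine (Hnorm2 L s c).
have HE : Hnorm2 L s c = H%:E by rewrite fineK// ge0_fin_numE.
have term k : nonzero k -> mu L k `^ s * c k ^+ 2 <= H.
  move=> nz; rewrite -lee_fin -HE; apply: esum_ge; exists [set k].
    by split; [exact: finite_set1|move=> _ ->].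
  by rewrite fsbig_set1.
pose B := H / (wave L ^+ 2) `^ s.
have cB k : nonzero k -> `|c k| <= 1 + B.
  move=> nz.
  have w2 : 0 < (wave L ^+ 2) `^ s by rewrite powR_gt0// exprn_gt0.
  have le1 : c k ^+ 2 <= B.
    rewrite /B ler_pdivlMr//; apply: le_trans (term k nz).
    have wm : wave L ^+ 2 <= mu L k.
      rewrite mu_wave [leRHS]exprMn; apply: ler_peMr; first exact: sqr_ge0.
      by rewrite exprn_ege1// knorm_ge1.
    rewrite mulrC; apply: ler_wpM2r; first exact: sqr_ge0.
    by apply: ge0_ler_powR => //; rewrite nnegrE ?sqr_ge0// mu_wave sqr_ge0.
  have := sqr_ge0 (`|c k| - 1); rewrite -(real_normK (num_real (c k))) in le1.
  nra.
exists ((1 + B) / (t * wave L ^+ 4) * 512) => n.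
apply: (@le_trans _ _ (\sum_(k <- kseq R n)
    (1 + B) / (t * wave L ^+ 4) * (knorm k ^+ 3)^-1)); last first.
  rewrite -mulr_sumr; apply: ler_wpM2l; last exact: sum_knorm_cube.
  apply: divr_ge0; last by rewrite mulr_ge0 ?exprn_ge0// ltW.
  exact: le_trans (cB (1%Z, 0%Z) _).
rewrite big_seq [leRHS]big_seq; apply: ler_sum => k kn.
have nz := kseq_nonzero kn.
have k0 : 0 < @knorm R k by apply/knorm_gt0.
have muE : mu L k ^+ 2 = (wave L * knorm k) ^+ 4 by rewrite mu_wave -exprM.
have x0 : 0 < t * mu L k ^+ 2 by rewrite mulr_gt0// muE exprn_gt0// mulr_gt0.
have eE : expR (- (t * mu L k ^+ 2)) <= (t * mu L k ^+ 2)^-1.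
  rewrite expRN lef_pV2 ?posrE ?expR_gt0//.
  by apply: le_trans (expR_ge1Dx _); rewrite lerDr.
rewrite normrM (ger0_norm (expR_ge0 _)).
apply: (@le_trans _ _ (knorm k * ((t * mu L k ^+ 2)^-1 * (1 + B)))).
  apply: ler_wpM2l; first exact: ltW.
  by apply: ler_pM; rewrite ?expR_ge0//; exact: cB.
rewrite muE le_eqVlt; apply/orP; left; apply/eqP.
by field; rewrite !gt_eqF.
Qed.

(** The integral of a nonnegative function is a supremum over the simple functions
    below it, so it is monotone for arbitrary [f]. It bounds moments of
    the gradient, which is identified only outside a null set. *)
Lemma le_nonmeasurable_integral d (T : measurableType d) (R : realType)
    (mu : {measure set T -> \bar R}) (f g : T -> \bar R) :
  (forall x, (0 <= f x)%E) -> (forall x, (f x <= g x)%E) ->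
  (\int[mu]_x f x <= \int[mu]_x g x)%E.
Proof.
move=> f0 fg; rewrite !ge0_integralTE//; last first.
  by move=> x; exact: le_trans (fg x).
apply: ereal_sup_le => _ [h hf <-].
exists h => // x; exact: le_trans (hf x) (fg x).
Qed.

Section Decomposition.
Context {R : realType}.
Variables (L T alpha sigma : R).
Hypotheses (L0 : 0 < L) (T0 : 0 < T).

(** [L * L / 2] is the bound of [frakF_bessel]. *)
Definition drift_bound : R := grad_bound L * conv_bound L T (L * L / 2).

(** The three families of coefficients are absolutely summable against [|k|], so
    the series of the gradient may be summed family by family; the noise has
    finitely many modes. *)
Lemma gradient_decomposition (t M : R) (N : nat)
    (c c0 z : int * int -> R) (U : R -> int * int -> R) :
  0 < t <= T ->
  (forall n, \sum_(k <- kseq R n) knorm k * `|c0 k| <= M) ->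
  (forall k, nonzero k -> (@lebesgue_measure R).-integrable `[0, t]
     (fun s => (expR (- ((t - s) * mu L k ^+ 2)) * frakF L (U s) k)%:E) /\
     c k = c0 k +
       \int[lebesgue_measure]_(s in `[0, t])
          (expR (- ((t - s) * mu L k ^+ 2)) * frakF L (U s) k) +
       (if 0 < @knorm R k <= N%:R
        then mode_amp L alpha sigma (knorm k) * z k else 0)) ->
  has_C1_repr L c /\ forall x, exists v : R * R,
    [/\ `|v.1| <= drift_bound, `|v.2| <= drift_bound &
     grad_at L c x =
      (series_lim (fun k x => c0 k * (freq L k.1 * ebasis L (flip1 k) x)) x +
         v.1 + \sum_(k <- kseq R N) amp1 L alpha sigma x k * z k,
       series_lim (fun k x => c0 k * (freq L k.2 * ebasis L (flip2 k) x)) x +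
         v.2 + \sum_(k <- kseq R N) amp2 L alpha sigma x k * z k)].
Proof.
move=> tT c0M cE.
pose cv k := \int[lebesgue_measure]_(s in `[0, t])
   (expR (- ((t - s) * mu L k ^+ 2)) * frakF L (U s) k).
pose cz k := if 0 < @knorm R k <= N%:R
   then mode_amp L alpha sigma (knorm k) * z k else 0.
pose B := conv_bound L T (L * L / 2).
have cvB n : \sum_(k <- kseq R n) knorm k * `|cv k| <= B.
  apply: convolution_bound => //.
    by move=> k /kseq_nonzero nz; have [] := cE _ nz.
  move=> s; apply: frakF_bessel => //; first exact: uniq_kseq.
  by move=> k; exact: kseq_nonzero.
have czE k : k \in kseq R N -> cz k = mode_amp L alpha sigma (knorm k) * z k.
  by rewrite mem_kseq /cz => ->.
have cz0 k : k \notin kseq R N -> cz k = 0.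
  by rewrite mem_kseq /cz => /negPf ->.
pose Mz := \sum_(k <- kseq R N) knorm k * `|cz k|.
have czB n : \sum_(k <- kseq R n) knorm k * `|cz k| <= Mz.
  rewrite (bigID (mem (kseq R N))) /= [X in _ + X]big1 ?addr0; last first.
    by move=> k kN; rewrite cz0// normr0 mulr0.
  rewrite -big_filter; apply: ler_sum_subseq.
  - exact: uniq_kseq.
  - exact/filter_uniq/uniq_kseq.
  - by move=> k; rewrite mem_filter => /andP[].
  - by move=> k _; rewrite mulr_ge0 ?knorm_ge0.
have cB n : \sum_(k <- kseq R n) knorm k * `|c k| <= M + B + Mz.
  apply: le_trans (lerD (lerD (c0M n) (cvB n)) (czB n)).
  rewrite -!big_split /= big_seq [leRHS]big_seq; apply: ler_sum => k kn.
  have [_ ->] := cE _ (kseq_nonzero kn).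
  rewrite -!mulrDr ler_wpM2l ?knorm_ge0// (le_trans (ler_normD _ _))//.
  by rewrite lerD// ler_normD.
split; first by have [] := grad_atE (0, 0) L0 cB.
move=> x; have [_ gE] := grad_atE x L0 cB.
have lim_split (e : int * int -> R) :
    (forall k, `|e k| <= grad_bound L * knorm k) ->
    let S (a : int * int -> R) := lim (\sum_(k <- kseq R n) a k * e k @[n --> \oo]) in
    `|S cv| <= drift_bound /\
    S c = S c0 + S cv +
      \sum_(k <- kseq R N) mode_amp L alpha sigma (knorm k) * e k * z k.
  move=> eB S; have gb0 := grad_bound_ge0 L0.
  have aB (a : int * int -> R) k : nonzero k ->
      `|a k * e k| <= grad_bound L * (knorm k * `|a k|).
    move=> _; rewrite normrM mulrC mulrA ler_wpM2r//.
  have [l1 _ _] := sum_kseq_cvg c0M gb0 (aB c0).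
  have [l2 _ b2] := sum_kseq_cvg cvB gb0 (aB cv).
  split; first exact: b2.
  apply: cvg_lim => //.
  have l3 : \sum_(k <- kseq R n) cz k * e k @[n --> \oo] -->
      \sum_(k <- kseq R N) mode_amp L alpha sigma (knorm k) * e k * z k.
    apply: cvg_near_cst; near=> n.
    have Nn : (N <= n)%N by near: n; exists N.
    rewrite (bigID (fun k : int * int => @knorm R k <= N%:R)) /=.
    rewrite -(sum_kseq_sub _ Nn) [X in _ + X]big1 ?addr0; last first.
      by move=> k kN; rewrite cz0 ?mul0r// mem_kseq negb_and kN orbT.
    rewrite big_seq [RHS]big_seq; apply: eq_bigr => k kN.
    by rewrite czE//; ring.
  have -> : (fun n => \sum_(k <- kseq R n) c k * e k) = (fun n =>
      \sum_(k <- kseq R n) c0 k * e k + \sum_(k <- kseq R n) cv k * e k +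
      \sum_(k <- kseq R n) cz k * e k).
    apply/funext => n; rewrite -!big_split /= big_seq [RHS]big_seq.
    apply: eq_bigr => k kn; have [_ ->] := cE _ (kseq_nonzero kn).
    by rewrite !mulrDl.
  by apply: cvgD => //; apply: cvgD.
have e1B k : `|freq L k.1 * ebasis L (flip1 k) x| <= grad_bound L * knorm k.
  have := @term1_le R L L0 (fun=> 1) k x; rewrite mul1r normr1 mulr1; exact.
have e2B k : `|freq L k.2 * ebasis L (flip2 k) x| <= grad_bound L * knorm k.
  have := @term2_le R L L0 (fun=> 1) k x; rewrite mul1r normr1 mulr1; exact.
have [v1 E1] := lim_split _ e1B; have [v2 E2] := lim_split _ e2B.
eexists (_, _); split; [exact: v1|exact: v2|].
by rewrite gE /series_lim E1 E2.
Unshelve. all: by end_near. Qed.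

End Decomposition.

(** * The moment bound *)

Lemma fnl_powR_le1 (R : realType) (p : R) (y : R * R) : 0 <= p ->
  enorm (fnl y) `^ p <= 1.
Proof.
move=> p0; rewrite enorm_fnl.
have ey0 : 0 <= enorm y by exact: sqrtr_ge0.
have n0 : 0 < 1 + enorm y ^+ 2 by rewrite ltr_pwDl// sqr_ge0.
have q0 : 0 <= enorm y / (1 + enorm y ^+ 2) by rewrite divr_ge0// ltW.
have q1 : enorm y / (1 + enorm y ^+ 2) <= 1.
  rewrite ler_pdivrMr// mul1r; have := sqr_ge0 (enorm y - 1); nra.
have H : (enorm y / (1 + enorm y ^+ 2)) `^ p <= 1 `^ p.
  by rewrite ge0_ler_powR// nnegrE.
by rewrite powR1 in H.
Qed.

(** Outside the disc, [|z|^2 <= 2 |z + v|^2 + 2 |v|^2] gives [|z + v| >= r], and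
    [|f y| <= 1 / |y|]. *)
Lemma fnl_powR_le (R : realType) (p r D z1 z2 v1 v2 : R) :
  0 <= p -> 0 < r -> 0 <= D -> `|v1| <= D -> `|v2| <= D ->
  enorm (fnl (z1 + v1, z2 + v2)) `^ p <=
  (z1 ^+ 2 + z2 ^+ 2 <= (2 * r + 2 * D) ^+ 2)%R%:R + r `^ (- p).
Proof.
move=> p0 r0 D0 v1D v2D; set y := (z1 + v1, z2 + v2).
have [_|far] := leP (z1 ^+ 2 + z2 ^+ 2) ((2 * r + 2 * D) ^+ 2).
  apply: (le_trans (fnl_powR_le1 _ p0)); rewrite lerDl; exact: powR_ge0.
rewrite add0r enorm_fnl.
have ey0 : 0 <= enorm y by exact: sqrtr_ge0.
have n0 : 0 < 1 + enorm y ^+ 2 by rewrite ltr_pwDl// sqr_ge0.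
have ey2 : enorm y ^+ 2 = (z1 + v1) ^+ 2 + (z2 + v2) ^+ 2.
  by rewrite sqr_sqrtr// addr_ge0// sqr_ge0.
have v1s : v1 ^+ 2 <= D ^+ 2.
  by rewrite -real_normK ?num_real//; apply: lerXn2r; rewrite ?nnegrE.
have v2s : v2 ^+ 2 <= D ^+ 2.
  by rewrite -real_normK ?num_real//; apply: lerXn2r; rewrite ?nnegrE.
have ry2 : r ^+ 2 <= enorm y ^+ 2.
  rewrite ey2; have h1 := sqr_ge0 (z1 + 2 * v1); have h2 := sqr_ge0 (z2 + 2 * v2).
  have h3 : 0 <= r * D by rewrite mulr_ge0// ltW.
  nra.
have ry : r <= enorm y by rewrite -ler_sqr ?nnegrE ?(ltW r0).
have q0 : 0 <= enorm y / (1 + enorm y ^+ 2) by rewrite divr_ge0// ltW.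
have qr : enorm y / (1 + enorm y ^+ 2) <= r^-1.
  by rewrite ler_pdivrMr// ler_pdivlMl//; nra.
rewrite -[- p]mulN1r powRrM powR_inv1 ?(ltW r0)//.
by apply: ge0_ler_powR => //; rewrite nnegrE ?invr_ge0 ltW.
Qed.

Theorem lemma4p3 (R : realType) (alpha p sigma L T m : R) :
  0 < alpha < 1 -> 1 <= p -> 0 < sigma -> 0 < L -> 0 < T ->
  exists2 C : R, 0 < C &
  forall (d : measure_display) (Omega : measurableType d)
    (P : probability Omega R)
    (beta Z : int * int -> R -> Omega -> R)
    (eta : R) (u0 : R * R -> R)
    (u : nat -> R -> Omega -> int * int -> R),
  iid_brownian P beta ->
  stoch_conv P L beta Z ->
  0 < eta < 4 ->
  Hs L (1 + eta) (fourier L u0) ->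
  W1infty_with_norm L u0 m ->
  (forall N, mild_solution P L T alpha sigma (fourier L u0) Z N (u N)) ->
  exists N0 : nat, forall N : nat, (N0 <= N)%N ->
    let tN := N%:R `^ (- (2 * alpha * p / (p + 2))) in
    (forall t : R, tN <= t <= T -> {ae P, forall w, has_C1_repr L (u N t w)}) /\
    (ereal_sup [set ereal_sup
        [set 'E_P[fun w => (enorm (fnl (grad_at L (u N t w) x)) `^ p)%R]
          | x in torus L]
        | t in `[tN, T]%classic]
      <= (C * N%:R `^ (- (2 * alpha * p / (p + 2))))%:E)%E.
Proof.
move=> alpha01 p1 sigma0 L0 T0.
have [a0 a1] := andP alpha01.
have w0 := wave_gt0 L0.
have vc0 : 0 < var_const L alpha sigma by exact: var_const_gt0.
pose D := drift_bound L T.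
have D0 : 0 <= D.
  have := frakF_bessel L0 (fun=> 0) (s := [::]) isT.
  rewrite big_nil => E0.
  rewrite /D /drift_bound mulr_ge0 ?grad_bound_ge0// /conv_bound.
  apply: mulr_ge0; first by rewrite mulr_ge0// powR_ge0.
  apply: mulr_ge0; first by rewrite divr_ge0 ?expR_ge0// mulr_ge0// ltW.
  apply: addr_ge0; last exact: E0.
  by apply: divr_ge0; [exact: ler0n|apply/exprn_ge0/ltW].
pose C := 4 * (expR 1 * (2 + 2 * D) ^+ 2 / var_const L alpha sigma) + 1.
have C0 : 0 < C.
  rewrite /C ltr_pwDr// mulr_ge0// divr_ge0 ?(ltW vc0)// mulr_ge0 ?expR_ge0//.
  exact: sqr_ge0.
exists C => // d Omega P beta Z eta u0 u iid sconv eta04 Hu0 _ mild.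
have [eta0 _] := andP eta04.
(* beyond this rank [t mu_k ^+ 2 >= 1] for all [t >= tN] and [|k| >= N / 3], as
   [tN >= N ^ -2] *)
exists (maxn 3 (Num.bound ((6 / wave L) ^+ 2))) => N.
rewrite geq_max => /andP[N3 Nb] tN.
have Npos : 0 < N%:R :> R by rewrite ltr0n (leq_trans _ N3).
have tN0 : 0 < tN by exact: powR_gt0.
pose th := 2 * alpha * p / (p + 2).
have N1 : 1 <= N%:R :> R by rewrite ler1n (leq_trans _ N3).
have p20 : 0 < p + 2 by lra.
have p0 : 0 <= p by lra.
have tNM : 1 <= tN * (wave L * (N %/ 3)%:R) ^+ 4.
  have th2 : th <= 2 by rewrite /th ler_pdivrMr//; nra.
  have tN2 : (N%:R ^+ 2)^-1 <= tN.
    by rewrite -powR_invn ?(ltW Npos)// /tN ler_powR// lerN2.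
  have M6 : N%:R <= 6 * (N %/ 3)%:R :> R.
    by rewrite -natrM ler_nat leq_six_third.
  have b0 : 0 <= (6 / wave L) ^+ 2 by exact: sqr_ge0.
  have bN : (6 / wave L) ^+ 2 <= N%:R.
    apply: (le_trans (ltW (archi_boundP b0))).
    by rewrite ler_nat.
  have wN : wave L * N%:R / 6 <= wave L * (N %/ 3)%:R.
    by rewrite -mulrA ler_wpM2l ?(ltW w0)// ler_pdivrMr// mulrC.
  have wN0 : 0 <= wave L * N%:R / 6 by rewrite divr_ge0// mulr_ge0// ltW.
  apply: (@le_trans _ _ ((N%:R ^+ 2)^-1 * (wave L * N%:R / 6) ^+ 4)).
    have -> : (N%:R ^+ 2)^-1 * (wave L * N%:R / 6) ^+ 4 =
        (N%:R / (6 / wave L) ^+ 2) ^+ 2 by field; rewrite !gt_eqF.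
    rewrite exprn_ege1// ler_pdivlMr ?mul1r//.
    by rewrite exprn_gt0// divr_gt0.
  apply: ler_pM; [by rewrite invr_ge0 sqr_ge0|exact: exprn_ge0|exact: tN2|].
  by apply: lerXn2r; rewrite ?nnegrE//; exact: le_trans wN.
have decomp t : tN <= t <= T -> exists h : R * R -> R * R,
    {ae P, forall w, has_C1_repr L (u N t w) /\ forall x, exists v : R * R,
    [/\ `|v.1| <= D, `|v.2| <= D &
     grad_at L (u N t w) x =
      ((h x).1 + v.1 + \sum_(k <- kseq R N) amp1 L alpha sigma x k * Z k t w,
       (h x).2 + v.2 + \sum_(k <- kseq R N) amp2 L alpha sigma x k * Z k t w)]}.
  move=> /andP[tt tT]; have t0 : 0 < t by exact: lt_le_trans tt.
  have eta1 : 0 <= 1 + eta by lra.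
  have [M cM] := heat_summable L0 eta1 t0 Hu0.
  pose c0 k := expR (- (t * mu L k ^+ 2)) * fourier L u0 k.
  exists (fun x => (series_lim (fun k x => c0 k * (freq L k.1 * ebasis L (flip1 k) x)) x,
           series_lim (fun k x => c0 k * (freq L k.2 * ebasis L (flip2 k) x)) x)).
  have [_ _ _ /(_ t)] := mild N.
  rewrite (ltW t0) tT => /(_ isT); apply: filterS => w Hw.
  have t0T : 0 < t <= T by rewrite t0.
  apply: (gradient_decomposition (U := fun s => u N s w) L0 T0 t0T cM).
  move=> k nz; have [int_k ->] := Hw k nz; split=> //.
  congr (_ + _ + _); rewrite /PNZ; case: ifP => _; last by rewrite mulr0.
  by rewrite mulrA /mode_amp -mu_wave.
split=> [t tT|].
  by have [h] := decomp t tT; apply: filterS => w [].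
apply: ub_ereal_sup => _ [t tT <-]; apply: ub_ereal_sup => _ [x _ <-].
rewrite /= in_itv/= in tT.
have [h [A [mA PA0 subA]]] := decomp t tT.
have t0 : 0 < t by have /andP[tt _] := tT; exact: lt_le_trans tt.
(* this radius balances [r ^ 2 / N ^ (2 alpha)] against [r ^ - p] *)
pose r := N%:R `^ (2 * alpha / (p + 2)).
have r1 : 1 <= r.
  have e0 : 0 <= 2 * alpha / (p + 2) by rewrite divr_ge0 ?(ltW p20)// mulr_ge0// ltW.
  have H : N%:R `^ 0 <= r by rewrite /r ler_powR.
  by rewrite powRr0 in H.
have r0 : 0 < r := lt_le_trans ltr01 r1.
pose rho := 2 * r + 2 * D.
have rho0 : 0 < rho.
  by rewrite /rho ltr_pwDl ?mulr_gt0// mulr_ge0.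
set Y := fun w => _.
pose X w := ((h x).1 + \sum_(k <- kseq R N) amp1 L alpha sigma x k * Z k t w) ^+ 2 +
  ((h x).2 + \sum_(k <- kseq R N) amp2 L alpha sigma x k * Z k t w) ^+ 2.
pose E := [set w | X w <= rho ^+ 2].
have mX : measurable_fun setT X.
  have mZ k : k \in kseq R N -> measurable_fun setT (Z k t).
    by move=> /kseq_nonzero nz; have [] := sconv k nz t (ltW t0).
  apply: measurable_funD; apply: measurable_funX; apply: measurable_funD => //;
  apply: measurable_fun_big => k kN; apply: measurable_funM => //; exact: mZ.
have mE : measurable E.
  have := measurable_preimage mX (measurable_itv `]-oo, rho ^+ 2]).
  by congr measurable; apply/seteqP; split=> w /=; rewrite in_itv.
have PE : (P E <= (4 * (expR 1 * rho ^+ 2 /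
    (var_const L alpha sigma * N%:R `^ (2 * alpha))))%:E)%E.
  apply: (noise_small_ball L0 alpha01 sigma0 iid sconv x (h x) N3 t0 _ rho0).
  apply: (le_trans tNM); rewrite ler_wpM2r ?exprn_ge0//.
    by rewrite mulr_ge0// ltW.
  by have /andP[] := tT.
have majorant w : Y w <= \1_A w + (\1_E w + r `^ (- p)).
  rewrite !indicE; have [wA|wA] := boolP (w \in A).
    rewrite /Y -[leLHS]addr0; apply: lerD; first exact: fnl_powR_le1.
    by rewrite addr_ge0 ?powR_ge0.
  rewrite add0r /Y.
  have [_ /(_ x)[v [v1 v2 ->]]] : has_C1_repr L (u N t w) /\ forall x, exists v : R * R,
    [/\ `|v.1| <= D, `|v.2| <= D &
     grad_at L (u N t w) x =
      ((h x).1 + v.1 + \sum_(k <- kseq R N) amp1 L alpha sigma x k * Z k t w,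
       (h x).2 + v.2 + \sum_(k <- kseq R N) amp2 L alpha sigma x k * Z k t w)].
    by apply: contrapT => nw; move: wA; rewrite notin_setE; apply; exact: subA.
  rewrite !(addrAC _ v.1) !(addrAC _ v.2).
  apply: le_trans (fnl_powR_le _ _ p0 r0 D0 v1 v2) _.
  by rewrite lerD2r /E mem_setE.
have rp0 : 0 <= r `^ (- p) by exact: powR_ge0.
have mi (B : set Omega) : measurable B ->
    measurable_fun setT (fun w => (\1_B w)%:E : \bar R).
  by move=> mB; apply/measurable_EFinP; exact: measurable_indic.
have intg : (\int[P]_w (\1_A w + (\1_E w + r `^ (- p)))%:E =
   P A + (P E + (r `^ (- p))%:E))%E.
  under eq_integral do rewrite !EFinD.
  rewrite ge0_integralD//=; last 3 first.
  - exact: mi.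
  - by move=> w _; rewrite -EFinD lee_fin addr_ge0.
  - by apply: emeasurable_funD => //; exact: mi.
  rewrite ge0_integralD//=; last exact: mi.
  rewrite !integral_indic// !setIT integral_cst//.
  by rewrite [X in (_ * X)%E]probability_setT mule1.
have step : (\int[P]_w (Y w)%:E <=
    \int[P]_w (\1_A w + (\1_E w + r `^ (- p)))%:E)%E.
  apply: le_nonmeasurable_integral => w; first by rewrite lee_fin powR_ge0.
  by rewrite lee_fin; exact: majorant.
rewrite unlock; apply: (le_trans step).
rewrite intg PA0 add0e.
apply: (le_trans (leeD PE (lexx _))); rewrite -EFinD lee_fin.
have rpE : r `^ (- p) = tN.
  by rewrite /r /tN -powRrM; congr (_ `^ _); field; rewrite gt_eqF.
have r2E : r ^+ 2 / N%:R `^ (2 * alpha) = tN.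
  rewrite -powRN -powR_mulrn ?(ltW r0)// /r -powRrM -powRD; last first.
    by rewrite (gt_eqF Npos) implybT.
  by rewrite /tN; congr (_ `^ _); field; rewrite gt_eqF.
have N2a : 0 < N%:R `^ (2 * alpha) :> R by exact: powR_gt0.
rewrite rpE -/tN.
have -> : C * tN = 4 * (expR 1 * (2 + 2 * D) ^+ 2 / var_const L alpha sigma * tN) + tN.
  by rewrite /C; ring.
rewrite lerD2r; apply: ler_wpM2l => //.
apply: (@le_trans _ _ (expR 1 * ((2 + 2 * D) * r) ^+ 2 /
    (var_const L alpha sigma * N%:R `^ (2 * alpha)))).
  apply: ler_wpM2r; first by rewrite invr_ge0 mulr_ge0// ltW.
  apply: ler_wpM2l; first exact: expR_ge0.
  apply: lerXn2r; rewrite ?nnegrE ?(ltW rho0)//.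
    by apply: mulr_ge0; [lra|exact: ltW].
  rewrite /rho; nra.
rewrite -r2E le_eqVlt; apply/orP; left; apply/eqP.
by field; rewrite !gt_eqF.
Qed.
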